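(* Let $A\to M$ be a vector bundle, let $\mu+\phi$ be a pre-Jacobi algebroid structure on $A$ (with $\mu\in\mathcal F_A^{1,2}$, $\phi\in\Gamma(A^* )=\mathcal F_A^{0,1}$) and let $\nu+X$ be a pre-Jacobi algebroid structure on $A^*$ (with $\nu\in\mathcal F_A^{2,1}$, $X\in\Gamma(A)=\mathcal F_A^{1,0}$). Set $$\diamondsuit:=\{\phi,X\}=\phi(X),\qquad \clubsuit:=\{\mu,X\}+\{\nu,\phi\},$$ $$\spadesuit:=\{\mu,\nu\}+\mu X+\nu\phi-\mathrm{id}_A\left(-\phi X+\frac{\{\mu,X\}-\{\nu,\phi\}}{2}\right).$$ 1. The pair $(\mu+\phi,\nu+X)$ is a pre-Jacobi bialgebroid if and only if $\diamondsuit=\clubsuit=\spadesuit=0$. 2. The pair $(\mu+\phi,\nu+X)$ is a Jacobi bialgebroid if and only if $\diamondsuit=\clubsuit=\spadesuit=\{\mu+\phi,\mu+\phi\}=\{\nu+X,\nu+X\}=0$.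
   Context: **Big bracket.** For a vector bundle $A\to M$ of rank $d$ over an $n$-manifold, $\mathcal F_A=\bigoplus_{k,l\in\mathbb N}\mathcal F_A^{k,l}$ denotes the bigraded algebra of functions on the graded manifold $T^*\Pi A$. Locally it is generated, over the smooth functions of coordinates $x_1,\dots,x_n$ of $M$ (bi-degree $(0,0)$), by $p^1,\dots,p^n$ (bi-degree $(1,1)$), $\xi_1,\dots,\xi_d$ (bi-degree $(0,1)$, a local frame of $A^*$) and $\theta^1,\dots,\theta^d$ (bi-degree $(1,0)$, the dual local frame of $A$), with polynomial dependence in the $p^i$. It is graded commutative for the total degree: $F_1F_2=(-1)^{(k_1+l_1)(k_2+l_2)}F_2F_1$ for $F_i\in\mathcal F_A^{k_i,l_i}$. The big bracket $\{\cdot,\cdot\}$ is the canonical graded Poisson bracket, of bi-degree $(-1,-1)$, satisfying $\{F_1,F_2\}=-(-1)^{(k_1+l_1)(k_2+l_2)}\{F_2,F_1\}$, $\{F_1,F_2F_3\}=\{F_1,F_2\}F_3+(-1)^{(k_1+l_1)(k_2+l_2)}F_2\{F_1,F_3\}$, $\{F_1,\{F_2,F_3\}\}=\{\{F_1,F_2\},F_3\}+(-1)^{(k_1+l_1)(k_2+l_2)}\{F_2,\{F_1,F_3\}\}$, with $\{p^i,x_i\}=\{\theta^j,\xi_j\}=1$ and all other brackets of coordinates vanishing. One identifies $\mathcal F_A^{0,0}=C^\infty(M)$, $\mathcal F_A^{k,0}=\Gamma(\wedge^kA)$, $\mathcal F_A^{0,k}=\Gamma(\wedge^kA^* )$ (as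 graded algebras, the product being the wedge product); for $\xi\in\Gamma(A^* ),\theta\in\Gamma(A)$ one has $\{\xi,\theta\}=\{\theta,\xi\}=\xi(\theta)$. $\mathrm{id}_A:=\sum_j\xi_j\theta^j\in\mathcal F_A^{1,1}$. There is a canonical isomorphism $\mathcal F_A\simeq\mathcal F_{A^*}$ of graded Poisson algebras exchanging $\mathcal F_A^{k,l}$ and $\mathcal F_{A^*}^{l,k}$; it is used to regard structures on $A^*$ as elements of $\mathcal F_A$. **Definitions.** $\Gamma(\bigwedge A)=\bigoplus_k\Gamma(\wedge^kA)$. A pre-Jacobi algebroid on $A$ is a function $\mu+\phi$ with $\mu\in\mathcal F_A^{1,2}$, $\phi\in\mathcal F_A^{0,1}=\Gamma(A^* )$; its bracket on $\Gamma(\bigwedge A)$ is $[P,Q]_{\mu,\phi}:=\{\{P,\mu+\mathrm{id}_A\phi\},Q\}-P\{\phi,Q\}+\{P,\phi\}Q$. It is a Jacobi algebroid if $\{\mu+\phi,\mu+\phi\}=0$. A pre-Jacobi algebroid on $A^*$ is (viewed in $\mathcal F_A$) a function $\nu+X$ with $\nu\in\mathcal F_A^{2,1}$, $X\in\mathcal F_A^{1,0}=\Gamma(A)$; its differential on $\Gamma(\bigwedge A)$ is $\mathsf d_{\nu,X}(P):=\{\nu,P\}+XP$. A pair $(\mu+\phi,\nu+X)$ of a pre-Jacobi algebroid on $A$ and one on $A^*$ is a pre-Jacobi bialgebroid if $\mathsf d_{\nu,X}[a,b]_{\mu,\phi}=[\mathsf d_{\nu,X}a,b]_{\mu,\phi}+(-1)^{k-1}[a,\mathsf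 d_{\nu,X}b]_{\mu,\phi}$ for all $k$, $a\in\Gamma(\wedge^kA)$, $b\in\Gamma(\bigwedge A)$. It is a Jacobi bialgebroid if moreover $\mu+\phi$ is a Jacobi algebroid and $\mathsf d_{\nu,X}$ squares to $0$. *)

(* Defs.v *)
From mathcomp Require Import all_boot all_order all_algebra.
From mathcomp Require Import boolp classical_sets functions cardinality reals.
From mathcomp Require Import topology normedtype derive.
(* The notations of mpoly clash with those of mathcomp-analysis. *)
From mathcomp.multinomials Require Import -(notations) mpoly.

Set Implicit Arguments.
Unset Strict Implicit.
Unset Printing Implicit Defensive.

Import Order.TTheory GRing.Theory Num.Theory numFieldNormedType.Exports.

Local Open Scope classical_set_scope.
Local Open Scope ring_scope.

(** * Smooth functions, manifolds, vector bundles *)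

Section Smooth.
Variables (R : realType) (n : nat).
Implicit Types (f : 'rV[R]_n -> R) (V : set 'rV[R]_n).

Definition partial (i : 'I_n) f : 'rV[R]_n -> R := fun v => 'D_('e_i) f v.

Fixpoint partials (s : seq 'I_n) f : 'rV[R]_n -> R :=
  if s is i :: s' then partial i (partials s' f) else f.

(* C^oo on an open set V: all iterated partial derivatives exist and are
   continuous at every point of V (no condition outside V). *)
Definition smooth_on V f : Prop :=
  forall (s : seq 'I_n) v, V v ->
    {for v, continuous (partials s f)} /\
    forall i, derivable (partials s f) v 'e_i.

End Smooth.

Record manifold (R : realType) (n : nat) := Manifold {
  mspace :> topologicalType;
  mchart : Type;
  mdom : mchart -> set mspace;
  mcoord : mchart -> mspace -> 'rV[R]_n;
  mparam : mchart -> 'rV[R]_n -> mspace;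
  m_hausdorff : hausdorff_space mspace;
  m_second_countable : @second_countable mspace;
  m_cover : forall x, exists c, mdom c x;
  m_open_dom : forall c, open (mdom c);
  m_open_cod : forall c, open (mcoord c @` mdom c);
  m_coordK : forall c x, mdom c x -> mparam c (mcoord c x) = x;
  m_coord_continuous : forall c, {within mdom c, continuous (mcoord c)};
  m_param_continuous :
    forall c, {within mcoord c @` mdom c, continuous (mparam c)};
  m_transition : forall c c' (j : 'I_n),
    smooth_on (mcoord c @` (mdom c `&` mdom c'))
              (fun v => mcoord c' (mparam c v) 0 j)
}.

Definition msmooth (R : realType) (n : nat) (M : manifold R n)
    (W : set M) (g : M -> R) : Prop :=
  forall c : mchart M,
    smooth_on (mcoord c @` (W `&` mdom c)) (fun v => g (mparam c v)).

(* A rank-d vector bundle, given by its fibres and by local frames over an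
   open cover of M; two frames are related by smooth functions.  (These data
   determine the manifold structure of the total space.) *)
Record vbundle (R : realType) (n : nat) (M : manifold R n) (d : nat) :=
  VBundle {
  vfibre : M -> vectType R;
  vtriv : Type;
  vdom : vtriv -> set M;
  vframe : vtriv -> forall x : M, d.-tuple (vfibre x);
  v_open_dom : forall t, open (vdom t);
  v_cover : forall x, exists t, vdom t x;
  v_basis : forall t x, vdom t x -> basis_of fullv (vframe t x);
  v_transition : forall t t' (a b : 'I_d),
    msmooth (vdom t `&` vdom t')
      (fun x => coord (vframe t x) b (tnth (vframe t' x) a))
}.

(** * The algebra K[p^1..p^n] (x) /\(theta^1..theta^d, xi_1..xi_d) *)

(* An element F is the sum over the sets S of odd generators of F S * e_S,
   where e_S is the product of the elements of S in increasing order.  The odd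
   generators are ordered as theta^1 < .. < theta^d < xi_1 < .. < xi_d. *)
Definition spoly (K : comNzRingType) (n d : nat) : Type :=
  {ffun {set 'I_(d + d)} -> mpoly n K}.

Section SuperPolynomials.
Variables (K : comNzRingType) (n d : nat).
Implicit Types (F G : spoly K n d) (S A B : {set 'I_(d + d)}).

Definition sconst (a : mpoly n K) : spoly K n d :=
  [ffun S => if S == finset.set0 then a else 0].
Definition sone : spoly K n d := sconst 1.
Definition pgen (i : 'I_n) : spoly K n d := sconst (mpolyX K (mnm1 i)).
Definition ogen (s : 'I_(d + d)) : spoly K n d :=
  [ffun S => if S == [set s]%SET then 1 else 0].
Definition theta_idx (j : 'I_d) : 'I_(d + d) := lshift d j.
Definition xi_idx (j : 'I_d) : 'I_(d + d) := rshift d j.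
Definition theta (j : 'I_d) : spoly K n d := ogen (theta_idx j).
Definition xi (j : 'I_d) : spoly K n d := ogen (xi_idx j).

(* For disjoint A and B: e_A e_B = (-1)^(inversions A B) e_(A U B). *)
Definition inversions A B : nat :=
  #|[set u : 'I_(d + d) * 'I_(d + d) |
      [&& u.1 \in A, u.2 \in B & (u.2 < u.1)%N]]%SET|.

Definition smul F G : spoly K n d :=
  [ffun S : {set 'I_(d + d)} => \sum_(A : {set 'I_(d + d)} | A \subset S)
     (-1) ^+ inversions A (S :\: A)%SET * (F A * G (S :\: A)%SET)].

Definition sderiv_p (i : 'I_n) F : spoly K n d :=
  [ffun S => mderiv i (F S)].

(* Left and right derivatives along an odd generator: e_s e_S is mapped to e_S
   by the former, e_S e_s is mapped to e_S by the latter. *)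
Definition sderivl (s : 'I_(d + d)) F : spoly K n d :=
  [ffun S : {set 'I_(d + d)} => if s \in S then 0 else
     (-1) ^+ #|[set t in S | (t < s)%N]%SET| * F (s |: S)%SET].
Definition sderivr (s : 'I_(d + d)) F : spoly K n d :=
  [ffun S : {set 'I_(d + d)} => if s \in S then 0 else
     (-1) ^+ #|[set t in S | (s < t)%N]%SET| * F (s |: S)%SET].

(* p^i has bidegree (1,1), theta^j has (1,0) and xi_j has (0,1). *)
Definition shomog (k l : nat) F : Prop :=
  forall S (m : multinom n), mcoeff m (F S) != 0 ->
    (mdeg m + #|[set j : 'I_d | theta_idx j \in S]%SET|)%N = k /\
    (mdeg m + #|[set j : 'I_d | xi_idx j \in S]%SET|)%N = l.

(* Substitution of p' for the p^i and of e' for the odd generators. *)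
Definition ssubst (p' : 'I_n -> spoly K n d) (e' : 'I_(d + d) -> spoly K n d)
    F : spoly K n d :=
  \sum_(S : {set 'I_(d + d)}) \sum_(m <- msupp (F S))
    mcoeff m (F S) *:
      smul (\big[smul/sone]_(i < n) iter (m i) (smul (p' i)) sone)
           (\big[smul/sone]_(s in S) e' s).

End SuperPolynomials.

(** * Local functions on T^*Pi A and their canonical bracket *)

Section LocalFunctions.
Variables (R : realType) (n d : nat).

(* Coefficients are functions of the coordinates x_1..x_n; only their values on
   the image of the coordinate domain are meaningful. *)
Definition locfun : Type := spoly ('rV[R]_n -> R) n d.
Implicit Types F G : locfun.

Definition lmul F G : locfun := smul F G.

Definition leval (v : 'rV[R]_n) F : spoly R n d :=
  [ffun S => map_mpoly (fun f : 'rV[R]_n -> R => f v) (F S)].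

Definition lderiv_x (i : 'I_n) F : locfun :=
  [ffun S => map_mpoly (partial i) (F S)].

(* The biderivation with {p^i, x_i} = {theta^j, xi_j} = {xi_j, theta^j} = 1,
   {x_i, p^i} = -1 and all other brackets of coordinates equal to 0. *)
Definition lbracket F G : locfun :=
  \sum_(i < n) (lmul (sderiv_p i F) (lderiv_x i G)
                - lmul (lderiv_x i F) (sderiv_p i G)) +
  \sum_(j < d) (lmul (sderivr (theta_idx j) F) (sderivl (xi_idx j) G)
                + lmul (sderivr (xi_idx j) F) (sderivl (theta_idx j) G)).

End LocalFunctions.

(** * The bigraded Poisson algebra F_A *)

Section BigBracket.
Variables (R : realType) (n d : nat) (M : manifold R n) (A : vbundle M d).

(* Local coordinates of T^*Pi A: a chart of M together with a local frame. *)
Definition lcoord : Type := (mchart M * vtriv A)%type.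
Definition ldom (c : lcoord) : set M := mdom c.1 `&` vdom c.2.
Definition lcod (c : lcoord) : set 'rV[R]_n := mcoord c.1 @` ldom c.

(* A function on T^*Pi A is represented by its expressions in all the local
   coordinates; bigF below says when such a family is an element of F_A. *)
Definition bigfam : Type := lcoord -> locfun R n d.
Implicit Types F G : bigfam.

Definition feq F G : Prop :=
  forall c v, lcod c v -> leval v (F c) = leval v (G c).
Definition fmul F G : bigfam := fun c => lmul (F c) (G c).
Definition fscale (r : R) F : bigfam :=
  fun c => ((fun=> r) : 'rV[R]_n -> R) *: F c.
Definition bracket F G : bigfam := fun c => lbracket (F c) (G c).
Definition idA : bigfam := fun=> \sum_(j < d) lmul (xi _ n j) (theta _ n j).

Section Transition.
Variables (c c' : lcoord) (x : M).

(* Derivative at x of a function on M along the i-th coordinate of c'. *)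
Let partial' (i : 'I_n) (g : M -> R) : R :=
  partial i (fun v => g (mparam c'.1 v)) (mcoord c'.1 x).

Definition frame_change (y : M) : 'M[R]_d :=
  \matrix_(a, b) coord (vframe c.2 y) b (tnth (vframe c'.2 y) a).

(* The coordinates (p', theta', xi') of c' in terms of those of c at the point
   x.  With h := frame_change, theta'^a = \sum_b h_ab theta^b, the xi'_a form
   the frame dual to theta', and
     p'^i = \sum_j (d x_j / d x'_i) p^j
            + \sum_(e, b) (h^-1 (d h / d x'_i))_(e b) xi_e theta^b,
   which is the only element of bidegree (1,1) satisfying {p'^i, x'_j} =
   (i == j) and {p'^i, theta'^a} = 0 (hence also {p'^i, xi'_a} = 0). *)
Definition theta_change (a : 'I_d) : spoly R n d :=
  \sum_(b < d) frame_change x a b *: theta R n b.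

Definition xi_change (a : 'I_d) : spoly R n d :=
  \sum_(b < d) invmx (frame_change x) b a *: xi R n b.

Definition odd_change (s : 'I_(d + d)) : spoly R n d :=
  match fintype.split s with inl a => theta_change a | inr a => xi_change a end.

Definition p_change (i : 'I_n) : spoly R n d :=
  let dh : 'M[R]_d :=
    \matrix_(a, b) partial' i (fun y => frame_change y a b) in
  \sum_(j < n) partial' i (fun y => mcoord c.1 y 0 j) *: pgen R d j +
  \sum_(e < d) \sum_(b < d)
    (invmx (frame_change x) *m dh) e b *: smul (xi R n e) (theta R n b).

End Transition.

Definition compatible F : Prop :=
  forall c c' x, ldom c x -> ldom c' x ->
    leval (mcoord c.1 x) (F c) =
    ssubst (p_change c c' x) (odd_change c c' x)
           (leval (mcoord c'.1 x) (F c')).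

(* F is an element of F_A^{k,l}. *)
Definition bigF (k l : nat) F : Prop :=
  [/\ forall c S (m : multinom n), smooth_on (lcod c) (mcoeff m (F c S)),
      forall c v, lcod c v -> shomog k l (leval v (F c))
    & compatible F].

(* F is an element of Gamma(/\ A), the direct sum of the Gamma(/\^k A) =
   F_A^{k,0}. *)
Definition multisection F : Prop :=
  exists (N : nat) (G : nat -> bigfam),
    (forall k, bigF k 0 (G k)) /\ feq F (\sum_(k < N) G k).

End BigBracket.

Arguments idA {R n d M} A.

Notation "F ⋆ G" := (fmul F G) (at level 40, left associativity) : ring_scope.
Notation "⦃ F , G ⦄" := (bracket F G) (at level 0, F, G at level 99,
  format "⦃ F ,  G ⦄") : ring_scope.
Notation "F ≡ G" := (feq F G) (at level 70, no associativity) : ring_scope.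

(** * Jacobi algebroids and bialgebroids *)

Section JacobiBialgebroids.
Variables (R : realType) (n d : nat) (M : manifold R n) (A : vbundle M d).
Implicit Types mu phi nu X P Q a b : bigfam A.

Definition pre_jacobi_algebroid mu phi : Prop := bigF 1 2 mu /\ bigF 0 1 phi.

(* A pre-Jacobi algebroid on the dual bundle A^*, viewed in F_A. *)
Definition pre_jacobi_algebroid_dual nu X : Prop :=
  bigF 2 1 nu /\ bigF 1 0 X.

Definition jbracket mu phi P Q : bigfam A :=
  ⦃⦃P, mu + idA A ⋆ phi⦄, Q⦄ - P ⋆ ⦃phi, Q⦄ + ⦃P, phi⦄ ⋆ Q.

Definition jacobi_algebroid mu phi : Prop :=
  pre_jacobi_algebroid mu phi /\ ⦃mu + phi, mu + phi⦄ ≡ 0.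

Definition jdiff nu X P : bigfam A := ⦃nu, P⦄ + X ⋆ P.

(* (-1)^(k-1) is written (-1)^(k+1), as k may be 0. *)
Definition pre_jacobi_bialgebroid mu phi nu X : Prop :=
  [/\ pre_jacobi_algebroid mu phi, pre_jacobi_algebroid_dual nu X
    & forall k a b, bigF k 0 a -> multisection b ->
        jdiff nu X (jbracket mu phi a b) ≡
        jbracket mu phi (jdiff nu X a) b
        + fscale ((-1) ^+ k.+1) (jbracket mu phi a (jdiff nu X b))].

Definition jacobi_bialgebroid mu phi nu X : Prop :=
  [/\ pre_jacobi_bialgebroid mu phi nu X, jacobi_algebroid mu phi
    & forall P, multisection P -> jdiff nu X (jdiff nu X P) ≡ 0].

Definition diamond phi X : bigfam A := ⦃phi, X⦄.

Definition club mu phi nu X : bigfam A := ⦃mu, X⦄ + ⦃nu, phi⦄.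

Definition spade mu phi nu X : bigfam A :=
  ⦃mu, nu⦄ + mu ⋆ X + nu ⋆ phi
  - idA A ⋆ (- (phi ⋆ X) + fscale 2^-1 (⦃mu, X⦄ - ⦃nu, phi⦄)).

End JacobiBialgebroids.

(* Main.v *)
Require Import Defs.
From HB Require Import structures.
From mathcomp Require Import all_boot all_order all_algebra ring lra zify.
From mathcomp Require Import boolp classical_sets functions cardinality reals.
From mathcomp Require Import topology normedtype derive realfun sequences exp.
From mathcomp.multinomials Require Import -(notations) mpoly.

Set Implicit Arguments.
Unset Strict Implicit.
Unset Printing Implicit Defensive.

Import Order.TTheory GRing.Theory Num.Theory numFieldNormedType.Exports.
Local Open Scope ring_scope.

(** Write d for the differential of (nu, X) and [a, b] for the bracket of
    (mu, phi).  For a of bidegree (k, 0) and b of bidegree (l, 0) let D(a, b) be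
    the difference of the two sides of the derivation rule.  Everything rests on
    the following identity ([sdefectE]), valid for arbitrary mu, phi, nu, X of the
    prescribed bidegrees:
      (-1)^k D(a, b) = {{a, spade}, b} + (k a {club, b} - l {a, club} b) / 2
                       + {a, club} b - a {club, b} + (k + l - 2) diamond a b.
    It is obtained by expanding D with the Leibniz and Jacobi identities.  What
    makes the expansion collapse is that functions of bidegrees (k, 0) and (l, 0)
    commute for the bracket ([hor_sbr]), and that id_A generates the Euler
    derivation, {id_A, F} = (l - k) F in bidegree (k, l) ([sidA_shomog]); the
    latter is where the coefficients k and l come from.

    If diamond, club and spade vanish, then so does D.  Conversely, D(1, 1) is
    -2 diamond; when diamond = 0, D(1, b) is -{club, b}; when moreover club = 0,
    D(a, b) is {{a, spade}, b} up to sign.  Brackets with x_i and theta^j are the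
    partial derivatives along p^i and xi_j, and a function of bidegree (k, l) with
    l > 0 whose derivatives along all p^i and xi_j vanish is itself 0
    ([test_eq0]).  So it is enough to know that D(a, b) = 0 for a and b among 1,
    x_i and theta^j ([tested_defect_eq0]).  In the same way the second part
    follows from
      2 d(d P) = {{nu, nu}, P} + 2 {nu, X} P  and
      {nu + X, nu + X} = {nu, nu} + 2 {nu, X}.

    These computations are carried out over a commutative ring K with commuting
    derivations.  To apply them near a point of the image of a coordinate system,
    K is taken to be the ring of smooth functions on an open neighbourhood V of
    this point; an element of F_A has an expression with coefficients in K
    ([rep_bigF]), and the operations of F_A become those over K ([rep_bracket]).
    That the derivations of K commute is the symmetry of second partial
    derivatives ([partialC]).

    For the converse the sections 1, x_i and theta^j have to be global, whereas
    coordinates and frames are local.  They are multiplied by a bump function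
    which is 1 on a neighbourhood of the point and whose support is a compact
    subset of the chart; extended by 0 these products are smooth in all
    coordinate systems ([bigF_test]) and agree near the point with the functions
    that are needed ([rep_test]). *)

(** * Super-polynomials as a ring *)

(** Locks the operations on super-polynomials, which are large finite sums, so
    that they are handled through their algebraic laws only. *)
Fact sring_key : unit. Proof. exact: tt. Qed.

Section SuperRing.
Variables (K : comNzRingType) (n d : nat).
Notation L := (mpoly n K).
Notation I := 'I_(d + d).
Implicit Types (A B C S U V : {set I}).

(** An alias of the type of super-polynomials on which the ring product is [smul]
    and not a componentwise one. *)
Definition sring : Type := spoly K n d.
HB.instance Definition _ := GRing.Zmodule.copy sring {ffun {set I} -> L}.
Implicit Types F G H : sring.

(** The coefficient of e_S in e_A e_B. *)
Definition structure_const A B S : L :=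
  if [disjoint A & B] && (A :|: B == S) then (-1) ^+ inversions A B else 0.

Lemma smulE F G S :
  (smul F G : sring) S = \sum_A \sum_B F A * G B * structure_const A B S.
Proof.
rewrite ffunE big_mkcond; apply: eq_bigr => A _; case: ifPn => AS.
  rewrite (bigD1 (S :\: A)) //= big1 ?addr0 => [|B nB].
    rewrite /structure_const.
    have ->: [disjoint A & S :\: A].
      by rewrite -setI_eq0 finset.setIDA finset.setIC -finset.setIDA finset.setDv finset.setI0.
    by rewrite finset.setDE finset.setUIr finset.setUCr finset.setIT (finset.setUidPr AS) eqxx mulrC.
  rewrite /structure_const; case: ifP; rewrite ?mulr0 // => /andP[dAB /eqP e].
  by case/eqP: nB; rewrite -e finset.setDUl finset.setDv finset.set0U (finset.setDidPl _) // disjoint_sym.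
rewrite big1 // => B _; rewrite /structure_const; case: ifP; rewrite ?mulr0 //.
by case/andP => _ /eqP e; rewrite -e finset.subsetUl in AS.
Qed.

Lemma inversionsUl A B C : [disjoint A & B] ->
  inversions (A :|: B) C = (inversions A C + inversions B C)%N.
Proof.
move=> dAB; rewrite /inversions -cardsUI.
rewrite [X in _ = (_ + X)%N](_ : _ = 0%N) ?addn0.
  by apply: eq_card => u; rewrite !finset.inE -andb_orl.
apply/eqP; rewrite cards_eq0 -finset.subset0; apply/fintype.subsetP => u; rewrite !finset.inE.
by case/andP => /andP[uA _] /andP[uB _]; rewrite (disjointFr dAB uA) in uB.
Qed.

Lemma inversionsUr A B C : [disjoint B & C] ->
  inversions A (B :|: C) = (inversions A B + inversions A C)%N.
Proof.
move=> dBC; rewrite /inversions -cardsUI.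
rewrite [X in _ = (_ + X)%N](_ : _ = 0%N) ?addn0.
  by apply: eq_card => u; rewrite !finset.inE; do 3!case: (_ \in _); case: (_ < _)%N.
apply/eqP; rewrite cards_eq0 -finset.subset0; apply/fintype.subsetP => u; rewrite !finset.inE.
case/andP => /andP[_ /andP[uB _]] /andP[_ /andP[uC _]].
by rewrite (disjointFr dBC uB) in uC.
Qed.

(** Both sides are the coefficient of e_S in e_A e_B e_C: inversions are additive
    in either argument on disjoint unions, so the total number of inversions does
    not depend on the bracketing. *)
Lemma structure_constA A B C S :
  \sum_U structure_const A B U * structure_const U C S =
  \sum_U structure_const A U S * structure_const B C U.
Proof.
rewrite (bigD1 (A :|: B)) //= big1 ?addr0 => [|U]; last first.
  rewrite eq_sym /structure_const => /negbTE ->.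
  by rewrite andbF mul0r.
rewrite (bigD1 (B :|: C)) //= big1 ?addr0 => [|U]; last first.
  rewrite eq_sym /structure_const => /negbTE ->.
  by rewrite andbF mulr0.
rewrite /structure_const !eqxx !andbT -finset.setUA.
have -> : [disjoint A :|: B & C] = [disjoint A & C] && [disjoint B & C].
  by rewrite -!setI_eq0 finset.setIUl finset.setU_eq0.
have -> : [disjoint A & B :|: C] = [disjoint A & B] && [disjoint A & C].
  by rewrite -!setI_eq0 finset.setIUr finset.setU_eq0.
have [dAB|] := boolP [disjoint A & B]; have [dBC|] := boolP [disjoint B & C];
  have [dAC|] := boolP [disjoint A & C]; case: eqP => _;
  rewrite ?mulr0 ?mul0r //=.
by rewrite -!exprD inversionsUl // inversionsUr //; congr (_ ^+ _); lia.
Qed.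

Lemma smulA : associative (@smul K n d : sring -> sring -> sring).
Proof.
move=> F G H; apply/ffunP => S; rewrite !smulE.
transitivity (\sum_A \sum_B \sum_C F A * G B * H C *
   \sum_U structure_const A U S * structure_const B C U).
  apply: eq_bigr => A _.
  under eq_bigr do rewrite smulE mulr_sumr mulr_suml.
  rewrite exchange_big; apply: eq_bigr => B _ /=.
  under eq_bigr do rewrite mulr_sumr mulr_suml.
  rewrite exchange_big; apply: eq_bigr => C _ /=.
  by rewrite mulr_sumr; apply: eq_bigr => U _; ring.
under eq_bigr do under eq_bigr do under eq_bigr do
  rewrite -structure_constA mulr_sumr.
under [RHS]eq_bigr do under eq_bigr do rewrite smulE !mulr_suml.
under [RHS]eq_bigr do rewrite exchange_big.
rewrite [RHS]exchange_big; apply: eq_bigr => A _ /=.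
under [RHS]eq_bigr do under eq_bigr do rewrite !mulr_suml.
under [RHS]eq_bigr do rewrite exchange_big.
rewrite [RHS]exchange_big; apply: eq_bigr => B _ /=.
rewrite [RHS]exchange_big; apply: eq_bigr => C _ /=.
by apply: eq_bigr => U _; ring.
Qed.

Lemma inversions0l A : inversions finset.set0 A = 0%N.
Proof. by apply/eqP; rewrite cards_eq0 -finset.subset0; apply/fintype.subsetP => u; rewrite !finset.inE. Qed.

Lemma inversions0r A : inversions A finset.set0 = 0%N.
Proof.
apply/eqP; rewrite cards_eq0 -finset.subset0; apply/fintype.subsetP => u; rewrite !finset.inE.
by rewrite andbF.
Qed.

Lemma smul_constE (a : L) F S : (smul (sconst _ a) F : sring) S = a * F S.
Proof.
rewrite ffunE (bigD1 finset.set0) ?finset.sub0set //= big1 => [|A /andP[_ nA]].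
  by rewrite addr0 ffunE eqxx inversions0l finset.setD0 mul1r.
by rewrite ffunE (negbTE nA) mul0r mulr0.
Qed.

Lemma smul1s : left_id (sone K n d) (@smul K n d : sring -> sring -> sring).
Proof. by move=> F; apply/ffunP => S; rewrite smul_constE mul1r. Qed.

Lemma smuls1 : right_id (sone K n d) (@smul K n d : sring -> sring -> sring).
Proof.
move=> F; apply/ffunP => S.
rewrite ffunE (bigD1 S) //= big1 => [|A /andP[sA nA]].
  by rewrite addr0 finset.setDv !ffunE eqxx inversions0r mul1r mulr1.
rewrite !ffunE ifF ?mulr0 //; apply/negbTE; rewrite finset.setD_eq0.
by apply: contra nA => sSA; rewrite finset.eqEsubset sA.
Qed.

Lemma smulDl : left_distributive (@smul K n d : sring -> sring -> sring) +%R.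
Proof.
move=> F G H; apply/ffunP => S; rewrite !ffunE -big_split.
by apply: eq_bigr => A _; rewrite ffunE mulrDl mulrDr.
Qed.

Lemma smulDr : right_distributive (@smul K n d : sring -> sring -> sring) +%R.
Proof.
move=> F G H; apply/ffunP => S; rewrite !ffunE -big_split.
by apply: eq_bigr => A _; rewrite ffunE !mulrDr.
Qed.

Lemma sone_neq0 : (sone K n d : sring) != 0.
Proof. by apply/eqP => /ffunP/(_ finset.set0); rewrite !ffunE eqxx; apply/eqP/oner_neq0. Qed.

Definition srmul : sring -> sring -> sring := locked_with sring_key (@smul K n d).

Lemma srmulE : srmul = @smul K n d. Proof. exact: locked_withE. Qed.

Lemma srmul_axioms : [/\ associative srmul, left_id (sone K n d : sring) srmul,
  right_id (sone K n d : sring) srmul, left_distributive srmul +%R &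
  right_distributive srmul +%R].
Proof.
rewrite srmulE; split; [exact: smulA | exact: smul1s | exact: smuls1 |
  exact: smulDl | exact: smulDr].
Qed.

HB.instance Definition _ := GRing.Zmodule_isNzRing.Build sring
  (let: And5 H _ _ _ _ := srmul_axioms in H)
  (let: And5 _ H _ _ _ := srmul_axioms in H)
  (let: And5 _ _ H _ _ := srmul_axioms in H)
  (let: And5 _ _ _ H _ := srmul_axioms in H)
  (let: And5 _ _ _ _ H := srmul_axioms in H) sone_neq0.

End SuperRing.

(** * Parity and derivations *)
Lemma sign_addnn (R : pzRingType) (p : nat) : (-1) ^+ (p + p) = 1 :> R.
Proof. by rewrite addnn -signr_odd odd_double. Qed.

Definition sg (V : zmodType) (b : bool) (x : V) : V := if b then - x else x.

Section SuperDerivations.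
Variables (K : comNzRingType) (n d : nat).
Notation L := (mpoly n K).
Notation I := 'I_(d + d).
Notation sring := (sring K n d).
Implicit Types (A B C S U V : {set I}) (F G H : sring) (a : L) (s t : I).

Lemma sringM F G : F * G = smul F G.
Proof. by rewrite -[LHS]/(srmul F G) srmulE. Qed.

Definition scst a : sring := sconst d a.
Definition sgen s : sring := ogen K n s.
(** [flip] is the parity automorphism; it provides the signs of the Leibniz rules
    for elements that need not be homogeneous. *)
Definition flip : sring -> sring := locked_with sring_key
  (fun F => [ffun S : {set I} => (-1) ^+ #|S| * F S] : sring).
Definition flipn (e : bool) F : sring := if e then flip F else F.
Definition dl : I -> sring -> sring :=
  locked_with sring_key (fun s F => sderivl s F : sring).
Definition liftD : (L -> L) -> sring -> sring := locked_with sring_key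
  (fun D F => [ffun S : {set I} => D (F S)] : sring).

Lemma flipE F S : flip F S = (-1) ^+ #|S| * F S.
Proof. by rewrite /flip locked_withE ffunE. Qed.

Lemma dlE s F S : dl s F S = if s \in S then 0 else
     (-1) ^+ #|[set t in S | (t < s)%N]%SET| * F (s |: S)%SET.
Proof. by rewrite /dl locked_withE ffunE. Qed.

Lemma liftDE D F S : liftD D F S = D (F S).
Proof. by rewrite /liftD locked_withE ffunE. Qed.

Lemma sring_addE F G S : (F + G) S = F S + G S. Proof. by rewrite ffunE. Qed.
Lemma sring_zeroE S : (0 : sring) S = 0. Proof. by rewrite ffunE. Qed.
Lemma sring_oppE F S : (- F) S = - F S. Proof. by rewrite ffunE. Qed.
Lemma sring_mulnE F m S : (F *+ m) S = F S *+ m.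
Proof. by elim: m => [|m IH]; rewrite ?mulr0n ?ffunE // !mulrS sring_addE IH. Qed.

Definition sringE := (flipE, dlE, liftDE, sring_addE, sring_oppE).

Lemma scstE a S : scst a S = if S == finset.set0 then a else 0.
Proof. by rewrite ffunE. Qed.

Lemma scst_mulE a F S : (scst a * F) S = a * F S.
Proof. by rewrite sringM; exact: smul_constE. Qed.

Lemma scst_is_zmod_morphism : zmod_morphism scst.
Proof.
by move=> a b; apply/ffunP => S; rewrite !(sringE, ffunE); case: ifP; rewrite ?subr0.
Qed.
HB.instance Definition _ := GRing.isZmodMorphism.Build L sring scst scst_is_zmod_morphism.

Lemma scst_is_monoid_morphism : monoid_morphism scst.
Proof.
split=> [|a b]; first by [].
by apply/ffunP => S; rewrite scst_mulE !(sringE, ffunE); case: ifP; rewrite ?mulr0.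
Qed.
HB.instance Definition _ :=
  GRing.isMonoidMorphism.Build L sring scst scst_is_monoid_morphism.

Lemma signM_E (e : nat) F S : ((-1) ^+ e * F) S = (-1) ^+ e * F S.
Proof.
by elim: e F => [|e IH] F; rewrite ?mul1r // !exprSr -!mulrA IH !mulN1r ffunE.
Qed.

(** Multiplying by a generator on the left creates an inversion for each smaller
    element of the set. *)
Lemma sgen_mulE t F S :
  (sgen t * F) S = if t \in S then
     (-1) ^+ #|[set u in S | (u < t)%N]%SET| * F (S :\ t) else 0.
Proof.
rewrite sringM ffunE; case: ifPn => tS; last first.
  rewrite big1 // => A AS; rewrite ffunE ifF ?mul0r ?mulr0 //.
  by apply: contraNF tS => /eqP e; rewrite -finset.sub1set -e.
rewrite (bigD1 [set t]%SET) ?finset.sub1set //= big1 => [|A /andP[_ nA]].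
  rewrite addr0 ffunE eqxx mul1r; congr (_ ^+ _ * _).
  have inj : injective (fun u : I => (t, u)) by move=> u v [].
  rewrite /inversions -[in RHS](card_imset _ inj).
  apply: eq_card => -[v u]; rewrite !finset.inE /=; apply/idP/idP.
    case/and3P => /eqP-> /andP[_ uS] ut; apply/imsetP; exists u => //.
    by rewrite finset.inE uS.
  case/imsetP => w; rewrite finset.inE => /andP[wS wt] [-> ->]; rewrite eqxx wS wt.
  by rewrite !andbT /=; apply: contraTneq wt => ->; rewrite ltnn.
by rewrite ffunE (negbTE nA) mul0r mulr0.
Qed.

Lemma mul_sgenE t F S :
  (F * sgen t) S = if t \in S then
     (-1) ^+ #|[set u in S | (t < u)%N]%SET| * F (S :\ t) else 0.
Proof.
rewrite sringM ffunE; case: ifPn => tS; last first.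
  rewrite big1 // => A AS; rewrite [ogen _ _ _ _]ffunE ifF ?mulr0 //.
  by apply: contraNF tS => /eqP e; have := set11 t; rewrite -e finset.inE => /andP[].
have StS : S :\ t \subset S by rewrite subsetDl.
have e0 : S :\: (S :\ t) = [set t]%SET.
  by rewrite finset.setDDr finset.setDv finset.set0U; apply/finset.setIidPr; rewrite finset.sub1set.
rewrite (bigD1 (S :\ t)) //= big1 => [|A /andP[AS nA]].
  rewrite addr0 e0 [ogen _ _ _ _]ffunE eqxx mulr1; congr (_ ^+ _ * _).
  have inj : injective (fun u : I => (u, t)) by move=> u v [].
  rewrite /inversions -[in RHS](card_imset _ inj).
  apply: eq_card => -[u v]; rewrite !finset.inE /=; apply/idP/idP.
    case/and3P => /andP[_ uS] /eqP-> ut; apply/imsetP; exists u => //.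
    by rewrite finset.inE uS.
  case/imsetP => w; rewrite finset.inE => /andP[wS wt] [-> ->]; rewrite eqxx wS wt.
  by rewrite !andbT /=; apply: contraTneq wt => ->; rewrite ltnn.
rewrite [ogen _ _ _ _]ffunE ifF ?mulr0 //; apply: contraNF nA => /eqP e.
by rewrite -e finset.setDDr finset.setDv finset.set0U; apply/eqP/esym/finset.setIidPr.
Qed.

Definition sbasis A : sring := [ffun S => (S == A)%:R].

Lemma sum_sringE (J : Type) (r : seq J) (P : pred J) (f : J -> sring) S :
  (\sum_(j <- r | P j) f j) S = \sum_(j <- r | P j) f j S.
Proof. by elim/big_rec2: _ => [|j x y _ <-]; rewrite ffunE. Qed.

Lemma sring_sum F : F = \sum_A scst (F A) * sbasis A.
Proof.
apply/ffunP => S; rewrite sum_sringE (bigD1 S) //= big1 => [|A nA].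
  by rewrite addr0 scst_mulE ffunE eqxx mulr1.
by rewrite scst_mulE ffunE eq_sym (negbTE nA) mulr0.
Qed.

Lemma sbasis0 : sbasis finset.set0 = 1.
Proof. by apply/ffunP => S; rewrite !(sringE, ffunE); case: eqP. Qed.

Lemma sbasisD1 s A : s \in A -> exists e : nat,
  sbasis A = (-1) ^+ e * (sgen s * sbasis (A :\ s)).
Proof.
move=> sA; exists #|[set u in A | (u < s)%N]%SET|; apply/ffunP => S.
rewrite signM_E sgen_mulE !(sringE, ffunE); case: eqP => [->|nSA].
  by rewrite sA eqxx mulr1 -exprD addnn -signr_odd odd_double.
case: ifPn; rewrite ?mulr0 // => sS; case: eqP => [e|_]; rewrite ?mulr0 //.
by case: nSA; rewrite -(finset.setD1K sS) e finset.setD1K.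
Qed.

(** Super-polynomials are obtained from 1 by sums and by left multiplication with
    scalars and odd generators; identities between additive operators that satisfy
    a Leibniz rule are thus reduced to generators. *)
Lemma sring_ind (P : sring -> Prop) :
  P 0 -> (forall F G, P F -> P G -> P (F + G)) -> P 1 ->
  (forall a F, P F -> P (scst a * F)) ->
  (forall s F, P F -> P (sgen s * F)) -> forall F, P F.
Proof.
move=> P0 PD P1 PC Pg F; rewrite (sring_sum F).
elim/big_ind: _ => // A _; apply: (PC (F A)).
elim: {A}_.+1 {-2}A (ltnSn #|A|) => // m IH A; rewrite ltnS => cA.
have [->|[s sA]] := set_0Vmem A; first by rewrite sbasis0.
have [e ->] := sbasisD1 sA; have := PC ((-1) ^+ e).
rewrite rmorphXn rmorphN1; apply; apply: Pg; apply: IH.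
by rewrite (cardsD1 s A) sA in cA; apply: leq_trans cA.
Qed.

Lemma flip_is_zmod_morphism : zmod_morphism flip.
Proof. by move=> F G; apply/ffunP => S; rewrite !(sringE, ffunE) mulrBr. Qed.
HB.instance Definition _ :=
  GRing.isZmodMorphism.Build sring sring flip flip_is_zmod_morphism.

Lemma flip_is_monoid_morphism : monoid_morphism flip.
Proof.
split=> [|F G]; apply/ffunP => S; rewrite ?sringM !(sringE, ffunE).
  by case: eqP => [->|]; rewrite ?mulr0 // cards0 mul1r.
rewrite mulr_sumr; apply: eq_bigr => A AS; rewrite !sringE.
by rewrite -(cardsID A S) (finset.setIidPr AS) exprD; ring.
Qed.
HB.instance Definition _ :=
  GRing.isMonoidMorphism.Build sring sring flip flip_is_monoid_morphism.

Lemma flipM F G : flip (F * G) = flip F * flip G. Proof. exact: rmorphM. Qed.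
Lemma flipD F G : flip (F + G) = flip F + flip G. Proof. exact: raddfD. Qed.
Lemma flipN F : flip (- F) = - flip F. Proof. exact: raddfN. Qed.
Lemma flip_sum (J : Type) (r : seq J) (P : pred J) (f : J -> sring) :
  flip (\sum_(j <- r | P j) f j) = \sum_(j <- r | P j) flip (f j).
Proof. exact: raddf_sum. Qed.

Lemma flipK : involutive flip.
Proof.
move=> F; apply/ffunP => S; rewrite !(sringE, ffunE) mulrA -exprD addnn -signr_odd.
by rewrite odd_double mul1r.
Qed.

Lemma flip_scst a : flip (scst a) = scst a.
Proof.
by apply/ffunP => S; rewrite !(sringE, ffunE); case: eqP => [->|]; rewrite ?mulr0 // cards0 mul1r.
Qed.

Lemma flip_sgen s : flip (sgen s) = - sgen s.
Proof.
apply/ffunP => S; rewrite !(sringE, ffunE); case: eqP => [->|_].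
  by rewrite cards1 mulr1.
by rewrite mulr0 oppr0.
Qed.

Lemma flip_liftD (D : {additive L -> L}) F : flip (liftD D F) = liftD D (flip F).
Proof.
apply/ffunP => S; rewrite !(sringE, ffunE) -signr_odd.
by rewrite !mulr_sign; case: (odd _); rewrite ?raddfN.
Qed.

(** Only the odd generators count for the parity: the momenta have bidegree (1, 1),
    hence even total degree. *)
Definition par (e : bool) F := forall S, odd #|S| != e -> F S = 0.

Lemma par_flip e F : par e F -> flip F = sg e F.
Proof.
move=> pF; apply/ffunP => S; rewrite flipE -signr_odd.
have [->|/pF F0] := eqVneq (odd #|S|) e.
  by case: e {pF}; rewrite ?mulN1r ?mul1r // /sg ffunE.
by case: e {pF}; rewrite /sg ?ffunE F0 mulr0 ?oppr0.
Qed.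

Lemma par0 e : par e 0. Proof. by move=> S _; rewrite ffunE. Qed.

Lemma parD e F G : par e F -> par e G -> par e (F + G).
Proof. by move=> pF pG S oS; rewrite ffunE pF // pG // addr0. Qed.

Lemma parN e F : par e F -> par e (- F).
Proof. by move=> pF S oS; rewrite ffunE pF // oppr0. Qed.

Lemma par_sum e (J : Type) (r : seq J) (P : pred J) (f : J -> sring) :
  (forall j, par e (f j)) -> par e (\sum_(j <- r | P j) f j).
Proof. by move=> pf; elim/big_ind: _ => // [|F G]; [exact: par0 | exact: parD]. Qed.

Lemma parM e f F G : par e F -> par f G -> par (e (+) f) (F * G).
Proof.
move=> pF pG S oS; rewrite sringM ffunE big1 // => A AS.
have cS : odd #|S| = odd #|A| (+) odd #|S :\: A|.
  by rewrite -(cardsID A S) (finset.setIidPr AS) oddD.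
have [eA|/pF->] := eqVneq (odd #|A|) e; last by rewrite mul0r mulr0.
have [eB|/pG->] := eqVneq (odd #|S :\: A|) f; last by rewrite !mulr0.
by rewrite cS eA eB eqxx in oS.
Qed.

Lemma par_scst a : par false (scst a).
Proof. by move=> S oS; rewrite scstE; case: ifP oS => // /eqP->; rewrite cards0. Qed.

Lemma par_flipF e F : par e F -> par e (flip F).
Proof. by move=> pF S oS; rewrite flipE pF // mulr0. Qed.

Lemma par_liftD e (D : {additive L -> L}) F : par e F -> par e (liftD D F).
Proof. by move=> pF S oS; rewrite liftDE pF // raddf0. Qed.

Lemma par_dl e s F : par e F -> par (~~ e) (dl s F).
Proof.
move=> pF S oS; rewrite dlE; case: ifPn => // sS; rewrite pF ?mulr0 //.
by rewrite cardsU1 sS /=; case: (odd _) oS; case: e {pF}.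
Qed.

Lemma flipnK e : involutive (flipn e).
Proof. by case: e => // F; rewrite /= flipK. Qed.

Lemma flipn_par e f F : par f F -> flipn e F = sg (e && f) F.
Proof. by case: e => [/par_flip|]. Qed.

(** Moving e_s across e_S costs a sign for each element of S; the elements on the
    left and on the right of s add up to all of S. *)
Lemma sgenC s G : sgen s * G = flip G * sgen s.
Proof.
apply/ffunP => S; rewrite sgen_mulE mul_sgenE; case: ifPn => // sS.
rewrite flipE mulrA -exprD; congr (_ * _).
have -> : #|S :\ s| = (#|[set u in S | (u < s)%N]%SET| +
             #|[set u in S | (s < u)%N]%SET|)%N.
  rewrite -cardsUI [X in _ = (_ + X)%N](_ : _ = 0%N) ?addn0.
    apply: eq_card => u; rewrite !finset.inE -andb_orr andbC; congr andb.
    by rewrite -neq_ltn.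
  apply/eqP; rewrite cards_eq0 -finset.subset0; apply/fintype.subsetP => u; rewrite !finset.inE.
  by case/andP => /andP[_ us] /andP[_]; rewrite ltnNge ltnW.
by rewrite -signr_odd -[RHS]signr_odd !oddD; do 2!case: (odd _).
Qed.

Lemma scstC a F : scst a * F = F * scst a.
Proof.
elim/sring_ind: F => [|F G IF IG||b F IF|s F IF].
- by rewrite mulr0 mul0r.
- by rewrite mulrDr mulrDl IF IG.
- by rewrite mulr1 mul1r.
- by rewrite -mulrA -IF !mulrA -!rmorphM mulrC.
- by rewrite -mulrA -IF !mulrA sgenC flip_scst.
Qed.

Lemma signC (e : nat) F : (-1) ^+ e * F = F * (-1) ^+ e.
Proof. by rewrite -signr_odd; case: (odd e); rewrite ?mulr1 ?mul1r // mulN1r mulrN1. Qed.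

Lemma sbasisC A G : sbasis A * G = flipn (odd #|A|) G * sbasis A.
Proof.
elim: {A}_.+1 {-2}A (ltnSn #|A|) G => // m IH A; rewrite ltnS => cA G.
have [->|[s sA]] := set_0Vmem A; first by rewrite sbasis0 cards0 mul1r mulr1.
have [e ->] := sbasisD1 sA.
rewrite -mulrA -[_ * _ * G]mulrA IH; last first.
  by rewrite (cardsD1 s A) sA in cA; apply: leq_trans cA.
rewrite [RHS]mulrA -[_ * (-1) ^+ e]signC -[RHS]mulrA; congr (_ * _).
have E : flip (flipn (odd #|A :\ s|) G) = flipn (odd #|A|) G.
  by rewrite (cardsD1 s A) sA /=; case: (odd _); rewrite /= ?flipK.
by rewrite !mulrA sgenC E.
Qed.

Lemma par_comm e F G : par e F -> F * G = flipn e G * F.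
Proof.
move=> pF; rewrite (sring_sum F) mulr_suml mulr_sumr; apply: eq_bigr => A _.
have [oA|/pF->] := eqVneq (odd #|A|) e; last by rewrite raddf0 !mul0r mulr0.
by rewrite -mulrA sbasisC oA !mulrA scstC.
Qed.

Lemma dl_is_zmod_morphism s : zmod_morphism (dl s).
Proof.
by move=> F G; apply/ffunP => S; rewrite !(sringE, ffunE); case: ifP; rewrite ?subr0 // mulrBr.
Qed.
HB.instance Definition _ s :=
  GRing.isZmodMorphism.Build sring sring (dl s) (dl_is_zmod_morphism s).

Lemma dl0 s : dl s 0 = 0. Proof. exact: raddf0. Qed.
Lemma dlD s F G : dl s (F + G) = dl s F + dl s G. Proof. exact: raddfD. Qed.
Lemma dlB s F G : dl s (F - G) = dl s F - dl s G. Proof. exact: raddfB. Qed.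
Lemma dl_sum s (J : Type) (r : seq J) (P : pred J) (f : J -> sring) :
  dl s (\sum_(j <- r | P j) f j) = \sum_(j <- r | P j) dl s (f j).
Proof. exact: raddf_sum. Qed.

Lemma dl_scstM s a F : dl s (scst a * F) = scst a * dl s F.
Proof.
apply/ffunP => S; rewrite dlE !scst_mulE dlE; case: ifP; rewrite ?mulr0 //.
by move=> _; rewrite mulrCA.
Qed.

Lemma dl_scst s a : dl s (scst a) = 0.
Proof.
apply/ffunP => S; rewrite !(sringE, ffunE); case: ifP => // _; case: eqP; rewrite ?mulr0 //.
by move=> e; have := setU11 s S; rewrite e finset.inE.
Qed.

(** The canonical anticommutation relations.  With [sring_ind] they determine the
    odd derivatives and yield their Leibniz rule [dlM] and anticommutation [dlC]. *)
Lemma dl_sgenM s t F : dl s (sgen t * F) = (s == t)%:R * F - sgen t * dl s F.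
Proof.
apply/ffunP => S; rewrite dlE sgen_mulE [in RHS]ffunE [X in _ = _ + X]ffunE.
rewrite sgen_mulE dlE.
have [<-|nst] := eqVneq s t; last first.
  rewrite mul0r [X in _ = X + _]ffunE add0r !finset.inE [t == s]eq_sym (negbTE nst) /=.
  have [tS|] := boolP (t \in S); last by rewrite mulr0 if_same oppr0.
  have [sS|sS] := boolP (s \in S); first by rewrite /= mulr0 oppr0.
  rewrite /=.
  have -> : (s |: S) :\ t = s |: (S :\ t).
    by apply/setP => u; rewrite !finset.inE; case: (eqVneq u s) => // ->; rewrite nst.
  rewrite -mulNr !mulrA; congr (_ * _).
  have -> : #|[set u in s |: S | (u < t)%N]| =
            ((s < t) + #|[set u in S | (u < t)%N]|)%N.
    rewrite (cardsD1 s) !finset.inE eqxx /=; congr (_ + _)%N; apply: eq_card => u.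
    by rewrite !finset.inE; case: eqP => [->|//]; rewrite (negbTE sS).
  have -> : #|[set u in S | (u < s)%N]| =
            ((t < s) + #|[set u in S :\ t | (u < s)%N]|)%N.
    rewrite (cardsD1 t) !finset.inE tS /=; congr (_ + _)%N; apply: eq_card => u.
    by rewrite !finset.inE andbA.
  move: nst; rewrite -(inj_eq val_inj) /= neq_ltn !exprD.
  case: ltngtP => //= _ _; ring.
rewrite mul1r setU11.
have [sS|sS] := boolP (s \in S).
  rewrite !finset.inE eqxx /= finset.setD1K // mulrA -exprD.
  rewrite (_ : #|[set t0 in S :\ s | (t0 < s)%N]| = #|[set u in S | (u < s)%N]|).
    by rewrite sign_addnn mul1r subrr.
  apply: eq_card => u; rewrite !finset.inE; case: eqP => // ->.
  by rewrite ltnn !andbF.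
rewrite oppr0 addr0 setU1K // mulrA -exprD.
rewrite (_ : #|[set u in s |: S | (u < s)%N]| = #|[set u in S | (u < s)%N]|).
  by rewrite sign_addnn mul1r.
apply: eq_card => u; rewrite !finset.inE; case: eqP => // ->.
by rewrite ltnn !andbF.
Qed.

Lemma dlM s F G : dl s (F * G) = dl s F * G + flip F * dl s G.
Proof.
elim/sring_ind: F G => [|F H IF IH||a F IF|t F IF] G.
- by rewrite mul0r dl0 mul0r (raddf0 flip) mul0r addr0.
- by rewrite mulrDl !dlD flipD IF IH !mulrDl addrACA.
- by rewrite -[1]/(scst 1) dl_scstM dl_scst mul0r add0r flip_scst.
- by rewrite -mulrA dl_scstM IF dl_scstM flipM flip_scst mulrDr !mulrA.
- rewrite -mulrA !dl_sgenM IF flipM flip_sgen mulrDr mulrBl !mulNr.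
  by rewrite opprD !mulrA addrA.
Qed.

Lemma dl_natM s (m : nat) F : dl s (m%:R * F) = m%:R * dl s F.
Proof. by rewrite !mulr_natl raddfMn. Qed.

Lemma dlC s t F : dl s (dl t F) = - dl t (dl s F).
Proof.
elim/sring_ind: F => [|F H IF IH||a F IF|u F IF].
- by rewrite !dl0 oppr0.
- by rewrite !dlD IF IH opprD.
- by rewrite -[1]/(scst 1) !dl_scst !dl0 oppr0.
- by rewrite !dl_scstM IF mulrN.
- rewrite !dl_sgenM !dlB !dl_natM !dl_sgenM IF.
  by rewrite mulrN opprK opprB opprD addrA addrAC.
Qed.

Lemma dl_flip s F : dl s (flip F) = - flip (dl s F).
Proof.
apply/ffunP => S; rewrite !(sringE, ffunE); case: ifPn => sS; rewrite ?mulr0 ?oppr0 //.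
by rewrite cardsU1 sS /= exprS; ring.
Qed.

Lemma dl_liftD s (D : {additive L -> L}) F : dl s (liftD D F) = liftD D (dl s F).
Proof.
apply/ffunP => S; rewrite !(sringE, ffunE); case: ifPn => sS; rewrite ?raddf0 //.
by rewrite -signr_odd !mulr_sign; case: (odd _); rewrite ?raddfN.
Qed.

Lemma sderivr_dl s F : sderivr s F = flip (dl s F).
Proof.
apply/ffunP => S; rewrite !(sringE, ffunE); case: ifPn => sS; rewrite ?mulr0 //.
rewrite mulrA -exprD; congr (_ * _).
have -> : #|S| = (#|[set u in S | (u < s)%N]%SET| +
             #|[set u in S | (s < u)%N]%SET|)%N.
  rewrite -cardsUI [X in _ = (_ + X)%N](_ : _ = 0%N) ?addn0.
    apply: eq_card => u; rewrite !finset.inE -andb_orr -neq_ltn; case: eqP => [/val_inj->|].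
      by rewrite (negbTE sS).
    by rewrite andbT.
  apply/eqP; rewrite cards_eq0 -finset.subset0; apply/fintype.subsetP => u; rewrite !finset.inE.
  by case/andP => /andP[_ us] /andP[_]; rewrite ltnNge ltnW.
by rewrite -signr_odd -[RHS]signr_odd !oddD; do 2!case: (odd _).
Qed.

Section LiftD.
Variable D : {additive L -> L}.
Lemma liftD_is_zmod_morphism : zmod_morphism (liftD D).
Proof. by move=> F G; apply/ffunP => S; rewrite !(sringE, ffunE) raddfB. Qed.
HB.instance Definition _ :=
  GRing.isZmodMorphism.Build sring sring (liftD D) liftD_is_zmod_morphism.

Lemma liftDM F G : (forall a b, D (a * b) = D a * b + a * D b) ->
  liftD D (F * G) = liftD D F * G + F * liftD D G.
Proof.
move=> DM; apply/ffunP => S; rewrite !sringM !(sringE, ffunE) raddf_sum -big_split.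
apply: eq_bigr => A AS; rewrite !(sringE, ffunE) -signr_odd !mulr_sign.
by case: (odd _); rewrite ?raddfN DM ?opprD.
Qed.

Lemma liftD_scst a : liftD D (scst a) = scst (D a).
Proof. by apply/ffunP => S; rewrite !(sringE, ffunE); case: eqP; rewrite ?raddf0. Qed.
End LiftD.

Lemma liftDC (D D' : {additive L -> L}) F : (forall a, D (D' a) = D' (D a)) ->
  liftD D (liftD D' F) = liftD D' (liftD D F).
Proof. by move=> DC; apply/ffunP => S; rewrite !(sringE, ffunE) DC. Qed.

End SuperDerivations.

(** * The canonical bracket over a ring with commuting derivations *)
(** Linear identities, whatever the products and brackets in them stand for. *)
Ltac sring_linear := let S := fresh in
  apply/ffunP => S; rewrite ?(sring_addE, sring_oppE, sring_zeroE, sring_mulnE);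
  ring.

Lemma sum2D (V : nmodType) (J J' : finType) (f g : J -> V) (f' g' : J' -> V) :
  (\sum_j f j + \sum_j f' j) + (\sum_j g j + \sum_j g' j) =
  \sum_j (f j + g j) + \sum_j (f' j + g' j).
Proof. by rewrite addrACA -!big_split. Qed.

Lemma sum2_eq (V : nmodType) (J J' : finType) (f g : J -> V) (f' g' : J' -> V) :
  f =1 g -> f' =1 g' -> \sum_j f j + \sum_j f' j = \sum_j g j + \sum_j g' j.
Proof. by move=> fg fg'; congr (_ + _); apply: eq_bigr. Qed.

Lemma sg0 (V : zmodType) b : sg b (0 : V) = 0.
Proof. by case: b; rewrite /sg ?oppr0. Qed.

Lemma sgK (V : zmodType) b (x : V) : sg b (sg b x) = x.
Proof. by case: b; rewrite /sg ?opprK. Qed.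

Lemma mul_sgr (R : pzRingType) b (x y : R) : x * sg b y = sg b (x * y).
Proof. by case: b; rewrite /sg ?mulrN. Qed.

Lemma mul_sgl (R : pzRingType) b (x y : R) : sg b x * y = sg b (x * y).
Proof. by case: b; rewrite /sg ?mulNr. Qed.

Lemma four_sums_cancel (V : zmodType) (a b u : V) : a + u - (b + a) - (- b + u) = 0.
Proof. by rewrite [- b + u]addrC opprB [b + a]addrC opprD [X in X + _]addrACA subrr add0r -[u - b]opprB addNr. Qed.

(** K plays the part of the functions of x_1..x_n, and Dx i that of the derivative
    along x_i. *)
Section Bracket.
Variables (K : comNzRingType) (n d : nat) (Dx : 'I_n -> {additive K -> K}).
Hypothesis DxM : forall i a b, Dx i (a * b) = Dx i a * b + a * Dx i b.
Hypothesis DxC : forall i j a, Dx i (Dx j a) = Dx j (Dx i a).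
Notation L := (mpoly n K).
Notation I := 'I_(d + d).
Notation sring := (sring K n d).
Implicit Types (S : {set I}) (F G H : sring) (a : L) (s t : I) (e f : bool).

Definition gconst (c : K) : sring := scst d (mpolyC n c).
Definition gmom (i : 'I_n) : sring := scst d (mpolyX K (mnm1 i)).

Lemma sring_gen_ind (P : sring -> Prop) :
  P 0 -> (forall F G, P F -> P G -> P (F + G)) -> P 1 ->
  (forall c F, P F -> P (gconst c * F)) ->
  (forall i F, P F -> P (gmom i * F)) ->
  (forall s F, P F -> P (sgen K n s * F)) -> forall F, P F.
Proof.
move=> P0 PD P1 PC PX Pg; apply: sring_ind => // a F PF.
pose Q b := forall F, P F -> P (scst d b * F).
have QM b b' : Q b -> Q b' -> Q (b * b').
  by move=> Qb Qb' G PG; rewrite rmorphM /= -mulrA; apply/Qb/Qb'.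
have Q1 : Q 1 by move=> G PG; rewrite rmorph1 mul1r.
suff: Q a by apply.
elim/mpolyind: a => [|c m b _ _ Qb] G PG; first by rewrite rmorph0 mul0r.
rewrite rmorphD /= mulrDl; apply: PD (Qb _ PG).
rewrite -mul_mpolyC; apply: (QM) PG => [G' PG'|]; first exact: PC.
rewrite mpolyXE_id; apply: big_ind => // i _.
by elim: (m i) => [|k IH]; rewrite ?expr0 // exprS; apply: QM => // ? ?; apply: PX.
Qed.

Definition dx i F : sring := liftD (map_mpoly (Dx i)) F.
Definition dp i F : sring := liftD (mderiv i) F.

Lemma dxD i F G : dx i (F + G) = dx i F + dx i G. Proof. exact: raddfD. Qed.
Lemma dpD i F G : dp i (F + G) = dp i F + dp i G. Proof. exact: raddfD. Qed.
Lemma dx_sum i (J : Type) (r : seq J) (P : pred J) (f : J -> sring) :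
  dx i (\sum_(j <- r | P j) f j) = \sum_(j <- r | P j) dx i (f j).
Proof. exact: raddf_sum. Qed.
Lemma dp_sum i (J : Type) (r : seq J) (P : pred J) (f : J -> sring) :
  dp i (\sum_(j <- r | P j) f j) = \sum_(j <- r | P j) dp i (f j).
Proof. exact: raddf_sum. Qed.
Lemma dx_flip i F : flip (dx i F) = dx i (flip F). Proof. exact: flip_liftD. Qed.
Lemma dp_flip i F : flip (dp i F) = dp i (flip F). Proof. exact: flip_liftD. Qed.
Lemma dl_dx s i F : dl s (dx i F) = dx i (dl s F). Proof. exact: dl_liftD. Qed.
Lemma dl_dp s i F : dl s (dp i F) = dp i (dl s F). Proof. exact: dl_liftD. Qed.
Lemma par_dx e i F : par e F -> par e (dx i F). Proof. exact: par_liftD. Qed.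
Lemma par_dp e i F : par e F -> par e (dp i F). Proof. exact: par_liftD. Qed.

Lemma dxM i F G : dx i (F * G) = dx i F * G + F * dx i G.
Proof.
apply: liftDM => a b; apply/mpolyP => m; rewrite mcoeff_map_mpoly mcoeffD.
rewrite !mcoeffM raddf_sum -big_split; apply: eq_bigr => k _.
by rewrite !mcoeff_map_mpoly DxM.
Qed.

Lemma dpM i F G : dp i (F * G) = dp i F * G + F * dp i G.
Proof. by apply: liftDM => a b; exact: mderivM. Qed.

Lemma dp_dx i j F : dp i (dx j F) = dx j (dp i F).
Proof.
apply: liftDC => a; apply/mpolyP => m.
by rewrite /= mcoeff_deriv !mcoeff_map_mpoly mcoeff_deriv raddfMn.
Qed.

Lemma dx_dx i j F : dx i (dx j F) = dx j (dx i F).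
Proof.
by apply: liftDC => a; apply/mpolyP => m; rewrite !mcoeff_map_mpoly DxC.
Qed.

Lemma dp_dp i j F : dp i (dp j F) = dp j (dp i F).
Proof. by apply: liftDC => a; exact: mderiv_comm. Qed.

(** Exchanges theta^j and xi_j, which are conjugate for the bracket. *)
Definition sdual s : I :=
  match fintype.split s with inl j => rshift d j | inr j => lshift d j end.

Lemma sdual_l j : sdual (lshift d j) = rshift d j.
Proof. by rewrite /sdual (unsplitK (inl _ j)). Qed.

Lemma sdual_r j : sdual (rshift d j) = lshift d j.
Proof. by rewrite /sdual (unsplitK (inr _ j)). Qed.

Lemma sdualK : involutive sdual.
Proof. by move=> s; rewrite -(splitK s); case: (fintype.split s) => j; rewrite /= ?sdual_l ?sdual_r ?sdual_l ?sdual_r. Qed.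

(** [flip (dl s F)] is the right derivative of F along s, see [sderivr_dl]. *)
Definition sbr : sring -> sring -> sring := locked_with sring_key (fun F G =>
  \sum_(i < n) (dp i F * dx i G - dx i F * dp i G) +
  \sum_s flip (dl s F) * dl (sdual s) G).

Lemma sbrE F G : sbr F G = \sum_(i < n) (dp i F * dx i G - dx i F * dp i G) +
  \sum_s flip (dl s F) * dl (sdual s) G.
Proof. by rewrite /sbr locked_withE. Qed.

Lemma sbrDl F G H : sbr (F + G) H = sbr F H + sbr G H.
Proof.
rewrite !sbrE sum2D; apply: sum2_eq => i.
  by rewrite dxD dpD !mulrDl opprD addrACA.
by rewrite dlD flipD mulrDl.
Qed.

Lemma sbrDr F G H : sbr F (G + H) = sbr F G + sbr F H.
Proof.
rewrite !sbrE sum2D; apply: sum2_eq => i.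
  by rewrite dxD dpD !mulrDr opprD addrACA.
by rewrite dlD mulrDr.
Qed.

Lemma sbr0l G : sbr 0 G = 0.
Proof. by apply: (addrI (sbr 0 G)); rewrite -sbrDl !addr0. Qed.
Lemma sbr0r F : sbr F 0 = 0.
Proof. by apply: (addrI (sbr F 0)); rewrite -sbrDr !addr0. Qed.
Lemma sbrNl F G : sbr (- F) G = - sbr F G.
Proof. by apply/eqP; rewrite -addr_eq0 -sbrDl addNr sbr0l. Qed.
Lemma sbrNr F G : sbr F (- G) = - sbr F G.
Proof. by apply/eqP; rewrite -addr_eq0 -sbrDr addNr sbr0r. Qed.
Lemma sbr_sumr F (J : Type) (r : seq J) (P : pred J) (f : J -> sring) :
  sbr F (\sum_(j <- r | P j) f j) = \sum_(j <- r | P j) sbr F (f j).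
Proof. by apply: (big_morph (sbr F)) => [G H|]; rewrite ?sbrDr ?sbr0r. Qed.
Lemma sbr_sgl e F G : sbr (sg e F) G = sg e (sbr F G).
Proof. by case: e => //; exact: sbrNl. Qed.
Lemma sbr_sgr e F G : sbr F (sg e G) = sg e (sbr F G).
Proof. by case: e => //; exact: sbrNr. Qed.

Lemma par_sbr e f F G : par e F -> par f G -> par (e (+) f) (sbr F G).
Proof.
move=> pF pG; rewrite sbrE; apply: parD; apply: par_sum => i.
  by apply: parD; first apply: parM; try apply: parN; try apply: parM;
     rewrite ?/dx; try exact: par_liftD.
have -> : e (+) f = (~~ e) (+) (~~ f) by case: e {pF}; case: f {pG}.
by apply: parM; first apply: par_flipF; apply: par_dl.
Qed.

Lemma flip_sbr F G : flip (sbr F G) = sbr (flip F) (flip G).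
Proof.
rewrite !sbrE flipD !flip_sum; apply: sum2_eq => i.
  by rewrite flipD flipN !flipM !dx_flip !dp_flip.
by rewrite flipM !dl_flip flipN mulrNN.
Qed.

Lemma flipn_sbr e F G : flipn e (sbr F G) = sbr (flipn e F) (flipn e G).
Proof. by case: e => //; exact: flip_sbr. Qed.

Lemma flipnNflip e F : flipn (~~ e) (flip F) = flipn e F.
Proof. by case: e => //=; rewrite flipK. Qed.

Lemma sbrMr e F G H : par e F ->
  sbr F (G * H) = sbr F G * H + flipn e G * sbr F H.
Proof.
move=> pF; rewrite !sbrE mulrDl mulrDr !mulr_suml !mulr_sumr.
rewrite sum2D; apply: sum2_eq => i.
  rewrite dxM dpM !mulrDr !mulrDl mulrN !mulrA.
  rewrite (par_comm G (par_dp i pF)) (par_comm G (par_dx i pF)) mulNr.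
  by rewrite opprD addrACA.
rewrite dlM mulrDr !mulrA (par_comm (flip G) (par_flipF (par_dl i pF))).
by rewrite flipnNflip.
Qed.

Lemma sbrMl h F G H : par h H ->
  sbr (F * G) H = F * sbr G H + sbr F H * flipn h G.
Proof.
move=> pH; rewrite !sbrE mulrDl mulrDr !mulr_suml !mulr_sumr.
have E b (A B : sring) : par b A -> B * A = A * flipn b B.
  by move=> pA; rewrite (par_comm _ pA) flipnK.
rewrite sum2D; apply: sum2_eq => i.
  rewrite dxM dpM !mulrDr !mulrDl !mulrN !mulNr -!mulrA.
  rewrite (E _ _ G (par_dp i pH)) (E _ _ G (par_dx i pH)).
  by rewrite opprD addrACA addrC.
rewrite dlM flipD mulrDl !flipM flipK -!mulrA.
by rewrite (E _ _ (flip G) (par_dl (sdual i) pH)) flipnNflip addrC.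
Qed.

Lemma sbrC e f F G : par e F -> par f G -> sbr G F = - sg (e && f) (sbr F G).
Proof.
move=> pF pG.
have E1 i : dp i G * dx i F - dx i G * dp i F =
    - sg (e && f) (dp i F * dx i G - dx i F * dp i G).
  rewrite (par_comm _ (par_dp i pG)) (par_comm _ (par_dx i pG)).
  rewrite (flipn_par f (par_dp i pF)) (flipn_par f (par_dx i pF)) andbC.
  by case: (e && f); rewrite /sg ?mulNr ?opprK ?opprB // addrC.
have E2 s : flip (dl (sdual s) G) * dl (sdual (sdual s)) F =
    - sg (e && f) (flip (dl s F) * dl (sdual s) G).
  have pF' := par_dl s pF; have pG' := par_dl (sdual s) pG.
  rewrite sdualK (par_flip pF') (par_flip pG') {pF pG}.
  transitivity (sg (~~ f) (dl (sdual s) G * dl s F)).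
    by case: (f); rewrite /sg ?mulNr.
  rewrite (par_comm _ pG') (flipn_par _ pF') {pF' pG'}.
  by case: (e); case: (f); rewrite /sg /= ?mulNr ?opprK.
rewrite !sbrE (eq_bigr _ (fun i _ => E1 i)).
rewrite [X in _ + X](reindex_inj (inv_inj sdualK)) (eq_bigr _ (fun s _ => E2 s)).
by case: (e && f); rewrite /sg ?sumrN ?opprD // ?opprK !sumrN ?opprK.
Qed.

(** An even derivation that commutes with all partial derivatives acts on the two
    arguments of the bracket in turn.  The derivatives along x_i and p^i are such
    derivations. *)
Lemma even_der_sbr (D : sring -> sring) :
  (forall F G, D (F + G) = D F + D G) ->
  (forall F G, D (F * G) = D F * G + F * D G) ->
  (forall F, D (flip F) = flip (D F)) -> (forall s F, D (dl s F) = dl s (D F)) ->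
  (forall i F, D (dp i F) = dp i (D F)) -> (forall i F, D (dx i F) = dx i (D F)) ->
  forall F G, D (sbr F G) = sbr (D F) G + sbr F (D G).
Proof.
move=> DD DM Df Dl Dp Dxx F G.
have D0 : D 0 = 0 by apply: (addrI (D 0)); rewrite -DD !addr0.
have DN H : D (- H) = - D H by apply/eqP; rewrite -addr_eq0 -DD addNr D0.
rewrite !sbrE DD !(big_morph D DD D0) sum2D; apply: sum2_eq => j.
  by rewrite DD DN !DM !Dp !Dxx; sring_linear.
by rewrite DM Df !Dl.
Qed.

Lemma dx_sbr i F G : dx i (sbr F G) = sbr (dx i F) G + sbr F (dx i G).
Proof.
apply: even_der_sbr => *; rewrite ?dx_flip ?dl_dx ?dp_dx //.
- exact: dxD.
- exact: dxM.
- exact: dx_dx.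
Qed.

Lemma dp_sbr i F G : dp i (sbr F G) = sbr (dp i F) G + sbr F (dp i G).
Proof.
apply: even_der_sbr => *; rewrite ?dp_flip ?dl_dp ?dp_dx //.
- exact: dpD.
- exact: dpM.
- exact: dp_dp.
Qed.

Lemma dl_sbr s F G : dl s (sbr F G) = sbr (dl s F) G + sbr (flip F) (dl s G).
Proof.
rewrite !sbrE dlD !dl_sum sum2D; apply: sum2_eq => j.
  rewrite dlB !dlM !dl_dp !dl_dx !dp_flip !dx_flip.
  by sring_linear.
rewrite dlM dl_flip flipK (dlC s j) flipN opprK dl_flip flipN flipK.
by rewrite (dlC s (sdual j)) mulrN mulNr.
Qed.

Lemma gconst_dl s c : dl s (gconst c) = 0. Proof. exact: dl_scst. Qed.
Lemma gconst_dp i c : dp i (gconst c) = 0.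
Proof. by rewrite /dp liftD_scst /= mderivC raddf0. Qed.
Lemma gconst_dx i c : dx i (gconst c) = gconst (Dx i c).
Proof. by rewrite /dx liftD_scst /= map_mpolyC. Qed.
Lemma gmom_dl s i : dl s (gmom i) = 0. Proof. exact: dl_scst. Qed.
Lemma gmom_dp i j : dp i (gmom j) = (i == j)%:R.
Proof.
rewrite /dp liftD_scst /= mderivX mnm1E eq_sym; case: eqP => [->|_].
  by rewrite scale1r -{1}[mnm1 j]add0m addmK mpolyX0 rmorph1.
by rewrite scale0r rmorph0.
Qed.
Lemma Dx1 i : Dx i 1 = 0.
Proof.
have := DxM i 1 1; rewrite !mulr1 mul1r => /eqP.
by rewrite -subr_eq0 opprD addrA subrr sub0r oppr_eq0 => /eqP.
Qed.
Lemma gmom_dx i j : dx i (gmom j) = 0.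
Proof.
rewrite /dx liftD_scst /=; apply/ffunP => S; rewrite scstE ffunE.
case: eqP => // _; apply/mpolyP => m; rewrite mcoeff_map_mpoly mcoeffX mcoeff0.
by rewrite -[_%:R]mulr1n; case: eqP => _; rewrite ?raddf0 // Dx1.
Qed.

Lemma sbr_gconst F c : sbr F (gconst c) = \sum_i dp i F * gconst (Dx i c).
Proof.
rewrite !sbrE [X in _ + X]big1 ?addr0 => [|s _]; last by rewrite gconst_dl mulr0.
by apply: eq_bigr => i _; rewrite gconst_dp gconst_dx mulr0 subr0.
Qed.

Lemma sbr_gmom F i : sbr F (gmom i) = - dx i F.
Proof.
rewrite !sbrE [X in _ + X]big1 ?addr0 => [|s _]; last by rewrite gmom_dl mulr0.
rewrite (bigD1 i) //= big1 => [|j nji].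
  by rewrite gmom_dx gmom_dp eqxx mulr0 mulr1 sub0r addr0.
by rewrite gmom_dx gmom_dp (negbTE nji) !mulr0 subr0.
Qed.

Lemma dl_sgen s t : dl s (sgen K n t) = (s == t)%:R.
Proof.
rewrite -[sgen K n t]mulr1 dl_sgenM -[X in dl s X]/(scst d 1) dl_scst mulr0 subr0.
exact: mulr1.
Qed.

Lemma sgen_liftD (D : {additive L -> L}) s : D 1 = 0 -> liftD D (sgen K n s) = 0.
Proof.
by move=> D1; apply/ffunP => S; rewrite liftDE !ffunE; case: eqP; rewrite ?D1 ?raddf0.
Qed.

Lemma sgen_dp i s : dp i (sgen K n s) = 0.
Proof. by apply: sgen_liftD; rewrite -[1]/(mpolyC n 1); exact: mderivC. Qed.

Lemma sgen_dx i s : dx i (sgen K n s) = 0.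
Proof.
apply: sgen_liftD; rewrite -[1]/(mpolyC n 1) /= map_mpolyC.
by rewrite Dx1 raddf0.
Qed.

Lemma sbr_sgen F s : sbr F (sgen K n s) = flip (dl (sdual s) F).
Proof.
rewrite !sbrE big1 ?add0r => [|i _]; last by rewrite sgen_dp sgen_dx !mulr0 subr0.
rewrite (bigD1 (sdual s)) //= big1 => [|t nts].
  by rewrite dl_sgen sdualK eqxx mulr1 addr0.
by rewrite dl_sgen (inv_eq sdualK) (negbTE nts) mulr0.
Qed.

Section Jacobi.
Variables (e f : bool) (F G : sring).
Hypotheses (pF : par e F) (pG : par f G).

(* The Jacobiator is in its third argument a derivation of the parity of {F, G}.
   So it vanishes if it does on generators, and there it expresses that partial
   derivatives are derivations of the bracket. *)
Let Z H := sbr F (sbr G H) - sbr (sbr F G) H - sg (e && f) (sbr G (sbr F H)).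

Let Z_der H H' : Z (H * H') = Z H * H' + flipn (e (+) f) H * Z H'.
Proof.
rewrite /Z !(sbrMr _ _ pF, sbrMr _ _ pG, sbrMr _ _ (par_sbr pF pG), sbrDr).
rewrite !flipn_sbr (flipn_par _ pG) (flipn_par _ pF) !sbr_sgl.
have -> : flipn f (flipn e H) = flipn (e (+) f) H.
  by case: (e); case: (f); rewrite /= ?flipK.
have -> : flipn e (flipn f H) = flipn (e (+) f) H.
  by case: (e); case: (f); rewrite /= ?flipK.
rewrite [f && e]andbC.
case: (e && f); rewrite /sg ?(mulrDl, mulrDr, mulNr, mulrN) ?mulrA; sring_linear.
Qed.

Let Z0 H : Z H = 0.
Proof.
elim/sring_gen_ind: H => [|H H' IH IH'||c H IH|i H IH|s H IH].
- by rewrite /Z !sbr0r sg0 !subr0.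
- rewrite -[RHS]addr0 -{1}IH -IH' /Z !sbrDr /sg; case: (e && f); sring_linear.
- rewrite -[1]/(gconst 1) /Z !sbr_gconst.
  have E (A : sring) : \sum_i dp i A * gconst (Dx i 1) = 0.
    by apply: big1 => i _; rewrite Dx1 /gconst !raddf0 mulr0.
  by rewrite !E !sbr0r sg0 !subr0.
(* {F, {G, c}} and {G, {F, c}} contain second derivatives of c; these cancel
   because the derivations Dx commute. *)
- rewrite Z_der IH mulr0 addr0.
  suff -> : Z (gconst c) = 0 by rewrite mul0r.
  rewrite /Z !sbr_gconst !sbr_sumr.
  rewrite (eq_bigr (fun i => sbr F (dp i G) * gconst (Dx i c) +
    \sum_j dp j F * dp i G * gconst (Dx j (Dx i c)))); last first.
    move=> i _; rewrite (sbrMr _ _ pF) sbr_gconst mulr_sumr; congr (_ + _).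
    by apply: eq_bigr => j _; rewrite mulrA -(par_comm _ (par_dp j pF)).
  rewrite [X in sg _ X](eq_bigr (fun i => sg (e && f)
    (- (sbr (dp i F) G * gconst (Dx i c)) +
    \sum_j dp i F * dp j G * gconst (Dx j (Dx i c))))); last first.
    move=> i _; rewrite (sbrMr _ _ pG) sbr_gconst (sbrC (par_dp i pF) pG).
    rewrite mulr_sumr (flipn_par _ (par_dp i pF)) [f && e]andbC /sg.
    case: (e && f); rewrite ?opprK ?mulNr ?opprD ?opprK -?sumrN; congr (_ + _).
      by apply: eq_bigr => j _; rewrite mulNr mulrA.
    by apply: eq_bigr => j _; rewrite mulrA.
  have sgs (g : 'I_n -> sring) : sg (e && f) (\sum_i sg (e && f) (g i)) = \sum_i g i.
    by rewrite /sg; case: (e && f) => //; rewrite sumrN opprK.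
  rewrite sgs.
  rewrite !big_split /= [X in _ - (_ + X)]exchange_big /=.
  under [X in _ - (_ + X)]eq_bigr do under eq_bigr do rewrite DxC.
  under [X in _ - X - _]eq_bigr do rewrite dp_sbr mulrDl.
  rewrite big_split /= sumrN; exact: four_sums_cancel.
- rewrite Z_der IH mulr0 addr0.
  suff -> : Z (gmom i) = 0 by rewrite mul0r.
  rewrite /Z !sbr_gmom !sbrNr dx_sbr (sbrC (par_dx i pF) pG) /sg.
  by case: (e && f); sring_linear.
- rewrite Z_der IH mulr0 addr0.
  suff -> : Z (sgen K n s) = 0 by rewrite mul0r.
  rewrite /Z !sbr_sgen dl_sbr flipD !flip_sbr flipK.
  have pdF := par_flipF (par_dl (sdual s) pF).
  rewrite (sbrC pdF pG) (par_flip pG) sbr_sgr.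
  by case: (e); case: (f); rewrite /sg /= ?opprK; sring_linear.
Qed.

Lemma sbr_jacobi H :
  sbr F (sbr G H) = sbr (sbr F G) H + sg (e && f) (sbr G (sbr F H)).
Proof. by apply/eqP; rewrite -subr_eq0 opprD addrA; apply/eqP/Z0. Qed.

End Jacobi.

End Bracket.

(** * The bigrading *)
Section Bidegree.
Variables (K : comNzRingType) (n d : nat) (Dx : 'I_n -> {additive K -> K}).
Hypothesis DxM : forall i a b, Dx i (a * b) = Dx i a * b + a * Dx i b.
Notation L := (mpoly n K).
Notation I := 'I_(d + d).
Notation sring := (sring K n d).
Notation sbr := (@sbr K n d Dx).
Notation dx := (@dx K n d Dx).
Implicit Types (S : {set I}) (F G H : sring) (s t : I) (a b k l : nat).

Definition ntheta S := #|[set j : 'I_d | theta_idx j \in S]%SET|.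
Definition nxi S := #|[set j : 'I_d | xi_idx j \in S]%SET|.

(** Bidegree (k - a, l - b), without subtraction of natural numbers: derivatives
    lower the degrees, and the derivative of an element of degree 0 vanishes. *)
Definition hom a k b l F := forall S (m : multinom n), mcoeff m (F S) != 0 ->
  (mdeg m + ntheta S + a = k /\ mdeg m + nxi S + b = l)%N.

Lemma hom_shomog a k b l F : hom a (k + a) b (l + b) F <-> shomog k l F.
Proof.
split=> hF S m /hF; first by move=> [/addIn-> /addIn->].
by move=> [<- <-].
Qed.

Lemma shomog_hom k l F : shomog k l F -> hom 0 k 0 l F.
Proof. by rewrite -(hom_shomog 0 _ 0) !addn0. Qed.

Lemma hom0 a k b l : hom a k b l 0.
Proof. by move=> S m; rewrite ffunE mcoeff0 eqxx. Qed.

Lemma homD a k b l F G : hom a k b l F -> hom a k b l G -> hom a k b l (F + G).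
Proof.
move=> hF hG S m; rewrite sring_addE mcoeffD.
have [->|/hF//] := eqVneq (mcoeff m (F S)) 0; rewrite add0r; exact: hG.
Qed.

Lemma homN a k b l F : hom a k b l F -> hom a k b l (- F).
Proof. by move=> hF S m; rewrite sring_oppE mcoeffN oppr_eq0 => /hF. Qed.

Lemma hom_sum a k b l (J : Type) (r : seq J) (P : pred J) (f : J -> sring) :
  (forall j, hom a k b l (f j)) -> hom a k b l (\sum_(j <- r | P j) f j).
Proof. by move=> hf; elim/big_ind: _ => // [|F G]; [exact: hom0 | exact: homD]. Qed.

Lemma card_preim_split (f : 'I_d -> I) (A S : {set I}) : A \subset S ->
  #|[set j | f j \in S]%SET| =
  (#|[set j | f j \in A]%SET| + #|[set j | f j \in S :\: A]%SET|)%N.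
Proof.
move=> AS; rewrite -(cardsID [set j | f j \in A]%SET); congr (_ + _)%N.
  by apply: eq_card => j; rewrite !finset.inE andb_idl // => /(fintype.subsetP AS).
by apply: eq_card => j; rewrite !finset.inE.
Qed.

Lemma homM a k b l a' k' b' l' F G : hom a k b l F -> hom a' k' b' l' G ->
  hom (a + a') (k + k') (b + b') (l + l') (F * G).
Proof.
move=> hF hG S m; rewrite sringM ffunE raddf_sum /= => nz.
have /existsP[A /andP[AS nzA]] :
    [exists A : {set I}, (A \subset S) && (mcoeff m (F A * G (S :\: A)) != 0)].
  apply: contraNT nz => /existsPn H; rewrite big1 // => A AS.
  have := H A; rewrite AS /= negbK => /eqP E.
  by rewrite -signr_odd mulr_sign; case: (odd _); rewrite ?mcoeffN E ?oppr0.
have /existsP[[[k1 b1] [k2 b2]] /= /andP[ek nzk]] :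
   [exists kk : bmultinom n (mdeg m).+1 * bmultinom n (mdeg m).+1, (m == mnm_add (bmnm kk.1) (bmnm kk.2)) &&
   (mcoeff kk.1 (F A) * mcoeff kk.2 (G (S :\: A)) != 0)].
  apply: contraNT nzA => /existsPn H; rewrite mcoeffM big1 // => kk ekk.
  by have := H kk; rewrite ekk /= negbK => /eqP.
have nzF : mcoeff k1 (F A) != 0 by apply: contraNneq nzk => ->; rewrite mul0r.
have nzG : mcoeff k2 (G (S :\: A)) != 0.
  by apply: contraNneq nzk => ->; rewrite mulr0.
have [<- <-] := hF _ _ nzF; have [<- <-] := hG _ _ nzG.
have := congr1 (@mdeg n) (eqP ek); rewrite mdegD => em.
have eT : ntheta S = (ntheta A + ntheta (S :\: A))%N by exact: card_preim_split.
have eX : nxi S = (nxi A + nxi (S :\: A))%N by exact: card_preim_split.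
by rewrite em eT eX; split; lia.
Qed.

Lemma hom_dp a k b l i F : hom a k b l F -> hom a.+1 k b.+1 l (dp i F).
Proof.
move=> hF S m; rewrite /dp liftDE /= mcoeff_deriv => nz.
have /hF : mcoeff (mnm_add m (mnm1 i)) (F S) != 0.
  by apply: contraNneq nz => ->; rewrite mul0rn.
by rewrite mdegD mdeg1 => -[<- <-]; split; lia.
Qed.

Lemma hom_dx a k b l i F : hom a k b l F -> hom a k b l (dx i F).
Proof.
move=> hF S m; rewrite /dx liftDE /= mcoeff_map_mpoly => nz.
by apply: hF; apply: contraNneq nz => ->; rewrite raddf0.
Qed.

Lemma hom_flip a k b l F : hom a k b l F -> hom a k b l (flip F).
Proof.
move=> hF S m; rewrite flipE -signr_odd mulr_sign.
by case: (odd _); rewrite ?mcoeffN ?oppr_eq0 => /hF.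
Qed.

Lemma card_preimU1 (f : 'I_d -> I) j S : injective f -> f j \notin S ->
  #|[set i | f i \in f j |: S]%SET| = #|[set i | f i \in S]%SET|.+1.
Proof.
move=> inj fjS; rewrite (cardsD1 j) !finset.inE eqxx add1n; congr _.+1.
apply: eq_card => i; rewrite !finset.inE (inj_eq inj).
by case: eqP => [->|//]; rewrite (negbTE fjS).
Qed.

Lemma card_preimU1' (f : 'I_d -> I) s S : (forall i, f i != s) ->
  #|[set i | f i \in s |: S]%SET| = #|[set i | f i \in S]%SET|.
Proof.
by move=> nf; apply: eq_card => i; rewrite !finset.inE (negbTE (nf i)).
Qed.

Lemma hom_dl_coef s F S m : mcoeff m (dl s F S) != 0 ->
  s \notin S /\ mcoeff m (F (s |: S)%SET) != 0.
Proof.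
rewrite dlE; case: ifPn => [_|sS]; first by rewrite mcoeff0 eqxx.
move=> nz; split=> //; apply: contraNneq nz => E.
by rewrite -signr_odd mulr_sign; case: (odd _); rewrite ?mcoeffN E ?oppr0.
Qed.

Lemma hom_dl_theta a k b l j F : hom a k b l F -> hom a.+1 k b l (dl (lshift d j) F).
Proof.
move=> hF S m /hom_dl_coef[sS /hF].
have -> : ntheta (lshift d j |: S) = (ntheta S).+1.
  by apply: card_preimU1 => //; exact: lshift_inj.
have -> : nxi (lshift d j |: S) = nxi S.
  by apply: card_preimU1' => i; rewrite /xi_idx eq_rlshift.
by move=> [<- <-]; split; lia.
Qed.

Lemma hom_dl_xi a k b l j F : hom a k b l F -> hom a k b.+1 l (dl (rshift d j) F).
Proof.
move=> hF S m /hom_dl_coef[sS /hF].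
have -> : nxi (rshift d j |: S) = (nxi S).+1.
  by apply: card_preimU1 => //; exact: rshift_inj.
have -> : ntheta (rshift d j |: S) = ntheta S.
  by apply: card_preimU1' => i; rewrite /theta_idx eq_lrshift.
by move=> [<- <-]; split; lia.
Qed.

Lemma hom_sbr k l k' l' F G : hom 0 k 0 l F -> hom 0 k' 0 l' G ->
  hom 1 (k + k') 1 (l + l') (sbr F G).
Proof.
move=> hF hG; rewrite sbrE; apply: homD; apply: hom_sum => i.
  apply: homD; last apply: homN.
    by apply: (homM (hom_dp hF) (hom_dx hG)).
  by apply: (homM (hom_dx hF) (hom_dp hG)).
rewrite -(splitK i); case: (fintype.split i) => j /=; rewrite ?sdual_l ?sdual_r.
  exact: (homM (hom_flip (hom_dl_theta hF)) (hom_dl_xi hG)).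
exact: (homM (hom_flip (hom_dl_xi hF)) (hom_dl_theta hG)).
Qed.

Lemma shomog_sbr k l k' l' k'' l'' F G : shomog k l F -> shomog k' l' G ->
  (k + k' = k''.+1)%N -> (l + l' = l''.+1)%N -> shomog k'' l'' (sbr F G).
Proof.
move=> hF hG ek el; apply/(hom_shomog 1 _ 1); rewrite !addn1 -ek -el.
by apply: hom_sbr; apply: shomog_hom.
Qed.

Lemma shomogM k l k' l' F G : shomog k l F -> shomog k' l' G ->
  shomog (k + k') (l + l') (F * G).
Proof.
move=> hF hG; apply/(hom_shomog 0 _ 0); rewrite !addn0.
exact: (homM (shomog_hom hF) (shomog_hom hG)).
Qed.

Lemma shomogD k l F G : shomog k l F -> shomog k l G -> shomog k l (F + G).
Proof.
move=> hF hG; apply/(hom_shomog 0 _ 0); rewrite !addn0.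
exact: (homD (shomog_hom hF) (shomog_hom hG)).
Qed.

Lemma shomogN k l F : shomog k l F -> shomog k l (- F).
Proof.
move=> hF; apply/(hom_shomog 0 _ 0); rewrite !addn0.
exact: (homN (shomog_hom hF)).
Qed.

Lemma card_theta_xi S : #|S| = (ntheta S + nxi S)%N.
Proof.
rewrite -sum1_card big_mkcond big_split_ord /= -!big_mkcond /=.
by rewrite !sum1dep_card; congr (_ + _)%N; apply: eq_card => j; rewrite !finset.inE.
Qed.

Lemma shomog_par k l F : shomog k l F -> par (odd (k + l)) F.
Proof.
move=> hF S oS; apply/mpolyP => m; rewrite mcoeff0; apply/eqP/negPn/negP => /hF.
rewrite -/(ntheta S) -/(nxi S) => -[ek el]; move: oS; rewrite card_theta_xi -ek -el.
by rewrite !oddD; case: (odd (mdeg m)); case: (odd (ntheta S)); case: (odd (nxi S)).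
Qed.

Lemma eq_shomog0 k l k' l' F G : F + G = 0 -> shomog k l F -> shomog k' l' G ->
  (k != k') || (l != l') -> F = 0.
Proof.
move=> FG hF hG neq; apply/ffunP => S; apply/mpolyP => m.
rewrite sring_zeroE mcoeff0; apply/eqP/negPn/negP => nz.
have nzG : mcoeff m (G S) != 0.
  move/ffunP/(_ S)/(congr1 (mcoeff m)): FG.
  rewrite sring_addE sring_zeroE mcoeffD mcoeff0 => /eqP.
  by rewrite addr_eq0 => /eqP e; rewrite e oppr_eq0 in nz.
by have [e1 e2] := hF _ _ nz; have [e3 e4] := hG _ _ nzG; move: neq;
  rewrite -e1 -e2 -e3 -e4 !eqxx.
Qed.

(** The elements that involve neither momenta nor xi.  The bracket pairs x and
    theta with p and xi only, hence it vanishes on two such elements. *)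
Definition hor F := (forall i, dp i F = 0) /\ (forall j, dl (rshift d j) F = 0).

Lemma shomog_hor k F : shomog k 0 F -> hor F.
Proof.
move=> /shomog_hom hF; split=> i; apply/ffunP => S; apply/mpolyP => m.
  rewrite sring_zeroE mcoeff0; apply/eqP/negPn/negP => /(hom_dp hF)[_].
  by rewrite addnS.
rewrite sring_zeroE mcoeff0; apply/eqP/negPn/negP => /(hom_dl_xi hF)[_].
by rewrite addnS.
Qed.

Lemma hor_sbr F G : hor F -> hor G -> sbr F G = 0.
Proof.
move=> [pF xF] [pG xG]; rewrite sbrE !big1 ?addr0 // => [i _|i _].
  rewrite -(splitK i); case: (fintype.split i) => j /=; rewrite ?sdual_l ?sdual_r.
    by rewrite xG mulr0.
  by rewrite xF raddf0 mul0r.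
by rewrite pF pG mulr0 mul0r subr0.
Qed.

Hypothesis K_torsion_free : forall (x : K) m, x *+ m.+1 = 0 -> x = 0.

(** Each monomial of positive second degree contains some p^i or xi_j, and is not
    killed by the derivative along it. *)
Lemma shomog_eq0 k l F : shomog k l.+1 F -> (forall i, dp i F = 0) ->
  (forall j, dl (rshift d j) F = 0) -> F = 0.
Proof.
move=> hF pF xF; apply/ffunP => S; apply/mpolyP => m.
rewrite sring_zeroE mcoeff0; apply/eqP/negPn/negP => nz.
have [_ el] := hF _ _ nz.
have [m0|[i mi]] : m = @mnm0 n \/ exists i, (0 < m i)%N.
  have [/existsP[i mi]|/existsPn m0] := boolP [exists i, (0 < m i)%N].
    by right; exists i.
  by left; apply/mnmP => i; rewrite mnm0E; apply/eqP; rewrite -leqn0 leqNgt.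
  have : (0 < nxi S)%N by move: el; rewrite m0 mdeg0 add0n /nxi => ->.
  case/card_gt0P => j; rewrite finset.inE => jS.
  have /ffunP/(_ (S :\ xi_idx j)%SET) := xF j.
  rewrite dlE !finset.inE eqxx finset.setD1K // sring_zeroE => /(congr1 (mcoeff m)).
  rewrite mcoeff0 => /eqP; apply/negP; apply: contraNneq nz.
  rewrite -signr_odd mulr_sign; case: (odd _); rewrite ?mcoeffN => /eqP.
    by rewrite oppr_eq0.
  by [].
have em : (mnm_add (mnm_sub m (mnm1 i)) (mnm1 i)) = m.
  by rewrite submK //; apply/mnm_lepP => j; rewrite mnm1E; case: eqP => // <-.
have /ffunP/(_ S)/(congr1 (mcoeff (mnm_sub m (mnm1 i)))) := pF i.
rewrite /dp liftDE sring_zeroE mcoeff0 /= mcoeff_deriv em => /K_torsion_free e.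
by rewrite e eqxx in nz.
Qed.

Definition sidA : sring := \sum_(j < d) sgen K n (rshift d j) * sgen K n (lshift d j).

Lemma sgen_dlE s F S : (sgen K n s * dl s F) S = if s \in S then F S else 0.
Proof.
rewrite sgen_mulE; case: ifPn => // sS; rewrite dlE !finset.inE eqxx /= finset.setD1K //.
rewrite mulrA -exprD [X in (_ + X)%N](_ : _ = #|[set u in S | (u < s)%N]%SET|).
  by rewrite sign_addnn mul1r.
by apply: eq_card => u; rewrite !finset.inE; case: eqP => // ->; rewrite ltnn !andbF.
Qed.

(** {id_A, -} counts the xi's and subtracts the number of theta's.  A momentum
    contributes equally to both degrees, so this is the difference of the degrees
    ([sidA_shomog]). *)
Lemma sidA_bracket F : sbr sidA F = \sum_(j < d)
  (sgen K n (rshift d j) * dl (rshift d j) F - sgen K n (lshift d j) * dl (lshift d j) F).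
Proof.
have dpz i : dp i sidA = 0.
  rewrite /sidA dp_sum big1 // => j _; rewrite dpM.
  by rewrite !sgen_dp mulr0 mul0r addr0.
have dxz i : dx i sidA = 0.
  rewrite /sidA dx_sum big1 // => j _; rewrite (dxM DxM).
  by rewrite !(sgen_dx DxM) mulr0 mul0r addr0.
rewrite sbrE [X in X + _]big1 ?add0r => [|i _]; last by rewrite dpz dxz !mul0r subr0.
have nlr (i j : 'I_d) : (lshift d i == rshift d j) = false.
  exact: eq_lrshift.
have dl_l i : dl (lshift d i) sidA = - sgen K n (rshift d i).
  rewrite /sidA dl_sum (bigD1 i) //= big1 => [|j nj].
    by rewrite dl_sgenM nlr mul0r sub0r dl_sgen eqxx mulr1 addr0.
  rewrite dl_sgenM nlr mul0r sub0r dl_sgen eq_lshift eq_sym (negbTE nj) mulr0.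
  exact: oppr0.
have dl_r i : dl (rshift d i) sidA = sgen K n (lshift d i).
  rewrite /sidA dl_sum (bigD1 i) //= big1 => [|j nj].
    by rewrite dl_sgenM eqxx mul1r dl_sgen eq_sym nlr mulr0 subr0 addr0.
  rewrite dl_sgenM eq_rshift eq_sym (negbTE nj) mul0r sub0r dl_sgen eq_sym nlr.
  by rewrite mulr0 oppr0.
rewrite big_split_ord /= -big_split; apply: eq_bigr => j _ /=.
by rewrite dl_l dl_r sdual_l sdual_r flipN !flip_sgen opprK mulNr.
Qed.

Lemma sidA_shomog k l F : shomog k l F -> sbr sidA F = F *+ l - F *+ k.
Proof.
move=> hF; rewrite sidA_bracket; apply/ffunP => S.
rewrite sum_sringE; under eq_bigr do rewrite sring_addE sring_oppE !sgen_dlE.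
rewrite sumrB -!big_mkcond /= !sumr_const sring_addE sring_oppE !sring_mulnE.
apply/mpolyP => m; rewrite !mcoeffB !mcoeffMn.
have [->|nz] := eqVneq (mcoeff m (F S)) 0; first by rewrite !mul0rn.
have [<- <-] := hF _ _ nz.
rewrite !mulrnDr opprD addrACA subrr add0r.
by congr (_ *+ _ - _ *+ _); apply: eq_card => j; rewrite !finset.inE.
Qed.

End Bidegree.

(** * The defect of the derivation rule *)
Section Bialgebroid.
Variables (K : comNzRingType) (n d : nat) (Dx : 'I_n -> {additive K -> K}).
Hypothesis DxM : forall i a b, Dx i (a * b) = Dx i a * b + a * Dx i b.
Hypothesis DxC : forall i j a, Dx i (Dx j a) = Dx j (Dx i a).
Notation sring := (sring K n d).
Notation sbr := (@sbr K n d Dx).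
Notation idA := (@sidA K n d).
Implicit Types (F G H a b : sring).
Local Notation "⟨ F , G ⟩" := (sbr F G) (at level 0, F, G at level 99).

Variables (mu phi nu X : sring).
Hypotheses (hmu : shomog 1 2 mu) (hphi : shomog 0 1 phi)
           (hnu : shomog 2 1 nu) (hX : shomog 1 0 X).

(** The bracket of a pre-Jacobi algebroid is the case M = mu + id_A phi.  The
    expansion of the defect is made for an arbitrary odd M first. *)
Definition sjbr M F G := ⟨⟨F, M⟩, G⟩ - F * ⟨phi, G⟩ + ⟨F, phi⟩ * G.
Definition sjbracket := sjbr (mu + idA * phi).
Definition sjdiff F := ⟨nu, F⟩ + X * F.
Definition sdiamond := ⟨phi, X⟩.
Definition sclub := ⟨mu, X⟩ + ⟨nu, phi⟩.
Definition sspade (h : K) := ⟨mu, nu⟩ + mu * X + nu * phi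
  - idA * (- (phi * X) + gconst n d h * (⟨mu, X⟩ - ⟨nu, phi⟩)).
(** The difference of the two sides of the derivation rule, e being the parity of
    the first argument: (-1)^(k-1) is -1 if k is even. *)
Definition sdefect M (e : bool) F G := sjdiff (sjbr M F G) -
  (sjbr M (sjdiff F) G + sg (~~ e) (sjbr M F (sjdiff G))).

Let pmu : par true mu := shomog_par hmu.
Let pphi : par true phi := shomog_par hphi.
Let pnu : par true nu := shomog_par hnu.
Let pX : par true X := shomog_par hX.

Lemma shomog_xi j : shomog 0 1 (sgen K n (rshift d j)).
Proof.
move=> S m; rewrite ffunE; case: ifP => [/eqP->|_]; last by rewrite mcoeff0 eqxx.
rewrite mcoeff1; have [->|_] := eqVneq m _; rewrite ?eqxx // => _; rewrite mdeg0.
split; last by rewrite (eq_card (B := pred1 j)) ?card1 // => i;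
  rewrite !finset.inE eq_rshift.
by apply/eqP; rewrite cards_eq0; apply/eqP/setP => i; rewrite !finset.inE eq_lrshift.
Qed.

Lemma shomog_theta j : shomog 1 0 (sgen K n (lshift d j)).
Proof.
move=> S m; rewrite ffunE; case: ifP => [/eqP->|_]; last by rewrite mcoeff0 eqxx.
rewrite mcoeff1; have [->|_] := eqVneq m _; rewrite ?eqxx // => _; rewrite mdeg0.
split; first by rewrite (eq_card (B := pred1 j)) ?card1 // => i;
  rewrite !finset.inE eq_lshift.
by apply/eqP; rewrite cards_eq0; apply/eqP/setP => i; rewrite !finset.inE eq_rlshift.
Qed.

Lemma shomog_idA : shomog 1 1 idA.
Proof.
rewrite /sidA; elim/big_ind: _ => [|F G|j _].
- by apply/(hom_shomog 0 _ 0); rewrite !addn0; exact: hom0.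
- exact: shomogD.
- exact: (shomogM (@shomog_xi j) (@shomog_theta j)).
Qed.

Let pid : par false idA := shomog_par shomog_idA.

Section Defect.
Variables (k l : nat) (a b : sring).
Hypotheses (ha : shomog k 0 a) (hb : shomog l 0 b).
Let e := odd k.
Let f := odd l.
Let pa : par e a. Proof. by rewrite /e -[k]addn0; exact: shomog_par. Qed.
Let pb : par f b. Proof. by rewrite /f -[l]addn0; exact: shomog_par. Qed.
Let ora : hor a := shomog_hor ha.
Let orb : hor b := shomog_hor hb.
Let orX : hor X := shomog_hor hX.

Let ab0 : ⟨a, b⟩ = 0 := hor_sbr Dx ora orb.
Let Xb0 : ⟨X, b⟩ = 0 := hor_sbr Dx orX orb.
Let aX0 : ⟨a, X⟩ = 0 := hor_sbr Dx ora orX.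

Variable M : sring.
Hypothesis pM : par true M.

Let X_nu_braM : ⟨nu, ⟨⟨a, M⟩, b⟩⟩ = ⟨⟨⟨nu, a⟩, M⟩, b⟩ +
  sg e ⟨⟨a, ⟨nu, M⟩⟩, b⟩ + sg (~~ e) ⟨⟨a, M⟩, ⟨nu, b⟩⟩.
Proof.
have paM : par (~~ e) ⟨a, M⟩ by rewrite -addbT; exact: par_sbr.
rewrite (sbr_jacobi DxM DxC pnu paM) (sbr_jacobi DxM DxC pnu pa).
by rewrite sbrDl sbr_sgl.
Qed.

Let nu_phi : ⟨nu, ⟨phi, b⟩⟩ = ⟨⟨nu, phi⟩, b⟩ - ⟨phi, ⟨nu, b⟩⟩.
Proof. by rewrite (sbr_jacobi DxM DxC pnu pphi). Qed.

Let nu_aphi : ⟨nu, ⟨a, phi⟩⟩ = ⟨⟨nu, a⟩, phi⟩ + sg e ⟨a, ⟨nu, phi⟩⟩.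
Proof. by rewrite (sbr_jacobi DxM DxC pnu pa). Qed.

Let Xa_M : ⟨⟨X * a, M⟩, b⟩ = X * ⟨⟨a, M⟩, b⟩ + sg e (a * ⟨⟨X, M⟩, b⟩).
Proof.
have pXM : par false ⟨X, M⟩ by exact: (par_sbr Dx pX pM).
rewrite (sbrMl DxM _ _ pM) (flipn_par true pa) /= mul_sgr sbrDl sbr_sgl.
rewrite !(sbrMl DxM _ _ pb) Xb0 mul0r addr0 ab0 mulr0 add0r.
rewrite (flipn_par f pa) mul_sgr (par_comm _ (par_sbr Dx pXM pb)) (flipn_par _ pa).
by rewrite mul_sgl addFb sgK.
Qed.

Let aM_Xb : ⟨⟨a, M⟩, X * b⟩ = ⟨⟨a, M⟩, X⟩ * b + sg (~~ e) (X * ⟨⟨a, M⟩, b⟩).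
Proof.
have paM : par (~~ e) ⟨a, M⟩ by rewrite -addbT; exact: par_sbr.
by rewrite (sbrMr DxM _ _ paM) (flipn_par _ pX) andbT mul_sgl.
Qed.

Let Xa_phi : ⟨X * a, phi⟩ = X * ⟨a, phi⟩ + sg e (sdiamond * a).
Proof.
rewrite (sbrMl DxM _ _ pphi) (flipn_par true pa) mul_sgr /sdiamond.
by rewrite (sbrC Dx pphi pX) opprK.
Qed.

Let phi_Xb : ⟨phi, X * b⟩ = sdiamond * b - X * ⟨phi, b⟩.
Proof. by rewrite (sbrMr DxM _ _ pphi) (flipn_par _ pX) mulNr. Qed.

Let aM_X : ⟨⟨a, M⟩, X⟩ = ⟨a, ⟨M, X⟩⟩.
Proof. by rewrite (sbr_jacobi DxM DxC pa pM) aX0 sbr0r sg0 addr0. Qed.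

Let X_M : ⟨X, M⟩ = ⟨M, X⟩.
Proof. by rewrite (sbrC Dx pM pX) opprK. Qed.

Let aMX_b : ⟨⟨a, M * X⟩, b⟩ = sg (~~ e) (X * ⟨⟨a, M⟩, b⟩).
Proof.
have paM : par (~~ e) ⟨a, M⟩ by rewrite -addbT; exact: par_sbr.
rewrite (sbrMr DxM _ _ pa) aX0 mulr0 addr0 (sbrMl DxM _ _ pb) Xb0 mulr0 add0r.
rewrite (flipn_par f pX) andbT mul_sgr.
rewrite (par_comm _ (par_sbr Dx paM pb)) (flipn_par _ pX) andbT mul_sgl.
by case: (e); case: (f); rewrite /sg /= ?opprK.
Qed.

Let pdiamond : par false sdiamond := par_sbr Dx pphi pX.

Let diamondC F : F * sdiamond = sdiamond * F.
Proof. by rewrite (par_comm F pdiamond). Qed.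

Let XaC F : a * (X * F) = sg e (X * a * F).
Proof. by rewrite mulrA (par_comm a pX) (flipn_par true pa) /= !mul_sgl sgK. Qed.

Let aphiX F : ⟨a, phi⟩ * (X * F) = sg (~~ e) (X * ⟨a, phi⟩ * F).
Proof.
have pap : par (~~ e) ⟨a, phi⟩ by rewrite -addbT; exact: par_sbr.
by rewrite mulrA (par_comm ⟨a, phi⟩ pX) (flipn_par true pap) /= !mul_sgl sgK.
Qed.

(** Jacobi moves nu into the brackets and Leibniz moves X out of them; as a, b and
    X commute for the bracket, most of the resulting terms cancel. *)
Lemma sdefectE0 : sdefect M e a b = sg e (⟨⟨a, ⟨nu, M⟩ + M * X⟩, b⟩
  + ⟨a, ⟨nu, phi⟩ + ⟨M, X⟩⟩ * b - a * ⟨⟨nu, phi⟩ + ⟨M, X⟩, b⟩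
  + sg e (X * a * ⟨phi, b⟩ - X * ⟨a, phi⟩ * b) - (sdiamond * a * b) *+ 2).
Proof.
rewrite /sdefect /sjdiff /sjbr.
rewrite !(sbrDr, sbrDl, sbrNl, sbrNr) X_nu_braM.
rewrite !(sbrMr DxM _ _ pnu) nu_phi nu_aphi (flipn_par true pa).
have pap : par (~~ e) ⟨a, phi⟩ by rewrite -addbT; exact: par_sbr.
rewrite (flipn_par true pap) Xa_M aM_Xb Xa_phi phi_Xb aM_X X_M aMX_b.
rewrite !(mulrDl, mulrDr, mulrN, mulNr) ?(mul_sgl, mul_sgr) XaC aphiX !mulrA.
rewrite (diamondC a).
by case: (e); rewrite /sg /=; sring_linear.
Qed.

End Defect.

Let M := mu + idA * phi.
Let pM : par true M.
Proof. by apply: parD => //; exact: (parM pid pphi). Qed.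

Variable h : K.
Hypothesis h2 : h *+ 2 = 1.
Let gh := gconst n d h.

Let gh2 F : F = (gh * F) *+ 2.
Proof. by rewrite -mulrnAl /gh /gconst -!raddfMn /= h2 mul1r. Qed.

Let hor_gh : hor gh.
Proof. by split=> i; [exact: gconst_dp | exact: gconst_dl]. Qed.

Let par_gh : par false gh := par_scst _.

Let mul_gh F : F * gh = gh * F.
Proof. by rewrite /gh /gconst scstC. Qed.

Let hnuphi : shomog 1 1 ⟨nu, phi⟩.
Proof. exact: (shomog_sbr hnu hphi). Qed.
Let hmuX : shomog 1 1 ⟨mu, X⟩.
Proof. exact: (shomog_sbr hmu hX). Qed.

Lemma shomog_club : shomog 1 1 sclub.
Proof. exact: shomogD. Qed.

Lemma shomog_diamond : shomog 0 0 sdiamond.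
Proof. exact: (shomog_sbr hphi hX). Qed.

Lemma shomog_gconstM k l c F : shomog k l F -> shomog k l (gconst n d c * F).
Proof.
move=> hF; apply: (@shomogM _ _ _ 0 0) => // S m.
rewrite scstE; case: ifP => [/eqP->|_]; last by rewrite mcoeff0 eqxx.
rewrite mcoeffC; have [->|_] := eqVneq m _; last by rewrite mulr0 eqxx.
move=> _; rewrite mdeg0; split; apply/eqP; rewrite cards_eq0;
  by apply/eqP/setP => i; rewrite !finset.inE.
Qed.

Lemma shomog_spade : shomog 2 2 (sspade h).
Proof.
have hphiX : shomog 1 1 (phi * X) by exact: (shomogM hphi hX).
apply: shomogD; first apply: shomogD; first apply: shomogD.
- exact: (shomog_sbr hmu hnu).
- exact: (shomogM hmu hX).
- exact: (shomogM hnu hphi).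
apply: shomogN; apply: (shomogM shomog_idA); apply: shomogD; first exact: shomogN.
by apply: shomog_gconstM; apply: shomogD => //; exact: shomogN.
Qed.

Let nu_id : ⟨nu, idA⟩ = nu.
Proof.
by rewrite (sbrC Dx pid pnu) (sidA_shomog DxM hnu) /sg /=; sring_linear.
Qed.

Let id_X : ⟨idA, X⟩ = - X.
Proof. by rewrite (sidA_shomog DxM hX) mulr0n sub0r. Qed.

(* {nu, id_A phi} contributes id_A {nu, phi} on the left where spade has half of
   id_A ({nu, phi} - {mu, X}); the difference is half of id_A club. *)
Let nuM : ⟨nu, M⟩ + M * X = sspade h + gh * (idA * sclub).
Proof.
rewrite /M sbrDr (sbrMr DxM _ _ pnu) nu_id (flipn_par _ pid) /sg /=.
have -> : ⟨nu, mu⟩ = ⟨mu, nu⟩ by rewrite (sbrC Dx pmu pnu) opprK.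
rewrite /sspade /sclub -/gh !(mulrDr, mulrDl, mulrN) !mulrA mul_gh.
by rewrite [in LHS](gh2 (idA * ⟨nu, phi⟩)) !mulrA; sring_linear.
Qed.

Let nuphiMX : ⟨nu, phi⟩ + ⟨M, X⟩ = sclub + idA * sdiamond + X * phi.
Proof.
rewrite /M sbrDl (sbrMl DxM _ _ pX) id_X (flipn_par _ pphi) /sg /= mulrNN.
by rewrite -/sdiamond /sclub; sring_linear.
Qed.

Section DefectFormula.
Variables (k l : nat) (a b : sring).
Hypotheses (ha : shomog k 0 a) (hb : shomog l 0 b).
Let e := odd k.
Let f := odd l.
Let pa : par e a. Proof. by rewrite /e -[k]addn0; exact: shomog_par. Qed.
Let pb : par f b. Proof. by rewrite /f -[l]addn0; exact: shomog_par. Qed.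
Let ora : hor a := shomog_hor ha.
Let orb : hor b := shomog_hor hb.
Let orX : hor X := shomog_hor hX.
Let pclub : par false sclub := shomog_par shomog_club.
Let pdiamond : par false sdiamond := shomog_par shomog_diamond.

Let a_id : ⟨a, idA⟩ = a *+ k.
Proof.
by rewrite (sbrC Dx pid pa) (sidA_shomog DxM ha) mulr0n /= opprD opprK oppr0 add0r.
Qed.

Let id_b : ⟨idA, b⟩ = - (b *+ l).
Proof. by rewrite (sidA_shomog DxM hb) mulr0n sub0r. Qed.

Let a_gh F : ⟨a, gh * F⟩ = gh * ⟨a, F⟩.
Proof.
rewrite (sbrMr DxM _ _ pa) (hor_sbr Dx ora hor_gh) mul0r add0r.
by rewrite (flipn_par _ par_gh) andbF.
Qed.

Let gh_b F : ⟨gh * F, b⟩ = gh * ⟨F, b⟩.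
Proof. by rewrite (sbrMl DxM _ _ pb) (hor_sbr Dx hor_gh orb) mul0r addr0. Qed.

(* The degrees come in through {a, id_A} = k a and {id_A, b} = - l b. *)
Let a_id_club : ⟨⟨a, idA * sclub⟩, b⟩ = (a * ⟨sclub, b⟩) *+ k - (⟨a, sclub⟩ * b) *+ l.
Proof.
have paC : par e ⟨a, sclub⟩ by rewrite -[e]addbF; exact: par_sbr.
have hor_aC : hor ⟨a, sclub⟩.
  by apply: (@shomog_hor _ _ _ k); apply: (shomog_sbr ha shomog_club); rewrite ?addn1.
rewrite (sbrMr DxM _ _ pa) a_id (flipn_par _ pid) andbF /sg sbrDl.
rewrite !(sbrMl DxM _ _ pb) (hor_sbr Dx hor_aC orb) mulr0 add0r.
have -> : ⟨a *+ k, b⟩ = 0.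
  elim: (k) => [|m IH]; first by rewrite mulr0n sbr0l.
  by rewrite mulrS sbrDl IH (hor_sbr Dx ora orb) addr0.
rewrite mul0r addr0 id_b mulrnAl (flipn_par f paC) mulNr; congr (_ - _).
by rewrite mulrnAl mul_sgr (par_comm _ pb) (flipn_par f paC) mul_sgl sgK.
Qed.

Let diamondC F : sdiamond * F = F * sdiamond := par_comm F pdiamond.

Let a_id_diamond : ⟨a, idA * sdiamond⟩ * b = (sdiamond * a * b) *+ k.
Proof.
rewrite (sbrMr DxM _ _ pa) (hor_sbr Dx ora (shomog_hor shomog_diamond)) mulr0 addr0.
by rewrite a_id !mulrnAl diamondC.
Qed.

Let id_diamond_b : a * ⟨idA * sdiamond, b⟩ = - ((sdiamond * a * b) *+ l).
Proof.
rewrite (sbrMl DxM _ _ pb) (hor_sbr Dx (shomog_hor shomog_diamond) orb) mulr0 add0r.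
rewrite id_b (flipn_par _ pdiamond) andbF /sg mulNr mulrN mulrnAl mulrnAr.
by rewrite -[in RHS]mulrA [in RHS]diamondC mulrA.
Qed.

Let a_Xphi : ⟨a, X * phi⟩ = sg e (X * ⟨a, phi⟩).
Proof.
rewrite (sbrMr DxM _ _ pa) (hor_sbr Dx ora orX) mul0r add0r.
by rewrite (flipn_par _ pX) andbT mul_sgl.
Qed.

Let Xphi_b : ⟨X * phi, b⟩ = X * ⟨phi, b⟩.
Proof. by rewrite (sbrMl DxM _ _ pb) (hor_sbr Dx orX orb) mul0r addr0. Qed.

Let XaC F : a * (X * F) = sg e (X * a * F).
Proof. by rewrite mulrA (par_comm a pX) (flipn_par true pa) /= !mul_sgl sgK. Qed.

Lemma sdefectE : sdefect M e a b = sg e (⟨⟨a, sspade h⟩, b⟩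
  + gh * ((a * ⟨sclub, b⟩) *+ k - (⟨a, sclub⟩ * b) *+ l)
  + ⟨a, sclub⟩ * b - a * ⟨sclub, b⟩
  + (sdiamond * a * b) *+ (k + l) - (sdiamond * a * b) *+ 2).
Proof.
have D3r Y1 Y2 Y3 : ⟨a, Y1 + Y2 + Y3⟩ = ⟨a, Y1⟩ + ⟨a, Y2⟩ + ⟨a, Y3⟩.
  by rewrite !sbrDr.
have D3l Y1 Y2 Y3 : ⟨Y1 + Y2 + Y3, b⟩ = ⟨Y1, b⟩ + ⟨Y2, b⟩ + ⟨Y3, b⟩.
  by rewrite !sbrDl.
have D2 Y1 Y2 : ⟨⟨a, Y1 + gh * Y2⟩, b⟩ = ⟨⟨a, Y1⟩, b⟩ + gh * ⟨⟨a, Y2⟩, b⟩.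
  by rewrite sbrDr sbrDl a_gh gh_b.
rewrite (sdefectE0 ha hb pM) nuM nuphiMX D3r D3l D2 a_id_club !(mulrDl, mulrDr).
rewrite a_id_diamond id_diamond_b a_Xphi Xphi_b XaC -/e mulrnDr.
by congr sg; case: (e); rewrite /sg ?mulNr ?mulrA; sring_linear.
Qed.

End DefectFormula.

Hypothesis K_torsion_free : forall (x : K) m, x *+ m.+1 = 0 -> x = 0.
Variable xc : 'I_n -> K.
Hypothesis Dxc : forall i j, Dx i (xc j) = (i == j)%:R.

Lemma sring_torsion_free F m : F *+ m.+1 = 0 -> F = 0.
Proof.
move=> /ffunP F0; apply/ffunP => S; apply/mpolyP => p.
move: (F0 S); rewrite sring_mulnE !sring_zeroE => /(congr1 (mcoeff p)).
by rewrite mcoeffMn mcoeff0 => /K_torsion_free.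
Qed.

Let dl1 s : dl s (1 : sring) = 0.
Proof. by rewrite -[X in dl _ X]/(scst d 1) dl_scst. Qed.

Let one_hor : hor (1 : sring).
Proof.
by split=> i; [exact: (gconst_dp d i 1) | exact: dl1].
Qed.

Let dx1 i : dx Dx i (1 : sring) = 0.
Proof. by rewrite -[1]/(gconst n d 1) gconst_dx (Dx1 DxM) /gconst !raddf0. Qed.

Lemma sbr1l F : ⟨1, F⟩ = 0.
Proof.
rewrite sbrE !big1 ?addr0 // => i _; first by rewrite dl1 raddf0 mul0r.
by rewrite one_hor.1 dx1 !mul0r subr0.
Qed.

Lemma sbr1r F : ⟨F, 1⟩ = 0.
Proof.
rewrite sbrE !big1 ?addr0 // => i _; first by rewrite dl1 mulr0.
by rewrite one_hor.1 dx1 !mulr0 subr0.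
Qed.

Lemma shomog_gconst (c : K) : shomog 0 0 (gconst n d c).
Proof.
have -> : gconst n d c = gconst n d c * 1 by rewrite mulr1.
apply: shomog_gconstM => S m; rewrite -[1]/(scst d 1) scstE.
case: ifP => [/eqP->|_]; last by rewrite mcoeff0 eqxx.
rewrite mcoeff1; have [->|_] := eqVneq m _; last by rewrite eqxx.
move=> _; rewrite mdeg0; split; apply/eqP; rewrite cards_eq0;
  by apply/eqP/setP => i; rewrite !finset.inE.
Qed.

Lemma gconst1 : gconst n d 1 = 1 :> sring. Proof. by []. Qed.

Lemma shomog1 : @shomog K n d 0 0 (1 : sring).
Proof. by rewrite -gconst1; exact: shomog_gconst. Qed.

(** The coordinates x_i and theta^j.  Brackets with them are the derivatives along
    p^i and xi_j, so together they detect all elements of positive second degree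
    ([test_eq0]). *)
Definition test (u : 'I_n + 'I_d) : sring :=
  match u with inl i => gconst n d (xc i) | inr j => sgen K n (lshift d j) end.
Definition test_deg (u : 'I_n + 'I_d) : nat := if u is inl _ then 0 else 1.

Lemma shomog_test u : shomog (test_deg u) 0 (test u).
Proof. by case: u => i; [exact: shomog_gconst | exact: shomog_theta]. Qed.

Lemma test_eq0 k l F : shomog k l.+1 F -> (forall u, ⟨F, test u⟩ = 0) -> F = 0.
Proof.
move=> hF F0; apply: (shomog_eq0 K_torsion_free hF) => [i|j].
  have := F0 (inl i); rewrite /= sbr_gconst (bigD1 i) //= big1 => [|j nji].
    by rewrite Dxc eqxx addr0 -[gconst _ _ 1]/(1 : sring) mulr1.
  by rewrite Dxc (negbTE nji) /gconst !raddf0 mulr0.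
have := F0 (inr j); rewrite /= (sbr_sgen DxM) sdual_l => /(congr1 (@flip _ _ _)).
by rewrite flipK raddf0.
Qed.

Lemma defect_eq0 k l a b : shomog k 0 a -> shomog l 0 b ->
  sdiamond = 0 -> sclub = 0 -> sspade h = 0 -> sdefect M (odd k) a b = 0.
Proof.
move=> ha hb d0 c0 s0; rewrite (sdefectE ha hb) d0 c0 s0 !(sbr0l, sbr0r).
by rewrite !(mul0r, mulr0, mul0rn, subr0, addr0, oppr0, add0r) sg0.
Qed.

Lemma sg_eq0 (V : zmodType) c (x : V) : sg c x = 0 -> x = 0.
Proof. by case: c; rewrite /sg // => /eqP; rewrite oppr_eq0 => /eqP. Qed.

(** In [sdefectE], a = b = 1 leaves -2 diamond; then a = 1 leaves -{club, b}; then
    {{a, spade}, b} is left. *)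
Lemma tested_defect_eq0 :
  sdefect M false 1 1 = 0 -> (forall u, sdefect M false 1 (test u) = 0) ->
  (forall u v, sdefect M (odd (test_deg u)) (test u) (test v) = 0) ->
  [/\ sdiamond = 0, sclub = 0 & sspade h = 0].
Proof.
move=> D11 D1 D2.
have d0 : sdiamond = 0.
  move: D11; rewrite (sdefectE shomog1 shomog1) !(sbr1l, sbr1r, sbr0l).
  rewrite !(mul0r, mulr0, mul0rn, mulr1, addn0, mulr0n, subr0, addr0, oppr0, sub0r).
  by move/sg_eq0/eqP; rewrite oppr_eq0 => /eqP; exact: sring_torsion_free.
have c0 : sclub = 0.
  apply: (test_eq0 shomog_club) => u; move: (D1 u).
  rewrite (sdefectE shomog1 (@shomog_test u)) d0 !(sbr1l, sbr0l).
  rewrite !(mul0r, mulr0, mul0rn, mul1r, mulr0n, subr0, addr0, oppr0, sub0r) => /sg_eq0/eqP.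
  by rewrite oppr_eq0 => /eqP.
split=> //; apply: (test_eq0 shomog_spade) => u.
have pS : par false (sspade h) := shomog_par shomog_spade.
have pu : par (odd (test_deg u)) (test u).
  by rewrite -[test_deg u]addn0; exact: shomog_par (@shomog_test u).
rewrite (sbrC Dx pu pS); suff -> : ⟨test u, sspade h⟩ = 0 by rewrite sg0 oppr0.
have hu : shomog (test_deg u).+1 1 ⟨test u, sspade h⟩.
  by apply: (shomog_sbr (@shomog_test u) shomog_spade); rewrite ?addn2.
apply: (test_eq0 hu) => v; move: (D2 u v).
rewrite (sdefectE (@shomog_test u) (@shomog_test v)) d0 c0 !(sbr0l, sbr0r).
by rewrite !(mul0r, mulr0, mul0rn, subr0, addr0, oppr0, add0r) => /sg_eq0.
Qed.

(** X is odd, so X X = 0, and {nu, X P} = {nu, X} P - X {nu, P} cancels the mixed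
    term; Jacobi turns {nu, {nu, P}} into half of {{nu, nu}, P}. *)
Lemma sjdiff2 P : sjdiff (sjdiff P) *+ 2 = ⟨⟨nu, nu⟩, P⟩ + (⟨nu, X⟩ * P) *+ 2.
Proof.
have XX : X * X = 0.
  apply: (@sring_torsion_free _ 1).
  by rewrite mulr2n {1}(par_comm X pX) (flipn_par _ pX) /sg /= mulNr addNr.
have J : ⟨⟨nu, nu⟩, P⟩ = ⟨nu, ⟨nu, P⟩⟩ *+ 2.
  by rewrite mulr2n [X in _ = X + _](sbr_jacobi DxM DxC pnu pnu) /sg /= subrK.
rewrite /sjdiff sbrDr (sbrMr DxM _ _ pnu) (flipn_par _ pX) mulrDr mulrA XX mul0r.
by rewrite J /sg /= !mulNr; sring_linear.
Qed.

Lemma sbr_nuX : ⟨nu + X, nu + X⟩ = ⟨nu, nu⟩ + ⟨nu, X⟩ *+ 2.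
Proof.
have orX : hor X := shomog_hor hX.
rewrite !(sbrDl, sbrDr) (hor_sbr Dx orX orX) (sbrC Dx pnu pX) /sg /=.
by sring_linear.
Qed.

(** {nu, nu} and {nu, X} have different bidegrees, so they vanish separately. *)
Lemma jdiff2_eq0 P : ⟨nu + X, nu + X⟩ = 0 -> sjdiff (sjdiff P) = 0.
Proof.
rewrite sbr_nuX => E; have hnn : shomog 3 1 ⟨nu, nu⟩ by exact: (shomog_sbr hnu hnu).
have hnX : shomog 2 0 (⟨nu, X⟩ *+ 2).
  by rewrite mulr2n; apply: shomogD; exact: (shomog_sbr hnu hX).
have nn0 := eq_shomog0 E hnn hnX isT; apply: (@sring_torsion_free _ 1).
move: E; rewrite nn0 add0r => /sring_torsion_free nX0.
by rewrite sjdiff2 nn0 nX0 sbr0l mul0r mul0rn addr0.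
Qed.

Lemma tested_jdiff2_eq0 : sjdiff (sjdiff 1) = 0 ->
  (forall u, sjdiff (sjdiff (test u)) = 0) -> ⟨nu + X, nu + X⟩ = 0.
Proof.
move=> d1 dt; have hnn : shomog 3 1 ⟨nu, nu⟩ by exact: (shomog_sbr hnu hnu).
have nX0 : ⟨nu, X⟩ = 0.
  have := sjdiff2 1; rewrite d1 mul0rn sbr1r add0r mulr1 => /esym.
  exact: sring_torsion_free.
rewrite sbr_nuX nX0 mul0rn addr0; apply: (test_eq0 hnn) => u.
by have := sjdiff2 (test u); rewrite dt nX0 mul0r !mul0rn addr0.
Qed.

End Bialgebroid.

(** * Smooth functions of several variables *)
Local Open Scope classical_set_scope.
Local Open Scope ring_scope.

Section SmoothCalculus.
Variables (R : realType) (n : nat).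
Notation rV := 'rV[R]_n.
Implicit Types (f g : rV -> R) (V W : set rV).

(** Differentiability up to order N, with the first derivative taken innermost:
    the rules of calculus are then proved by induction on N, generalizing over the
    functions. *)
Fixpoint smooth_upto (N : nat) V f : Prop :=
  (forall v, V v -> {for v, continuous f}) /\
  (if N is N'.+1 then forall i, (forall v, V v -> derivable f v 'e_i) /\
     smooth_upto N' V (partial i f) else True).

Lemma smooth_upto_continuous N V f : smooth_upto N V f ->
  forall v, V v -> {for v, continuous f}.
Proof. by case: N => [|N] []. Qed.

Lemma partials_rcons s i f : partials (rcons s i) f = partials s (partial i f).
Proof. by elim: s => //= j s ->. Qed.

Lemma smooth_partial V f i : smooth_on V f -> smooth_on V (partial i f).
Proof. by move=> sf s v Vv; rewrite -partials_rcons; exact: sf. Qed.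

Lemma smooth_onP V f : smooth_on V f <-> forall N, smooth_upto N V f.
Proof.
split=> [sf N|sf].
  have cf v : V v -> {for v, continuous f} by move=> Vv; case: (sf [::] v Vv).
  elim: N f sf cf => [|N IH] f sf cf; split=> // i.
  split; last first.
    apply: IH => [|v Vv]; first exact: smooth_partial.
    by case: (smooth_partial i sf [::] Vv).
  by move=> v Vv; case: (sf [::] v Vv).
have {}sf s N : smooth_upto N V (partials s f).
  by elim: s N => //= i s IH N; case: (IH N.+1) => _ /(_ i) [].
move=> s v Vv; split; first exact: (smooth_upto_continuous (sf s 0%N)).
by move=> i; case: (sf s 1%N) => _ /(_ i) [/(_ v Vv)].
Qed.

Lemma smooth_uptoW N V f : smooth_upto N.+1 V f -> smooth_upto N V f.
Proof.
elim: N f => [|N IH] f [cf df]; split=> // i; have [dfi sfi] := df i.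
by split=> //; exact: IH.
Qed.

Lemma near_open V v : open V -> V v -> \near v, V v.
Proof. by move=> oV Vv; exact: open_nbhs_nbhs. Qed.

Lemma eq_near_on V f g v : open V -> (forall w, V w -> f w = g w) -> V v ->
  \near v, f v = g v.
Proof.
by move=> oV fg Vv; near=> w; apply: fg; near: w; exact: near_open.
Unshelve. all: by end_near. Qed.

Lemma partial_eq_on V f g i v : open V -> (forall w, V w -> f w = g w) -> V v ->
  partial i f v = partial i g v.
Proof. by move=> oV fg Vv; apply: near_eq_derive; exact: eq_near_on fg Vv. Qed.

Lemma smooth_upto_eq N V f g : open V -> (forall w, V w -> f w = g w) ->
  smooth_upto N V f -> smooth_upto N V g.
Proof.
move=> oV; have cont f' g' : (forall w, V w -> f' w = g' w) ->
    (forall v, V v -> {for v, continuous f'}) -> forall v, V v -> {for v, continuous g'}.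
  move=> fg cf v Vv; rewrite /prop_for /continuous_at -(fg v Vv).
  exact: cvg_trans (near_eq_cvg (eq_near_on oV fg Vv)) (cf v Vv).
elim: N f g => [|N IH] f g fg [cf df]; split=> //; try exact: cont fg cf.
move=> i; have [dfi sfi] := df i; split=> [v Vv|].
  exact: near_eq_derivable (eq_near_on oV fg Vv) (dfi v Vv).
by apply: IH sfi => w Vw; exact: partial_eq_on fg Vw.
Qed.

Lemma smooth_eq V f g : open V -> (forall w, V w -> f w = g w) ->
  smooth_on V f -> smooth_on V g.
Proof.
move=> oV fg /smooth_onP sf; apply/smooth_onP => N; exact: smooth_upto_eq fg _.
Qed.

Lemma smooth_sub V W f : V `<=` W -> smooth_on W f -> smooth_on V f.
Proof. by move=> VW sf s v /VW; exact: sf. Qed.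

Lemma smooth_local V f :
  (forall v, V v -> exists W, [/\ open W, W v & smooth_on W f]) -> smooth_on V f.
Proof. by move=> loc s v /loc[W [_ Wv sf]]; exact: sf. Qed.

Lemma smooth_upto_cst N V (r : R) : smooth_upto N V (fun=> r).
Proof.
elim: N r => [|N IH] r; first by split=> // v _; exact: cst_continuous.
split=> [v _|i]; first exact: cst_continuous.
split=> [v _|]; first exact: derivable_cst.
have -> : partial i (fun=> r) = fun=> 0; last exact: IH.
by apply/funext => v; exact: derive_cst.
Qed.

Lemma smooth_cst V (r : R) : smooth_on V (fun=> r).
Proof. by apply/smooth_onP => N; exact: smooth_upto_cst. Qed.

Lemma smooth_uptoD N V f g : open V -> smooth_upto N V f -> smooth_upto N V g ->
  smooth_upto N V (fun v => f v + g v).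
Proof.
move=> oV; have C f' g' : (forall v, V v -> {for v, continuous f'}) ->
    (forall v, V v -> {for v, continuous g'}) ->
    forall v, V v -> {for v, continuous (fun v => f' v + g' v)}.
  by move=> cf cg v Vv; apply: continuousD; [exact: cf | exact: cg].
elim: N f g => [|N IH] f g [cf df] [cg dg]; split=> //; try exact: C cf cg.
move=> i; have [dfi sfi] := df i; have [dgi sgi] := dg i; split=> [v Vv|].
  exact: derivableD (dfi v Vv) (dgi v Vv).
apply: (smooth_upto_eq oV _ (IH _ _ sfi sgi)) => v Vv.
exact: (esym (deriveD (dfi v Vv) (dgi v Vv))).
Qed.

Lemma smooth_uptoM N V f g : open V -> smooth_upto N V f -> smooth_upto N V g ->
  smooth_upto N V (fun v => f v * g v).
Proof.
move=> oV; have C f' g' : (forall v, V v -> {for v, continuous f'}) ->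
    (forall v, V v -> {for v, continuous g'}) ->
    forall v, V v -> {for v, continuous (fun v => f' v * g' v)}.
  by move=> cf cg v Vv; apply: continuousM; [exact: cf | exact: cg].
elim: N f g => [|N IH] f g sf sg; split=> //;
  try exact: C (smooth_upto_continuous sf) (smooth_upto_continuous sg).
move=> i; have [_ /(_ i)[dfi sfi]] := sf; have [_ /(_ i)[dgi sgi]] := sg.
split=> [v Vv|]; first exact: derivableM (dfi v Vv) (dgi v Vv).
apply: (smooth_upto_eq oV _ (smooth_uptoD oV (IH _ _ (smooth_uptoW sf) sgi)
   (IH _ _ (smooth_uptoW sg) sfi))) => v Vv.
exact: (esym (deriveM (dfi v Vv) (dgi v Vv))).
Qed.

Lemma smooth_uptoV N V f : open V -> (forall v, V v -> f v != 0) ->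
  smooth_upto N V f -> smooth_upto N V (fun v => (f v)^-1).
Proof.
move=> oV f0; have C : (forall v, V v -> {for v, continuous f}) ->
    forall v, V v -> {for v, continuous (fun v => (f v)^-1)}.
  by move=> cf v Vv; apply: continuousV; [exact: f0 | exact: cf].
elim: N => [|N IH] sf; split=> //; try exact: C (smooth_upto_continuous sf).
move=> i; have [_ /(_ i)[dfi sfi]] := sf.
split=> [v Vv|]; first exact: derivableV (f0 v Vv) (dfi v Vv).
have sfV := IH (smooth_uptoW sf).
apply: (smooth_upto_eq oV _ (smooth_uptoM oV (smooth_upto_cst N V (-1))
  (smooth_uptoM oV (smooth_uptoM oV sfV sfV) sfi))) => v Vv.
transitivity (- ((f v)^-1 * (f v)^-1) * partial i f v).
  by rewrite !mulNr mul1r.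
by rewrite /partial [RHS](deriveV (f0 v Vv) (dfi v Vv)) -exprVn expr2.
Qed.

Lemma smoothD V f g : open V -> smooth_on V f -> smooth_on V g ->
  smooth_on V (fun v => f v + g v).
Proof.
by move=> oV /smooth_onP sf /smooth_onP sg; apply/smooth_onP => N; exact: smooth_uptoD.
Qed.

Lemma smoothM V f g : open V -> smooth_on V f -> smooth_on V g ->
  smooth_on V (fun v => f v * g v).
Proof.
by move=> oV /smooth_onP sf /smooth_onP sg; apply/smooth_onP => N; exact: smooth_uptoM.
Qed.

Lemma smoothV V f : open V -> (forall v, V v -> f v != 0) -> smooth_on V f ->
  smooth_on V (fun v => (f v)^-1).
Proof.
by move=> oV f0 /smooth_onP sf; apply/smooth_onP => N; exact: smooth_uptoV.
Qed.

Lemma is_derive_coord (j : 'I_n) (v w : rV) :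
  is_derive v w (fun u : rV => u 0 j) (w 0 j).
Proof.
apply: DeriveDef; first exact/diff_derivable/differentiable_coord.
have := derive_mx (@derivable_id _ _ v w); rewrite derive_id => /matrixP/(_ 0 j).
by rewrite mxE => ->.
Qed.

Lemma partial_coord i j : partial i (fun u : rV => u 0 j) = fun=> (i == j)%:R.
Proof.
apply/funext => v; rewrite /partial (@derive_val _ _ _ _ _ _ _ (is_derive_coord j v 'e_i)).
by rewrite mxE eqxx eq_sym.
Qed.

Lemma smooth_coord V j : smooth_on V (fun u : rV => u 0 j).
Proof.
have C v : {for v, continuous (fun u : rV => u 0 j)} by exact: coord_continuous.
apply/smooth_onP => -[|N]; split=> // i.
split=> [v _|]; first exact/diff_derivable/differentiable_coord.
by rewrite partial_coord; exact: smooth_upto_cst.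
Qed.

Lemma derivable_line f w (e : rV) (s : R) : derivable f (s *: e + w) e ->
  is_derive s 1 (fun t => f (t *: e + w)) ('D_e f (s *: e + w)).
Proof.
move=> df; have E : (fun h : R => h^-1 *: (f ((h *: 1 + s) *: e + w) - f (s *: e + w))) =
    (fun h : R => h^-1 *: (f (h *: e + (s *: e + w)) - f (s *: e + w))).
  by apply/funext => h; rewrite [h *: 1]mulr1 scalerDl addrA.
by apply: DeriveDef; [rewrite /derivable /= E | rewrite /derive /= E].
Qed.

Lemma partial_mean_value f (w : rV) i (t : R) :
  (forall s : R, `|s| <= `|t| -> derivable f (s *: 'e_i + w) 'e_i) ->
  exists2 s : R, `|s| <= `|t| &
    f (t *: 'e_i + w) - f w = t * partial i f (s *: 'e_i + w).
Proof.
move=> df; have D (s : R) : `|s| <= `|t| -> is_derive s 1 (fun t => f (t *: 'e_i + w))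
    (partial i f (s *: 'e_i + w)) by move=> /df; exact: derivable_line.
have C (a b : R) : (forall s, s \in `[a, b] -> `|s| <= `|t|) ->
    {within `[a, b], continuous (fun t => f (t *: 'e_i + w))}.
  move=> H; apply: derivable_within_continuous => s /H /D ds.
  exact: ex_derive.
have [t0|t0] := leP 0 t.
  have H s : s \in `[0, t] -> `|s| <= `|t|.
    by rewrite in_itv /= => /andP[s0 st]; rewrite !ger0_norm.
  have [|s sI E] := @MVT_segment R _ (fun s => partial i f (s *: 'e_i + w)) _ _
    t0 _ (C 0 t H).
    by move=> s sI; apply: D; apply: H; apply: subset_itv_oo_cc sI.
  exists s; first exact: H.
  by move: E; rewrite /= scale0r add0r subr0 mulrC.
have H s : s \in `[t, 0] -> `|s| <= `|t|.
  rewrite in_itv /= => /andP[ts s0]; rewrite !ler0_norm ?lerN2 //.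
  exact: ltW.
have [|s sI E] := @MVT_segment R _ (fun s => partial i f (s *: 'e_i + w)) _ _
  (ltW t0) _ (C t 0 H).
  by move=> s sI; apply: D; apply: H; apply: subset_itv_oo_cc sI.
exists s; first exact: H.
move: E; rewrite /= scale0r add0r sub0r mulrN => /eqP.
by rewrite eq_sym -eqr_opp opprK opprB eq_sym mulrC => /eqP.
Qed.

(* the first k coordinates of h *)
Let prefix (h : rV) (k : nat) : rV := \row_i (if (i < k)%N then h 0 i else 0).

(** Goes from a to a + h along the coordinate axes, with the mean value theorem on
    each edge. *)
Lemma mean_value_sum f (a h : rV) :
  (forall w : rV, (forall i, `|w 0 i - a 0 i| <= `|h 0 i|) ->
     forall i, derivable f w 'e_i) ->
  exists2 xi : 'I_n -> rV, (forall k i, `|xi k 0 i - a 0 i| <= `|h 0 i|) &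
    f (h + a) - f a = \sum_k h 0 k * partial k f (xi k).
Proof.
move=> df.
have pS (k : 'I_n) : prefix h k.+1 = h 0 k *: 'e_k + prefix h k.
  apply/rowP => i; rewrite !mxE eqxx /= ltnS leq_eqVlt.
  have [->|nik] := eqVneq i k; first by rewrite !eqxx ltnn mulr1 addr0.
  by rewrite (inj_eq val_inj) (negbTE nik) mulr0 add0r.
have step (k : 'I_n) : exists xi : rV, (forall i, `|xi 0 i - a 0 i| <= `|h 0 i|) /\
    f (prefix h k.+1 + a) - f (prefix h k + a) = h 0 k * partial k f xi.
  have inbox (s : R) : `|s| <= `|h 0 k| -> forall i,
      `|(s *: 'e_k + (prefix h k + a)) 0 i - a 0 i| <= `|h 0 i|.
    move=> sh i; rewrite !mxE eqxx /= addrA addrK.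
    have [->|nik] := eqVneq i k; first by rewrite ltnn mulr1 addr0.
    by rewrite mulr0 add0r; case: ifP; rewrite ?normr0.
  have [s sh E] := @partial_mean_value f (prefix h k + a) k (h 0 k)
     (fun s sh => df _ (inbox s sh) k).
  exists (s *: 'e_k + (prefix h k + a)); split; first exact: inbox.
  by rewrite pS -addrA.
have [xi hxi] := choice step; exists xi => [k i|]; first by case: (hxi k).
have -> : \sum_k h 0 k * partial k f (xi k) =
    \sum_(k < n) (f (prefix h k.+1 + a) - f (prefix h k + a)).
  by apply: eq_bigr => k _; case: (hxi k).
rewrite -(big_mkord xpredT (fun k => f (prefix h k.+1 + a) - f (prefix h k + a))).
rewrite telescope_sumr //; congr (f (_ + a) - f _).
  by apply/rowP => i; rewrite mxE ltn_ord.
by apply/rowP => i; rewrite !mxE ltn0 add0r.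
Qed.

Lemma box_nbhs (a : rV) (P : rV -> Prop) : (\near a, P a) ->
  exists2 e : R, 0 < e & forall w : rV, (forall i, `|w 0 i - a 0 i| < e) -> P w.
Proof.
move=> /nbhs_ballP[e e0 He]; exists e => // w Hw; apply: He.
split=> // i j; rewrite (ord1 i) /ball /= distrC; exact: Hw.
Qed.

Lemma cvg_rowP (T : Type) (F : set_system T) (FF : Filter F) (u : T -> rV) (a : rV) :
  (forall i, u x 0 i @[x --> F] --> a 0 i) -> u x @[x --> F] --> a.
Proof.
move=> H; apply/cvgrPdist_lt => e e0; near=> x.
suff : ball a e (u x) by rewrite -ball_normE.
split=> // i j; rewrite (ord1 i) {i}; move: j.
near: x; apply: filter_forall => j; have /cvgrPdist_lt/(_ _ e0) := H j.
by [].
Unshelve. all: by end_near. Qed.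

Lemma cvg_finite_sum (T J : Type) (F : set_system T) (FF : Filter F) (r : seq J)
    (u : J -> T -> R) (l : J -> R) : (forall j, u j x @[x --> F] --> l j) ->
  \sum_(j <- r) u j x @[x --> F] --> \sum_(j <- r) l j.
Proof.
move=> ul; elim: r => [|j r IH].
  by rewrite big_nil; under eq_cvg do rewrite big_nil; exact: cvg_cst.
by rewrite big_cons; under eq_cvg do rewrite big_cons; exact: cvgD (ul j) IH.
Qed.

(** By [mean_value_sum] the increment of f along that of p is a sum of increments
    of the components of p multiplied with partial derivatives of f at points that
    tend to p v, where these derivatives are continuous. *)
Lemma is_derive_comp f (p : rV -> rV) (v : rV) i W : open W -> W (p v) ->
  smooth_upto 1 W f -> (forall j, derivable (fun u => p u 0 j) v 'e_i) ->
  is_derive v 'e_i (f \o p)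
    (\sum_j partial i (fun u => p u 0 j) v * partial j f (p v)).
Proof.
move=> oW Wpv [_ df] dp.
have [e e0 He] := box_nbhs (near_open oW Wpv).
pose h (t : R) : rV := p (t *: 'e_i + v) - p v.
have dh j : t^-1 * h t 0 j @[t --> (0 : R)^'] --> partial i (fun u => p u 0 j) v.
  have E : (fun t : R => t^-1 * h t 0 j) =
      (fun t : R => t^-1 *: (p (t *: 'e_i + v) 0 j - p v 0 j)).
    by apply/funext => t; rewrite /h !mxE.
  by rewrite E; exact: dp.
have h0 j : h t 0 j @[t --> (0 : R)^'] --> (0 : R).
  have E : {near (0 : R)^', (fun t : R => t * (t^-1 * h t 0 j)) =1 (fun t => h t 0 j)}.
    near=> t; have t0 : t != 0 by near: t; exact: nbhs_dnbhs_neq.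
    by rewrite mulrA mulfV // mul1r.
  have L : t * (t^-1 * h t 0 j) @[t --> (0 : R)^'] -->
      0 * partial i (fun u => p u 0 j) v.
    by apply: cvgM (dh j); exact: nbhs_dnbhs.
  by rewrite mul0r in L; exact: cvg_trans (near_eq_cvg E) L.
have small : \forall t \near (0 : R)^', forall j, `|h t 0 j| < e.
  apply: filter_forall => j; have /cvgr0Pnorm_lt/(_ _ e0) := h0 j.
  by [].
have : forall t, exists y : 'I_n -> rV, (forall j, `|h t 0 j| < e) ->
    (forall k j, `|y k 0 j - p v 0 j| <= `|h t 0 j|) /\
    f (h t + p v) - f (p v) = \sum_k h t 0 k * partial k f (y k).
  move=> t.
  have [ht|nht] := pselect (forall j, `|h t 0 j| < e); last by exists (fun=> 0).
  have [|y y1 y2] := @mean_value_sum f (p v) (h t); last by exists y.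
  move=> w Hw j; have [dj _] := df j; apply: dj; apply: He => l.
  exact: le_lt_trans (Hw l) (ht l).
move=> /choice[xi Hxi].
have cxi k : xi t k @[t --> (0 : R)^'] --> p v.
  apply: cvg_rowP => j; apply/cvgrPdist_lt => r r0.
  near=> t; rewrite distrC; have ht : forall j, `|h t 0 j| < e by near: t.
  apply: le_lt_trans ((Hxi t ht).1 k j) _.
  by near: t; have /cvgr0Pnorm_lt/(_ _ r0) := h0 j.
have C : t^-1 *: (f (p (t *: 'e_i + v)) - f (p v)) @[t --> (0 : R)^'] -->
    \sum_j partial i (fun u => p u 0 j) v * partial j f (p v).
  have E : {near (0 : R)^', (fun t : R => \sum_k (t^-1 * h t 0 k) * partial k f (xi t k))
      =1 (fun t => t^-1 *: (f (p (t *: 'e_i + v)) - f (p v)))}.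
    near=> t; have ht : forall j, `|h t 0 j| < e by near: t.
    rewrite -[p (_ + v)](subrK (p v)) (Hxi t ht).2 -[RHS]/(_ * _) mulr_sumr.
    by apply: eq_bigr => k _; rewrite mulrA.
  apply: (cvg_trans (near_eq_cvg E)).
  apply: cvg_finite_sum => k; apply: cvgM (dh k) _.
  have [_ sk] := df k.
  apply: (@cvg_comp _ _ _ (fun t => xi t k) (partial k f) _ _ _ (cxi k)).
  exact: (@smooth_upto_continuous 0 W (partial k f) sk _ Wpv).
apply: DeriveDef; first by apply/cvg_ex; eexists; exact: C.
exact: cvg_lim C.
Unshelve. all: by end_near. Qed.

Lemma smooth_upto_sum N V (J : Type) (r : seq J) (u : J -> rV -> R) : open V ->
  (forall j, smooth_upto N V (u j)) -> smooth_upto N V (fun v => \sum_(j <- r) u j v).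
Proof.
move=> oV su; elim: r => [|j r IH].
  by apply: smooth_upto_eq (smooth_upto_cst N V 0) => // v _; rewrite big_nil.
by apply: smooth_upto_eq (smooth_uptoD oV (su j) IH) => // v _; rewrite big_cons.
Qed.

Lemma smooth_sum V (J : Type) (r : seq J) (u : J -> rV -> R) : open V ->
  (forall j, smooth_on V (u j)) -> smooth_on V (fun v => \sum_(j <- r) u j v).
Proof.
move=> oV su; apply/smooth_onP => N; apply: smooth_upto_sum => // j.
by move: N; apply/smooth_onP.
Qed.

Lemma smooth_prod V (J : Type) (r : seq J) (u : J -> rV -> R) : open V ->
  (forall j, smooth_on V (u j)) -> smooth_on V (fun v => \prod_(j <- r) u j v).
Proof.
move=> oV su; elim: r => [|j r IH].
  by refine (smooth_eq oV _ (@smooth_cst V 1)) => v _; rewrite big_nil.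
by refine (smooth_eq oV _ (smoothM oV (su j) IH)) => v _; rewrite big_cons.
Qed.

Lemma smooth_upto_comp N V W f (p : rV -> rV) : open V -> open W ->
  (forall v, V v -> W (p v)) -> (forall j, smooth_on V (fun v => p v 0 j)) ->
  (forall N, smooth_upto N W f) -> smooth_upto N V (f \o p).
Proof.
move=> oV oW pVW sp.
have cp v : V v -> {for v, continuous p}.
  by move=> Vv; apply: (@cvg_rowP _ (nbhs v) _) => j; case: (sp j [::] v Vv).
elim: N f => [|N IH] f sf.
  split=> // v Vv; apply: continuous_comp; first exact: cp.
  exact: (smooth_upto_continuous (sf 0%N) (pVW v Vv)).
have dp j i v : V v -> derivable (fun u => p u 0 j) v 'e_i.
  by move=> Vv; case: (sp j [::] v Vv).
have D v i : V v -> is_derive v 'e_i (f \o p)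
    (\sum_j partial i (fun u => p u 0 j) v * partial j f (p v)).
  by move=> Vv; apply: (is_derive_comp oW (pVW v Vv) (sf 1%N)) => j; exact: dp.
split=> [v Vv|i].
  apply: continuous_comp; first exact: cp.
  exact: (smooth_upto_continuous (sf 0%N) (pVW v Vv)).
split=> [v Vv|]; first by have := D v i Vv.
have sfj j : forall N, smooth_upto N W (partial j f).
  by move=> N'; case: (sf N'.+1) => _ /(_ j)[].
apply: (smooth_upto_eq (f := fun v => \sum_j partial i (fun u => p u 0 j) v *
   (partial j f \o p) v)) => // [v Vv|].
  by have := D v i Vv => ?; rewrite /partial derive_val.
apply: smooth_upto_sum => // j; apply: smooth_uptoM => //; last exact: IH.
by have /smooth_onP := smooth_partial i (sp j).
Qed.

Lemma smooth_comp V W f (p : rV -> rV) : open V -> open W ->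
  (forall v, V v -> W (p v)) -> (forall j, smooth_on V (fun v => p v 0 j)) ->
  smooth_on W f -> smooth_on V (f \o p).
Proof.
by move=> oV oW pVW sp /smooth_onP sf; apply/smooth_onP => N; exact: smooth_upto_comp sf.
Qed.

(** The mean value theorem, applied along 'e_i and then along 'e_j.  The second
    difference is symmetric in i and j, which gives [partialC] as r tends to 0. *)
Lemma second_difference f (v : rV) (i j : 'I_n) (r : R) : 0 < r ->
  (forall s t : R, `|s| <= r -> `|t| <= r ->
     derivable f (s *: 'e_i + (t *: 'e_j + v)) 'e_i /\
     derivable (partial i f) (t *: 'e_j + (s *: 'e_i + v)) 'e_j) ->
  exists s t : R, [/\ `|s| <= r, `|t| <= r &
    f (r *: 'e_i + (r *: 'e_j + v)) - f (r *: 'e_i + v) - (f (r *: 'e_j + v) - f v) =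
    r * (r * partial j (partial i f) (t *: 'e_j + (s *: 'e_i + v)))].
Proof.
move=> r0 df; have rr : `|r| = r by rewrite gtr0_norm.
pose g (w : rV) := f (r *: 'e_j + w) - f w.
have n0 : `|0 : R| <= r by rewrite normr0 ltW.
have dsh (w : rV) : derivable f (r *: 'e_j + w) 'e_i ->
   is_derive w 'e_i (fun w => f (r *: 'e_j + w)) (partial i f (r *: 'e_j + w)).
  move=> d; have E : (fun h : R => h^-1 *: (f (r *: 'e_j + (h *: 'e_i + w)) - f (r *: 'e_j + w)))
     = (fun h : R => h^-1 *: (f (h *: 'e_i + (r *: 'e_j + w)) - f (r *: 'e_j + w))).
    by apply/funext => h; rewrite addrCA.
  by apply: DeriveDef; [rewrite /derivable /= E | rewrite /derive /= E].
have dg (s : R) : `|s| <= r -> is_derive (s *: 'e_i + v) 'e_i g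
    (partial i f (r *: 'e_j + (s *: 'e_i + v)) - partial i f (s *: 'e_i + v)).
  move=> sr; apply: is_deriveB.
    by apply: dsh; rewrite addrCA; apply: (df s r sr _).1; rewrite rr.
  apply: derivableP; have := (df s 0 sr n0).1; by rewrite scale0r add0r.
have dgi (s : R) : `|s| <= `|r| -> derivable g (s *: 'e_i + v) 'e_i.
  by rewrite rr => H; case: (dg s H).
have [s sr Es] := partial_mean_value dgi; rewrite rr in sr.
have dfj (t : R) : `|t| <= `|r| -> derivable (partial i f) (t *: 'e_j + (s *: 'e_i + v)) 'e_j.
  by rewrite rr => tr; case: (df s t sr tr).
have [t tr Et] := partial_mean_value dfj; rewrite rr in tr.
exists s, t; split=> //; rewrite -Et; transitivity (g (r *: 'e_i + v) - g v).
  by rewrite /g addrCA [in RHS]opprB; lra.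
by rewrite Es /partial (@derive_val _ _ _ _ _ _ _ (dg s sr)).
Qed.

Lemma partialC V f v i j : open V -> V v -> smooth_on V f ->
  partial i (partial j f) v = partial j (partial i f) v.
Proof.
move=> oV Vv sf.
have [e e0 He] := box_nbhs (near_open oV Vv).
have near_v (r s t : R) (k l m : 'I_n) : `|s| <= r -> `|t| <= r ->
    `|(s *: 'e_k + (t *: 'e_l + v)) 0 m - v 0 m| <= r + r.
  move=> sr tr; rewrite !mxE eqxx /= addrA addrK (le_trans (ler_normD _ _)) //.
  by apply: lerD; rewrite normrM; [move: sr | move: tr]; case: eqP => _;
    rewrite ?normr1 ?normr0 ?mulr1 ?mulr0 // => /(le_trans (normr_ge0 _)).
have sP k := smooth_partial k sf.
have H (k l : 'I_n) (r : R) : 0 < r -> r + r < e -> forall s t : R, `|s| <= r -> `|t| <= r ->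
     derivable f (s *: 'e_k + (t *: 'e_l + v)) 'e_k /\
     derivable (partial k f) (t *: 'e_l + (s *: 'e_k + v)) 'e_l.
  move=> r0 re s t sr tr; have V1 : V (s *: 'e_k + (t *: 'e_l + v)).
    by apply: He => m; apply: le_lt_trans (near_v r s t k l m sr tr) re.
  split; first by case: (sf [::] _ V1) => _; exact.
  by rewrite addrCA; case: (sP k [::] _ V1) => _; exact.
have cont (k l : 'I_n) := (sf [:: k; l] v Vv).1.
apply/eqP; rewrite -subr_eq0 -normr_eq0 eq_le normr_ge0 andbT; apply/ler_addgt0Pl => eps eps0; rewrite addr0.
have eps2 : 0 < eps / 2 by rewrite divr_gt0.
have /cvgrPdist_lt/(_ _ eps2)/box_nbhs[e1 e10 H1] := cont i j.
have /cvgrPdist_lt/(_ _ eps2)/box_nbhs[e2 e20 H2] := cont j i.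
pose r := Num.min e (Num.min e1 e2) / 3.
have m0 : 0 < Num.min e (Num.min e1 e2) by rewrite !lt_min e0 e10.
have r0 : 0 < r by rewrite divr_gt0.
have r2 : r + r < Num.min e (Num.min e1 e2) by rewrite /r; lra.
move: (r2); rewrite !lt_min => /and3P[re re1 re2].
have [s [t [sr tr E1]]] := second_difference r0 (H i j r r0 re).
have [s' [t' [sr' tr' E2]]] := second_difference r0 (H j i r r0 re).
have E : partial j (partial i f) (t *: 'e_j + (s *: 'e_i + v)) =
    partial i (partial j f) (t' *: 'e_i + (s' *: 'e_j + v)).
  have rn : r != 0 by rewrite gt_eqF.
  have sw : r *: 'e_j + (r *: 'e_i + v) = r *: 'e_i + (r *: 'e_j + v) by rewrite addrCA.
  rewrite sw in E2.
  have {}E1 := esym E1; have {}E2 := esym E2.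
  move: (partial j _ _) (partial i (partial j f) _) E1 E2 => x y E1 E2.
  apply: (mulfI rn); apply: (mulfI rn); rewrite E1 E2.
  by move: (f _) (f _) (f _) (f _) => x1 x2 x3 x4; ring.
have := H2 (t *: 'e_j + (s *: 'e_i + v)) (fun m => le_lt_trans (near_v r t s j i m tr sr) re2).
have := H1 (t' *: 'e_i + (s' *: 'e_j + v)) (fun m => le_lt_trans (near_v r t' s' i j m tr' sr') re1).
rewrite /= E => A B; rewrite distrC in B; rewrite (splitr eps).
apply: le_trans (ler_distD _ _ _) _; apply: lerD; [exact: ltW A | exact: ltW B].
Qed.

End SmoothCalculus.

(** * Bump functions *)
Section Flat.
Variable R : realType.
Implicit Types (t : R) (k : nat).

(** t^-k exp(-1/t), extended by 0: the derivative of a function of this family is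
    a linear combination of functions of the family ([is_derive_flat]), which makes
    all of them smooth. *)
Definition flat k t : R := if 0 < t then t^-1 ^+ k * expR (- t^-1) else 0.

Lemma flat_gt0 t : 0 < t -> 0 < flat 0 t.
Proof. by move=> t0; rewrite /flat t0 mul1r expR_gt0. Qed.

Lemma flat_le0 k t : t <= 0 -> flat k t = 0.
Proof. by move=> t0; rewrite /flat ltNge t0. Qed.

Lemma flat_ge0 k t : 0 <= flat k t.
Proof.
rewrite /flat; case: ifP => // t0.
by rewrite mulr_ge0 ?expR_ge0 // exprn_ge0 // invr_ge0 ltW.
Qed.

(** exp s is at least s^(k+1) / (k+1)!, taken at s = 1/t. *)
Lemma flat_bound k t : flat k t <= k.+1`!%:R * `|t|.
Proof.
rewrite /flat; case: ifPn => [t0|_]; last by rewrite mulr_ge0.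
have s0 : 0 < t^-1 by rewrite invr_gt0.
have F0 : 0 < (k.+1`!%:R : R) by rewrite ltr0n fact_gt0.
rewrite expRN ler_pdivrMr ?expR_gt0 // gtr0_norm //.
have H : t^-1 ^+ k.+1 / k.+1`!%:R <= expR t^-1.
  by apply: le_trans (expR_ge1Dxn k (ltW s0)); rewrite lerDr.
have -> : t^-1 ^+ k = k.+1`!%:R * t * (t^-1 ^+ k.+1 / k.+1`!%:R).
  rewrite exprS; field.
  by rewrite (gt_eqF F0) (gt_eqF t0).
by rewrite ler_pM2l // mulr_gt0.
Qed.

Lemma flatS k t : t^-1 * flat k t = flat k.+1 t.
Proof. by rewrite /flat; case: ifP; rewrite ?mulr0 // exprS mulrA. Qed.

Lemma is_derive_flat k t :
  is_derive t 1 (flat k) (flat k.+2 t - k%:R * flat k.+1 t).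
Proof.
have [t0|t0|->] := ltgtP t 0.
- have E : {near t, (fun=> 0) =1 flat k}.
    by near=> u; rewrite flat_le0 // ltW //; near: u; exact: lt_nbhsl.
  rewrite !flat_le0 ?ltW // mulr0 subr0.
  apply: (@near_eq_is_derive _ _ _ (fun=> 0) (flat k) t 1) => //.
- have E : {near t, (fun u => u^-1 ^+ k * expR (- u^-1)) =1 flat k}.
    near=> u; rewrite /flat ifT //; near: u; exact: lt_nbhsr.
  apply: (@near_eq_is_derive _ _ _ _ (flat k) t 1 _ E).
  have tn : t != 0 by rewrite gt_eqF.
  have dV : is_derive t 1 (fun u : R => u^-1) (- t ^- 2).
    apply: DeriveDef; first exact: (@derivableV _ _ id t 1 tn).
    by rewrite (@deriveV _ _ id t 1 tn) // derive_id [LHS]mulr1.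
  have dN : is_derive t 1 (fun u : R => - u^-1) (t ^- 2).
    by apply: is_derive_eq; rewrite opprK.
  have dE : is_derive t 1 (fun u : R => expR (- u^-1)) (expR (- t^-1) * t ^- 2).
    exact: is_derive1_comp.
  have dX : is_derive t 1 (fun u : R => u^-1 ^+ k) (k%:R * t^-1 ^+ k.-1 * - t ^- 2).
    have -> : (fun u : R => u^-1 ^+ k) = (fun u : R => u^-1) ^+ k.
      by apply/funext => u; rewrite fctE.
    exact: is_deriveX.
  apply: (is_derive_eq (is_deriveM dX dE)).
  rewrite /flat t0 -![_ *: _]/(_ * _) -exprVn; case: k E dX => [|k] E dX.
    by rewrite !mul0r mulr0 addr0 subr0 expr0 mul1r mulrC.
  by rewrite /= !exprS; ring.
have H0 : flat k 0 = 0 by rewrite flat_le0.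
have C : h^-1 *: (flat k (h *: 1 + 0) - flat k 0) @[h --> (0 : R)^'] --> (0 : R).
  apply/cvgrPdist_lt => e e0.
  have F0 : 0 < (k.+2`!%:R : R) by rewrite ltr0n fact_gt0.
  have ef : 0 < e / k.+2`!%:R by rewrite divr_gt0.
  near=> h; rewrite sub0r normrN addr0 H0 subr0 [h *: 1]mulr1 -[_ *: _]/(_ * _) flatS.
  rewrite ger0_norm ?flat_ge0 //; apply: le_lt_trans (flat_bound _ _) _.
  rewrite mulrC -ltr_pdivlMr //; near: h.
  by apply: dnbhs0_lt.
rewrite !flat_le0 // mulr0 subr0.
apply: DeriveDef; first by apply/cvg_ex; eexists; exact: C.
exact: cvg_lim C.
Unshelve. all: by end_near. Qed.

End Flat.

Section Bump.
Variables (R : realType) (n : nat).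
Notation rV := 'rV[R]_n.
Implicit Types (f g : rV -> R) (V W : set rV).

Lemma is_derive_lineP f (v e : rV) (c : R) :
  is_derive v e f c <-> is_derive (0 : R) 1 (fun h : R => f (h *: e + v)) c.
Proof.
have E : (fun h : R => h^-1 *: (f ((h *: 1 + 0) *: e + v) - f (0 *: e + v))) =
    (fun h : R => h^-1 *: (f (h *: e + v) - f v)).
  by apply/funext => h; rewrite [h *: 1]mulr1 addr0 scale0r add0r.
split=> -[d <-]; (apply: DeriveDef; [move: d|]);
  by rewrite /derivable /derive /= ?E //= -?E.
Qed.

Lemma is_derive_outer (u : R -> R) g (v e : rV) (a b : R) :
  is_derive (g v) 1 u a -> is_derive v e g b -> is_derive v e (u \o g) (a * b).
Proof.
move=> du /is_derive_lineP dg; apply/is_derive_lineP.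
apply: (@is_derive1_comp R u (fun h : R => g (h *: e + v)) 0 a b _ dg).
by rewrite scale0r add0r.
Qed.

Lemma smooth_flat V g k : open V -> smooth_on V g -> smooth_on V (flat k \o g).
Proof.
move=> oV sg; apply/smooth_onP => N; elim: N k => [|N IH] k.
  split=> // v Vv; apply: continuous_comp; first by case: (sg [::] v Vv).
  apply/differentiable_continuous/derivable1_diffP.
  by case: (is_derive_flat k (g v)).
have D v i : V v -> is_derive v 'e_i (flat k \o g)
    ((flat k.+2 (g v) - k%:R * flat k.+1 (g v)) * partial i g v).
  move=> Vv; apply: is_derive_outer; first exact: is_derive_flat.
  by apply: derivableP; case: (sg [::] v Vv) => _; exact.
split=> [v Vv|i]; first exact: (smooth_upto_continuous (IH k) Vv).
split=> [v Vv|]; first by case: (D v i Vv).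
have /smooth_onP/(_ N) sgi := smooth_partial i sg.
apply: (smooth_upto_eq oV _ (smooth_uptoM oV (smooth_uptoD oV (IH k.+2)
   (smooth_uptoM oV (smooth_upto_cst N V (- k%:R)) (IH k.+1))) sgi)) => v Vv.
by case: (D v i Vv) => _; rewrite /partial => ->; rewrite mulNr.
Qed.

(** A smooth function that is 0 for t <= 0 and 1 for t >= 1. *)
Definition step (t : R) : R := flat 0 t / (flat 0 t + flat 0 (1 - t)).

Lemma step_den_gt0 (t : R) : 0 < flat 0 t + flat 0 (1 - t).
Proof.
have [t0|t0] := ltP 0 t; first by rewrite ltr_pwDl ?flat_gt0 ?flat_ge0.
by rewrite ltr_wpDl ?flat_ge0 // flat_gt0 //; lra.
Qed.

Lemma step_le0 (t : R) : t <= 0 -> step t = 0.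
Proof. by move=> t0; rewrite /step flat_le0 // mul0r. Qed.

Lemma step_ge1 (t : R) : 1 <= t -> step t = 1.
Proof.
move=> t1; rewrite /step [flat 0 (1 - t)]flat_le0 ?addr0 ?divff //; last by lra.
by rewrite gt_eqF // flat_gt0 //; lra.
Qed.

Lemma smooth_step V g : open V -> smooth_on V g -> smooth_on V (step \o g).
Proof.
move=> oV sg; have sg1 : smooth_on V (fun v => 1 + (-1) * g v).
  exact: (smoothD oV (@smooth_cst _ _ V 1) (smoothM oV (@smooth_cst _ _ V (-1)) sg)).
have s0 := smooth_flat 0 oV sg; have s1 := smooth_flat 0 oV sg1.
have := smoothM oV s0 (smoothV oV _ (smoothD oV s0 s1)).
have E v : 1 + -1 * g v = 1 - g v by rewrite mulN1r.
rewrite /comp; under eq_fun do rewrite E.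
by apply=> v Vv; rewrite E gt_eqF // step_den_gt0.
Qed.

(** Equal to 1 on the cube of half side r around a, and to 0 outside the cube of
    half side 2 r: the argument of [step] is at least 1 if |v_i - a_i| <= r, and
    negative if |v_i - a_i| >= 2 r. *)
Definition bump_fun (a : rV) (r : R) (v : rV) : R :=
  \prod_(i < n) step (2 - ((v 0 i - a 0 i) / r) ^+ 2).

Lemma smooth_bump V (a : rV) (r : R) : open V -> smooth_on V (bump_fun a r).
Proof.
move=> oV; apply: smooth_prod => // i; apply: smooth_step => //.
have sq : smooth_on V (fun v => (v 0 i + - a 0 i) * r^-1).
  exact: (smoothM oV (smoothD oV (@smooth_coord _ _ V i) (@smooth_cst _ _ V (- a 0 i)))
    (@smooth_cst _ _ V r^-1)).
have := smoothD oV (@smooth_cst _ _ V 2) (smoothM oV (@smooth_cst _ _ V (-1)) (smoothM oV sq sq)).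
by under eq_fun do rewrite mulN1r -expr2.
Qed.

Lemma bump_eq1 (a : rV) (r : R) (v : rV) : 0 < r -> (forall i, `|v 0 i - a 0 i| <= r) -> bump_fun a r v = 1.
Proof.
move=> r0 H; rewrite /bump_fun big1 // => i _; apply: step_ge1.
have : ((v 0 i - a 0 i) / r) ^+ 2 <= 1.
  by rewrite -[X in X <= _]real_normK ?num_real // expr_le1 // normrM normfV
    (gtr0_norm r0) ler_pdivrMr // mul1r.
lra.
Qed.

Lemma bump_eq0 (a : rV) (r : R) (v : rV) i : 0 < r -> r *+ 2 <= `|v 0 i - a 0 i| -> bump_fun a r v = 0.
Proof.
move=> r0 H; rewrite /bump_fun (bigD1 i) //= step_le0 ?mul0r //.
have : 2 <= `|(v 0 i - a 0 i) / r|.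
  by rewrite normrM normfV (gtr0_norm r0) ler_pdivlMr // mulr_natl.
rewrite -(real_normK (num_real ((v 0 i - a 0 i) / r))) => H2.
by rewrite subr_le0; move: (`| _ |) H2 => x x2; nra.
Qed.

End Bump.

(** * The ring of smooth functions on an open set *)

(** The point guarantees that 1 differs from 0 in the ring of functions. *)
Record pointed_open (R : realType) (n : nat) := PointedOpen {
  popen :> set 'rV[R]_n;
  popen_open : open popen;
  popoint : 'rV[R]_n;
  popointP : popen popoint }.

Section SmoothRing.
Variables (R : realType) (n : nat) (P : pointed_open R n).
Notation rV := 'rV[R]_n.
Notation V := (popen P).

(** A function on V is extended by 0, so that functions that agree on V are equal
    ([sfun_inj]). *)
Record smoothfun := SmoothFun {
  sfun :> rV -> R;
  sfun_smooth : smooth_on V sfun;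
  sfun_out : forall v, ~ V v -> sfun v = 0 }.

Lemma sfun_inj (f g : smoothfun) : (forall v, V v -> f v = g v) -> f = g.
Proof.
case: f g => [f sf of_] [g sg og] /= fg.
have {}fg : f = g.
  by apply/funext => v; have [/fg//|Vv] := pselect (V v); rewrite of_ ?og.
by case: _ / fg in sg og *; congr SmoothFun; exact: Prop_irrelevance.
Qed.

HB.instance Definition _ := gen_eqMixin smoothfun.
HB.instance Definition _ := gen_choiceMixin smoothfun.

Let oV := @popen_open _ _ P.

Definition cutoff (f : rV -> R) (v : rV) : R := if `[< V v >] then f v else 0.

Lemma cutoffE f v : V v -> cutoff f v = f v.
Proof. by move=> Vv; rewrite /cutoff asboolT. Qed.

Lemma cutoff_out f v : ~ V v -> cutoff f v = 0.
Proof. by move=> Vv; rewrite /cutoff asboolF. Qed.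

Lemma cutoff_smooth f : smooth_on V f -> smooth_on V (cutoff f).
Proof. by move=> sf; refine (smooth_eq oV _ sf) => v Vv; rewrite cutoffE. Qed.

Definition restr f (sf : smooth_on V f) : smoothfun :=
  SmoothFun (cutoff_smooth sf) (@cutoff_out f).

Lemma restrE f (sf : smooth_on V f) v : V v -> restr sf v = f v.
Proof. exact: cutoffE. Qed.

Definition sf_cst r : smoothfun := restr (@smooth_cst _ _ V r).
Definition sf_add (f g : smoothfun) : smoothfun :=
  restr (smoothD oV (sfun_smooth f) (sfun_smooth g)).
Definition sf_mul (f g : smoothfun) : smoothfun :=
  restr (smoothM oV (sfun_smooth f) (sfun_smooth g)).
Definition sf_opp (f : smoothfun) : smoothfun := sf_mul (sf_cst (-1)) f.
Definition sf_der i (f : smoothfun) : smoothfun := restr (smooth_partial i (sfun_smooth f)).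

Lemma sf_oppE (f : smoothfun) v : V v -> sf_opp f v = - f v.
Proof. by move=> Vv; rewrite !restrE // mulN1r. Qed.

Lemma sf_addA : associative sf_add.
Proof. by move=> f g h; apply: sfun_inj => v Vv; rewrite !restrE // addrA. Qed.
Lemma sf_addC : commutative sf_add.
Proof. by move=> f g; apply: sfun_inj => v Vv; rewrite !restrE // addrC. Qed.
Lemma sf_add0 : left_id (sf_cst 0) sf_add.
Proof. by move=> f; apply: sfun_inj => v Vv; rewrite !restrE // add0r. Qed.
Lemma sf_addN : left_inverse (sf_cst 0) sf_opp sf_add.
Proof.
by move=> f; apply: sfun_inj => v Vv; rewrite !restrE // mulN1r addNr.
Qed.
HB.instance Definition _ := GRing.isZmodule.Build smoothfun sf_addA sf_addC sf_add0 sf_addN.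

Lemma sf_mulA : associative sf_mul.
Proof. by move=> f g h; apply: sfun_inj => v Vv; rewrite !restrE // mulrA. Qed.
Lemma sf_mulC : commutative sf_mul.
Proof. by move=> f g; apply: sfun_inj => v Vv; rewrite !restrE // mulrC. Qed.
Lemma sf_mul1 : left_id (sf_cst 1) sf_mul.
Proof. by move=> f; apply: sfun_inj => v Vv; rewrite !restrE // mul1r. Qed.
Lemma sf_mulDl : left_distributive sf_mul sf_add.
Proof. by move=> f g h; apply: sfun_inj => v Vv; rewrite !restrE // mulrDl. Qed.
Lemma sf_1neq0 : sf_cst 1 != 0 :> smoothfun.
Proof.
apply/eqP => /(congr1 (fun f : smoothfun => f (popoint P))).
have Vp := @popointP _ _ P; rewrite !restrE // => /eqP; exact/negP/oner_neq0.
Qed.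
HB.instance Definition _ := GRing.Zmodule_isComNzRing.Build smoothfun
  sf_mulA sf_mulC sf_mul1 sf_mulDl sf_1neq0.

Definition sf_eval (v : rV) (Vv : V v) (f : smoothfun) : R := f v.

Section Eval.
Variables (v : rV) (Vv : V v).

Lemma sf_eval_zmod : zmod_morphism (sf_eval Vv).
Proof.
by move=> f g; rewrite /sf_eval [LHS]restrE //; congr (_ + _); exact: sf_oppE.
Qed.
HB.instance Definition _ :=
  GRing.isZmodMorphism.Build smoothfun R (sf_eval Vv) sf_eval_zmod.

Lemma sf_eval_monoid : monoid_morphism (sf_eval Vv).
Proof. by split=> [|f g]; rewrite /sf_eval [LHS]restrE. Qed.
HB.instance Definition _ :=
  GRing.isMonoidMorphism.Build smoothfun R (sf_eval Vv) sf_eval_monoid.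
End Eval.

Lemma smoothfunP (f g : smoothfun) :
  (forall v (Vv : V v), sf_eval Vv f = sf_eval Vv g) -> f = g.
Proof. by move=> fg; apply: sfun_inj => v Vv; exact: (fg v Vv). Qed.

Lemma sf_torsion_free (f : smoothfun) m : f *+ m.+1 = 0 -> f = 0.
Proof.
move=> f0; apply: smoothfunP => v Vv; rewrite raddf0.
have /eqP := congr1 (sf_eval Vv) f0; rewrite raddfMn raddf0 /= mulrn_eq0.
by move/eqP.
Qed.

Lemma sf_half : sf_cst 2^-1 *+ 2 = 1.
Proof.
apply: smoothfunP => v Vv; rewrite raddfMn rmorph1 /= [X in X *+ 2](restrE (@smooth_cst _ _ V 2^-1) Vv).
by rewrite -[LHS]mulr_natr mulVf // pnatr_eq0.
Qed.

Lemma sf_derE i (f : smoothfun) v : V v -> sf_der i f v = partial i f v.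
Proof. exact: restrE. Qed.

Lemma sf_der_zmod i : zmod_morphism (sf_der i).
Proof.
move=> f g; apply: smoothfunP => v Vv; rewrite (raddfB (sf_eval Vv)).
rewrite -[LHS]/(sf_der i (f - g) v) -[RHS]/(sf_der i f v - sf_der i g v) !sf_derE //.
have E w : V w -> (f - g) w = f w + (-1) * g w.
  move=> Vw; rewrite mulN1r; exact: (@sf_eval_zmod w Vw f g).
have [_ df] := @sfun_smooth f [::] v Vv.
have [_ dg] := @sfun_smooth g [::] v Vv.
rewrite (partial_eq_on i (g := fun w => f w - g w) oV _ Vv); last first.
  by move=> w Vw; rewrite E // mulN1r.
exact: (deriveB (df i) (dg i)).
Qed.
HB.instance Definition _ i :=
  GRing.isZmodMorphism.Build smoothfun smoothfun (sf_der i) (@sf_der_zmod i).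

Lemma sf_derM i (f g : smoothfun) : sf_der i (f * g) = sf_der i f * g + f * sf_der i g.
Proof.
apply: smoothfunP => v Vv; rewrite (rmorphD (sf_eval Vv)) !(rmorphM (sf_eval Vv)).
rewrite -[LHS]/(sf_der i (f * g) v).
rewrite -[RHS]/(sf_der i f v * g v + f v * sf_der i g v) !sf_derE //.
have [_ df] := @sfun_smooth f [::] v Vv.
have [_ dg] := @sfun_smooth g [::] v Vv.
rewrite (partial_eq_on i (g := fun w => f w * g w) oV _ Vv); last first.
  by move=> w Vw; exact: restrE.
by rewrite [LHS](deriveM (df i) (dg i)) addrC [X in _ = X + _]mulrC.
Qed.

Lemma sf_derC i j (f : smoothfun) : sf_der i (sf_der j f) = sf_der j (sf_der i f).
Proof.
apply: sfun_inj => v Vv.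
transitivity (partial i (sf_der j f) v); first exact: sf_derE.
transitivity (partial j (sf_der i f) v); last exact: esym (sf_derE j _ Vv).
have e k w : V w -> sf_der k f w = partial k f w by exact: sf_derE.
rewrite (partial_eq_on i oV (e j) Vv) (partial_eq_on j oV (e i) Vv).
exact: (partialC i j oV Vv (sfun_smooth f)).
Qed.

Definition sf_coord j : smoothfun := restr (@smooth_coord _ _ V j).

Lemma sf_der_coord i j : sf_der i (sf_coord j) = (i == j)%:R.
Proof.
apply: smoothfunP => v Vv; rewrite rmorph_nat /sf_eval sf_derE //.
rewrite (partial_eq_on i (g := fun u : rV => u 0 j) oV _ Vv) ?partial_coord //.
by move=> w Vw; exact: restrE.
Qed.

End SmoothRing.

(** * Local expressions *)
Section CoefficientMap.
Variables (K K' : comNzRingType) (n d : nat).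

Definition smap (h : K -> K') (F : spoly K n d) : spoly K' n d :=
  [ffun S => map_mpoly h (F S)].

Lemma mcoeff_map_mpoly0 (h : K -> K') (p : mpoly n K) m : h 0 = 0 ->
  mcoeff m (map_mpoly h p) = h (mcoeff m p).
Proof.
move=> h0; rewrite /map_mpoly /mmap raddf_sum /=.
have E m' : mcoeff m (mpolyC n (h (mcoeff m' p)) * mmap1 (fun i => mpolyX K' (mnm1 i)) m') =
    h (mcoeff m' p) * (m' == m)%:R.
  by rewrite mcoeffCM mmap1_id mcoeffX.
under eq_bigr do rewrite E.
have [mp|mp] := boolP (m \in msupp p).
  rewrite (bigD1_seq m) ?msupp_uniq //= eqxx mulr1 big1 ?addr0 // => m' nm.
  by rewrite (negbTE nm) mulr0.
rewrite (memN_msupp_eq0 mp) h0 big_seq big1 // => m' m'p.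
case: eqP => [e|_]; last by rewrite mulr0.
by rewrite -e m'p in mp.
Qed.

Variable h : {rmorphism K -> K'}.
Implicit Types F G : spoly K n d.

Lemma smapD F G : smap h (F + G) = smap h F + smap h G.
Proof. by apply/ffunP => S; rewrite !ffunE raddfD. Qed.
Lemma smap0 : smap h 0 = 0.
Proof. by apply/ffunP => S; rewrite !ffunE raddf0. Qed.
Lemma smapN F : smap h (- F) = - smap h F.
Proof. by apply/ffunP => S; rewrite !ffunE raddfN. Qed.
Lemma map_mpoly_signM (e : nat) (p : mpoly n K) :
  map_mpoly h ((-1) ^+ e * p) = (-1) ^+ e * map_mpoly h p.
Proof.
rewrite -[in LHS]signr_odd -[in RHS]signr_odd !mulr_sign.
by case: (odd e); rewrite ?raddfN.
Qed.
Lemma smapM F G : smap h (smul F G) = smul (smap h F) (smap h G).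
Proof.
apply/ffunP => S; rewrite !ffunE raddf_sum; apply: eq_bigr => A _ /=.
by rewrite map_mpoly_signM rmorphM !ffunE.
Qed.
Lemma smap_sderiv_p i F : smap h (sderiv_p i F) = sderiv_p i (smap h F).
Proof.
apply/ffunP => S; rewrite !ffunE; apply/mpolyP => m.
by rewrite mcoeff_map_mpoly !mcoeff_deriv mcoeff_map_mpoly raddfMn.
Qed.
Lemma smap_sderivl s F : smap h (sderivl s F) = sderivl s (smap h F).
Proof.
apply/ffunP => S; rewrite !ffunE; case: ifP; rewrite ?raddf0 // => _.
by rewrite map_mpoly_signM.
Qed.
Lemma smap_sderivr s F : smap h (sderivr s F) = sderivr s (smap h F).
Proof.
apply/ffunP => S; rewrite !ffunE; case: ifP; rewrite ?raddf0 // => _.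
by rewrite map_mpoly_signM.
Qed.
Lemma smap_ogen s : smap h (ogen K n s) = ogen K' n s.
Proof. by apply/ffunP => S; rewrite !ffunE; case: ifP; rewrite ?raddf0 ?rmorph1. Qed.
Lemma smap_scaleC c F :
  smap h (c *: F) = h c *: smap h F.
Proof. by apply/ffunP => S; rewrite !ffunE map_mpolyZ. Qed.
End CoefficientMap.

Section BracketFormula.
Variables (K : comNzRingType) (n d : nat) (Dx : 'I_n -> {additive K -> K}).

Lemma sbr_sum_formula (F G : spoly K n d) :
  sbr Dx F G = \sum_(i < n) (smul (sderiv_p i F) (dx Dx i G) -
     smul (dx Dx i F) (sderiv_p i G)) +
   \sum_(j < d) (smul (sderivr (theta_idx j) F) (sderivl (xi_idx j) G) +
     smul (sderivr (xi_idx j) F) (sderivl (theta_idx j) G)).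
Proof.
have dlS s (H : spoly K n d) : dl s H = sderivl s H by rewrite /dl locked_withE.
have dpS i (H : spoly K n d) : dp i H = sderiv_p i H.
  by apply/ffunP => S; rewrite /dp liftDE ffunE.
rewrite sbrE; congr (_ + _).
  by apply: eq_bigr => i _; rewrite !sringM !dpS.
rewrite big_split_ord /= -big_split; apply: eq_bigr => j _ /=.
by rewrite !sringM sdual_l sdual_r -!sderivr_dl !dlS.
Qed.
End BracketFormula.

Section Representation.
Variables (R : realType) (n d : nat) (P : pointed_open R n).
Notation rV := 'rV[R]_n.
Notation V := (popen P).
Notation K := (smoothfun P).
Notation locfun := (locfun R n d).
Implicit Types (F G : locfun) (Ft Gt : spoly K n d).

Definition feval (w : rV) (f : rV -> R) : R := f w.
Lemma feval_zmod w : zmod_morphism (feval w). Proof. by []. Qed.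
HB.instance Definition _ w :=
  GRing.isZmodMorphism.Build (rV -> R) R (feval w) (@feval_zmod w).
Lemma feval_monoid w : monoid_morphism (feval w). Proof. by []. Qed.
HB.instance Definition _ w :=
  GRing.isMonoidMorphism.Build (rV -> R) R (feval w) (@feval_monoid w).

Lemma levalE w F : leval w F = smap (feval w) F. Proof. by []. Qed.

(** Ft is the expression of F on V, with coefficients in the ring of smooth
    functions on V.  Equality is required pointwise on V, the values of the
    coefficients of F elsewhere being irrelevant. *)
Definition rep F Ft := forall w (Vw : V w), leval w F = smap (sf_eval Vw) Ft.

Lemma rep_coef F Ft S m : rep F Ft ->
  forall w, V w -> mcoeff m (F S) w = mcoeff m (Ft S) w.
Proof.
move=> rF w Vw; have := rF w Vw; rewrite levalE => /ffunP/(_ S)/(congr1 (mcoeff m)).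
by rewrite [in LHS]ffunE [in RHS]ffunE !mcoeff_map_mpoly.
Qed.

Lemma repD F G Ft Gt : rep F Ft -> rep G Gt -> rep (F + G) (Ft + Gt).
Proof. by move=> rF rG w Vw; rewrite levalE !smapD -!levalE rF rG. Qed.
Lemma rep0 : rep 0 0.
Proof. by move=> w Vw; rewrite levalE !smap0. Qed.
Lemma repN F Ft : rep F Ft -> rep (- F) (- Ft).
Proof. by move=> rF w Vw; rewrite levalE !smapN -!levalE rF. Qed.
Lemma repB F G Ft Gt : rep F Ft -> rep G Gt -> rep (F - G) (Ft - Gt).
Proof. by move=> rF rG; apply: repD => //; exact: repN. Qed.
Lemma rep_sum (J : Type) (r : seq J) (F : J -> locfun) (Ft : J -> spoly K n d) :
  (forall j, rep (F j) (Ft j)) -> rep (\sum_(j <- r) F j) (\sum_(j <- r) Ft j).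
Proof.
by move=> rF; elim/big_ind2: _ => // *; [exact: rep0 | exact: repD].
Qed.
Lemma repM F G Ft Gt : rep F Ft -> rep G Gt -> rep (lmul F G) (smul Ft Gt).
Proof. by move=> rF rG w Vw; rewrite levalE !smapM -!levalE rF rG. Qed.
Lemma rep_sderiv_p i F Ft : rep F Ft -> rep (sderiv_p i F) (sderiv_p i Ft).
Proof. by move=> rF w Vw; rewrite levalE !smap_sderiv_p -!levalE rF. Qed.
Lemma rep_sderivl s F Ft : rep F Ft -> rep (sderivl s F) (sderivl s Ft).
Proof. by move=> rF w Vw; rewrite levalE !smap_sderivl -!levalE rF. Qed.
Lemma rep_sderivr s F Ft : rep F Ft -> rep (sderivr s F) (sderivr s Ft).
Proof. by move=> rF w Vw; rewrite levalE !smap_sderivr -!levalE rF. Qed.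
Lemma rep_ogen s : rep (ogen _ n s) (ogen _ n s).
Proof. by move=> w Vw; rewrite levalE !smap_ogen. Qed.

Lemma partial0 (i : 'I_n) : partial i (0 : rV -> R) = 0.
Proof. by apply/funext => v; exact: derive_cst. Qed.

Lemma rep_lderiv_x i F Ft : rep F Ft ->
  rep (lderiv_x i F) (dx (@sf_der _ _ P) i Ft).
Proof.
move=> rF w Vw; apply/ffunP => S; apply/mpolyP => m.
rewrite levalE [in LHS]ffunE [in RHS]ffunE !mcoeff_map_mpoly ffunE liftDE.
rewrite /= [in RHS]mcoeff_map_mpoly0 ?raddf0 //.
rewrite [in LHS]mcoeff_map_mpoly0 ?partial0 //.
rewrite [RHS]sf_derE //; apply: (partial_eq_on i (@popen_open _ _ P) _ Vw).
exact: rep_coef.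
Qed.

Lemma rep_bracket F G Ft Gt : rep F Ft -> rep G Gt ->
  rep (lbracket F G) (sbr (@sf_der _ _ P) Ft Gt).
Proof.
move=> rF rG; rewrite sbr_sum_formula; apply: repD; apply: rep_sum => i.
  by apply: repB; apply: repM; first [exact: rep_sderiv_p | exact: rep_lderiv_x].
by apply: repD; apply: repM; first [exact: rep_sderivl | exact: rep_sderivr].
Qed.

Lemma rep_scale r F Ft : rep F Ft ->
  rep ((fun=> r : R) *: F) (gconst n d (sf_cst P r) * (Ft : sring K n d)).
Proof.
move=> rF w Vw; rewrite levalE smap_scaleC -levalE rF; apply/ffunP => S.
rewrite [RHS]ffunE scst_mulE mul_mpolyC map_mpolyZ !ffunE; congr (_ *: _).
by rewrite /sf_eval [RHS]restrE.
Qed.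

Lemma rep_uniq F Ft Gt : rep F Ft -> rep F Gt -> Ft = Gt.
Proof.
move=> rF rG; apply/ffunP => S; apply/mpolyP => m; apply: sfun_inj => w Vw.
by rewrite -(rep_coef S m rF Vw) (rep_coef S m rG Vw).
Qed.

Lemma rep_leval F G Ft : (forall w, V w -> leval w F = leval w G) -> rep F Ft -> rep G Ft.
Proof. by move=> FG rF w Vw; rewrite -FG // rF. Qed.

Lemma rep0_leval F w : rep F 0 -> V w -> leval w F = 0.
Proof. by move=> rF Vw; rewrite (rF w Vw) smap0. Qed.

Lemma rep_exists F : (forall S m, smooth_on V (mcoeff m (F S))) -> exists Ft, rep F Ft.
Proof.
move=> sF.
pose g (f : rV -> R) : K :=
  if pselect (smooth_on V f) is left sf then restr sf else 0.
have gE f w : smooth_on V f -> V w -> g f w = f w.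
  by move=> sf Vw; rewrite /g; case: pselect => // sf'; exact: restrE.
have g0 : g 0 = 0.
  apply: sfun_inj => w Vw; rewrite gE //; last exact: smooth_cst.
  exact: (esym (raddf0 (sf_eval Vw))).
exists [ffun S => map_mpoly g (F S)] => w Vw; apply/ffunP => S; apply/mpolyP => m.
rewrite levalE [in LHS]ffunE [in RHS]ffunE !mcoeff_map_mpoly ffunE.
by rewrite mcoeff_map_mpoly0 //; exact: (esym (gE _ _ (sF S m) Vw)).
Qed.

Lemma rep_shomog k l F Ft : rep F Ft -> (forall w, V w -> shomog k l (leval w F)) ->
  shomog k l Ft.
Proof.
move=> rF hF S m nz.
have [w Vw nzw] : exists2 w, V w & mcoeff m (Ft S) w != 0.
  apply: contrapT => H; move/eqP: nz; apply; apply: smoothfunP => w Vw.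
  rewrite raddf0; apply/eqP/negPn/negP => nz; apply: H; exists w => //.
apply: (hF w Vw S m); rewrite levalE ffunE mcoeff_map_mpoly.
by rewrite [X in X != 0](rep_coef S m rF Vw).
Qed.

End Representation.

(** * Cutting off functions on the manifold *)
Section Charts.
Variables (R : realType) (n : nat) (M : manifold R n).
Notation rV := 'rV[R]_n.
Implicit Types (U W : set M).

Lemma mcoordK (c : mchart M) x : mdom c x -> mparam c (mcoord c x) = x.
Proof. exact: m_coordK. Qed.

Lemma open_chart_image (c : mchart M) U : open U -> open (mcoord c @` (U `&` mdom c)).
Proof.
move=> oU; have oc : open (mcoord c @` mdom c) by exact: m_open_cod.
have cp := @m_param_continuous _ _ M c.
rewrite continuous_open_subspace // in cp.
rewrite openE => v [x [Ux dx] <-].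
have Vv : (mcoord c @` mdom c) (mcoord c x) by exists x.
have nU : nbhs (mparam c (mcoord c x)) U.
  by rewrite mcoordK //; exact: open_nbhs_nbhs.
have := cp (mcoord c x); rewrite inE => /(_ Vv)/(_ _ nU) => nU'.
have nV : nbhs (mcoord c x) (mcoord c @` mdom c) by exact: open_nbhs_nbhs.
rewrite /interior /=.
apply: (@filterS _ _ _ _ _ _ (@filterI _ (nbhs (mcoord c x)) _ _ _ nU' nV)) => w /= [Uw [y dy yw]].
by exists y => //; split => //; rewrite -(mcoordK dy) yw.
Qed.

End Charts.

Section Cutoff.
Variables (R : realType) (n d : nat) (M : manifold R n) (A : vbundle M d).
Notation rV := 'rV[R]_n.
Implicit Types (c : lcoord A).

Lemma open_ldom c : open (ldom c).
Proof. by apply: openI; [exact: m_open_dom | exact: v_open_dom]. Qed.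

Lemma ldom_image c (U : set M) :
  mcoord c.1 @` (U `&` ldom c) = mcoord c.1 @` ((U `&` vdom c.2) `&` mdom c.1).
Proof. by rewrite /ldom [mdom _ `&` _]setIC setIA. Qed.

Lemma open_image_ldom c (U : set M) : open U -> open (mcoord c.1 @` (U `&` ldom c)).
Proof.
move=> oU; rewrite ldom_image; apply: open_chart_image.
by apply: openI => //; exact: v_open_dom.
Qed.

Lemma open_lcod c : open (lcod c).
Proof.
by rewrite /lcod -[ldom c]setTI; apply: open_image_ldom; exact: openT.
Qed.

Definition box (a : rV) (r : R) : set rV := [set v | forall i, `|v 0 i - a 0 i| <= r].

Lemma compact_box (a : rV) (r : R) : compact (box a r).
Proof.
have -> : box a r = [set v : rV | forall i, `[a 0 i - r, a 0 i + r]%classic (v 0 i)].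
  apply/seteqP; split=> v /= H i; have := H i; rewrite /= in_itv /=.
    by rewrite ler_distl.
  by rewrite -ler_distl.
exact: (@rV_compact _ n (fun i => `[a 0 i - r, a 0 i + r]%classic)
  (fun i => @segment_compact _ _ _)).
Qed.

Variables (c : lcoord A) (a : rV) (r : R).
Hypotheses (r0 : 0 < r) (box_cod : box a (r *+ 2) `<=` lcod c).

(** It contains the support of [rho].  As the image of a compact set in a Hausdorff
    space it is closed in M. *)
Definition cube : set M := mparam c.1 @` box a (r *+ 2).
(** The bump function around a, seen on M and extended by 0 outside the chart. *)
Definition rho (y : M) : R := if `[< mdom c.1 y >] then bump_fun a r (mcoord c.1 y) else 0.

Lemma cube_ldom : cube `<=` ldom c.
Proof. by move=> y [v /box_cod[x [dx vx] <-] <-]; rewrite mcoordK. Qed.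

Lemma closed_cube : closed cube.
Proof.
apply: compact_closed; first exact: m_hausdorff.
apply: continuous_compact; last exact: compact_box.
apply: continuous_subspaceW (@m_param_continuous _ _ M c.1).
by move=> v /box_cod[x [dx _] <-]; exists x.
Qed.

Lemma rho_out y : ~ cube y -> rho y = 0.
Proof.
move=> ny; rewrite /rho; case: asboolP => // dy.
have [i hi] : exists i, r *+ 2 < `|mcoord c.1 y 0 i - a 0 i|.
  apply: contrapT => H; apply: ny; exists (mcoord c.1 y); last exact: mcoordK.
  by move=> i; rewrite leNgt; apply/negP => hi; apply: H; exists i.
exact: (bump_eq0 r0 (ltW hi)).
Qed.

(** Each point of M is in the domain of c, where u is smooth, or in the complement
    of [cube], which is open and where u vanishes. *)
Lemma smooth_zero_outside c' (u : M -> R) :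
  (forall y, ~ cube y -> u y = 0) ->
  smooth_on (mcoord c'.1 @` (ldom c `&` ldom c')) (u \o mparam c'.1) ->
  smooth_on (lcod c') (u \o mparam c'.1).
Proof.
move=> u0 su; apply: smooth_local => v [x lx <-].
have [cx|ncx] := pselect (ldom c x).
  exists (mcoord c'.1 @` (ldom c `&` ldom c')); split=> //; last by exists x.
  exact/open_image_ldom/open_ldom.
exists (mcoord c'.1 @` (~` cube `&` ldom c')).
have oW : open (mcoord c'.1 @` (~` cube `&` ldom c')).
  by apply: open_image_ldom; apply: closed_openC; exact: closed_cube.
split=> //; first by exists x => //; split=> // /cube_ldom.
apply: (smooth_eq oW _ (@smooth_cst _ _ _ 0)) => w [y [ny [dy _]] <-] /=.
by rewrite mcoordK // u0.
Qed.

Lemma smooth_transition c' j :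
  smooth_on (mcoord c'.1 @` (ldom c `&` ldom c'))
    (fun w => mcoord c.1 (mparam c'.1 w) 0 j).
Proof.
apply: smooth_sub (@m_transition _ _ M c'.1 c.1 j).
by move=> w [y [[dy _] [dy' _]] <-]; exists y.
Qed.

Lemma smooth_rho c' :
  smooth_on (mcoord c'.1 @` (ldom c `&` ldom c')) (rho \o mparam c'.1).
Proof.
have oW : open (mcoord c'.1 @` (ldom c `&` ldom c')).
  exact/open_image_ldom/open_ldom.
have sb : smooth_on (mcoord c'.1 @` (ldom c `&` ldom c'))
    (bump_fun a r \o (fun w => mcoord c.1 (mparam c'.1 w))).
  by refine (smooth_comp oW openT _ (@smooth_transition c') (smooth_bump a r openT)).
refine (smooth_eq oW _ sb) => w [y [[dy _] [dy' _]] <-] /=.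
by rewrite mcoordK // /rho asboolT.
Qed.

Lemma smooth_rhoM c' (u : M -> R) :
  smooth_on (mcoord c'.1 @` (ldom c `&` ldom c')) (u \o mparam c'.1) ->
  smooth_on (lcod c') ((fun y => rho y * u y) \o mparam c'.1).
Proof.
move=> su; apply: smooth_zero_outside => [y /rho_out->|]; first by rewrite mul0r.
have oW : open (mcoord c'.1 @` (ldom c `&` ldom c')).
  exact/open_image_ldom/open_ldom.
exact: smoothM oW (@smooth_rho c') su.
Qed.

Lemma rho_eq1 w : box a r w -> rho (mparam c.1 w) = 1.
Proof.
move=> bw; have [x [dx _] xw] : lcod c w.
  apply: box_cod => i; apply: le_trans (bw i) _.
  by rewrite mulr2n lerDl ltW.
rewrite -xw mcoordK // /rho asboolT // xw; exact: bump_eq1.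
Qed.

Definition coord_fun j (y : M) : R := rho y * mcoord c.1 y 0 j.

Lemma smooth_coord_fun c' j : smooth_on (lcod c') (coord_fun j \o mparam c'.1).
Proof. exact/smooth_rhoM/smooth_transition. Qed.

Definition frame_section b (y : M) : vfibre A y := rho y *: tnth (vframe c.2 y) b.

Lemma frame_section_coord c' b e y :
  coord (vframe c'.2 y) e (frame_section b y) =
  rho y * coord (vframe c'.2 y) e (tnth (vframe c.2 y) b).
Proof. by rewrite /frame_section linearZ. Qed.

Lemma smooth_frame_section c' b e : smooth_on (lcod c')
  ((fun y => coord (vframe c'.2 y) e (frame_section b y)) \o mparam c'.1).
Proof.
under [X in X \o _]eq_fun do rewrite frame_section_coord.
apply: smooth_rhoM; apply: smooth_sub (@v_transition _ _ _ _ A c'.2 c.2 b e c'.1).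
by move=> w [y [[_ dy] [dy' vy']] <-]; exists y.
Qed.

End Cutoff.

(** * Functions on M and sections of A as elements of F_A *)
Section MomentumFree.
Variables (K : comNzRingType) (n d : nat).
Notation I := 'I_(d + d).

(** Elements without momenta: the transformation of the p^i under a change of
    coordinates does not enter ([ssubst_momfree]). *)
Definition momfree (u : {set I} -> K) : spoly K n d := [ffun S => mpolyC n (u S)].
Definition fun_part (r : K) (S : {set I}) : K := if S == finset.set0 then r else 0.
Definition sec_part (s : 'I_d -> K) (S : {set I}) : K :=
  \sum_a (if S == [set theta_idx a]%SET then s a else 0).

Lemma mcoeff_momfree u S m :
  mcoeff m (momfree u S) = if m == mnm0 then u S else 0.
Proof. by rewrite ffunE mcoeffC; case: eqP => _; rewrite ?mulr1 ?mulr0. Qed.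

Lemma ssubst_momfree p' e' u :
  ssubst p' e' (momfree u) = \sum_S u S *: \big[@smul K n d/sone K n d]_(s in S) e' s.
Proof.
apply: eq_bigr => S _; rewrite ffunE msuppC.
have [->|_] := eqVneq; first by rewrite big_nil scale0r.
rewrite big_seq1 mcoeffC eqxx mulr1; congr (_ *: _).
suff -> : \big[@smul K n d/sone K n d]_(i < n) iter (fun_of_multinom mnm0 i) (smul (p' i)) (sone K n d)
  = sone K n d by rewrite smul1s.
by elim/big_rec: _ => // i F _ ->; rewrite mnm0E smul1s.
Qed.

Lemma momfree_fun r : momfree (fun_part r) = r *: sone K n d.
Proof.
apply/ffunP => S; rewrite !ffunE /fun_part; case: ifP => _.
  by rewrite -mul_mpolyC mulr1.
by rewrite scaler0 mpolyC0.
Qed.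

Lemma momfree_sec s : momfree (sec_part s) = \sum_a s a *: theta K n a.
Proof.
apply/ffunP => S; rewrite !ffunE sum_ffunE /sec_part raddf_sum.
apply: eq_bigr => a _ /=; rewrite !ffunE; case: ifP => _.
  by rewrite -mul_mpolyC mulr1.
by rewrite scaler0 mpolyC0.
Qed.

Lemma ssubst_fun p' e' r : ssubst p' e' (momfree (fun_part r)) = r *: sone K n d.
Proof.
rewrite ssubst_momfree (bigD1 finset.set0) //= big_set0 /fun_part eqxx big1 ?addr0 // => S.
by move/negbTE->; rewrite scale0r.
Qed.

Lemma ssubst_sec p' e' s :
  ssubst p' e' (momfree (sec_part s)) = \sum_a s a *: e' (theta_idx a).
Proof.
rewrite ssubst_momfree /sec_part; under eq_bigr do rewrite scaler_suml.
rewrite exchange_big; apply: eq_bigr => a _ /=.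
rewrite (bigD1 [set theta_idx a]%SET) //= eqxx big_set1E smuls1.
by rewrite big1 ?addr0 // => S /negbTE->; rewrite scale0r.
Qed.

Lemma shomog_fun r : shomog 0 0 (momfree (fun_part r)).
Proof.
move=> S m; rewrite mcoeff_momfree /fun_part; case: (m =P mnm0) => [->|]; last by rewrite eqxx.
case: (S =P finset.set0) => [->|_]; last by rewrite eqxx.
by move=> _; rewrite mdeg0; split; apply/eqP; rewrite cards_eq0;
  apply/eqP/setP => i; rewrite !inE.
Qed.

Lemma shomog_sec s : shomog 1 0 (momfree (sec_part s)).
Proof.
move=> S m; rewrite mcoeff_momfree; case: (m =P mnm0) => [->|]; last by rewrite eqxx.
rewrite /sec_part => nz.
have [a /eqP ->] : exists a, S == [set theta_idx a]%SET.
  apply/existsP; apply: contraR nz => /existsPn na.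
  by rewrite big1 // => a _; rewrite (negbTE (na a)).
rewrite mdeg0; split; first by rewrite (eq_card (B := pred1 a)) ?card1 // => i;
  rewrite !inE eq_lshift.
by apply/eqP; rewrite cards_eq0; apply/eqP/setP => i; rewrite !inE eq_rlshift.
Qed.

End MomentumFree.
Arguments momfree {K n d} u.

Section TestFamilies.
Variables (R : realType) (n d : nat) (M : manifold R n) (A : vbundle M d).
Notation rV := 'rV[R]_n.
Implicit Types (c : lcoord A).

Definition fun_family (u : M -> R) : bigfam A :=
  fun c => momfree (fun_part (fun v : rV => u (mparam c.1 v))).
Definition sec_coord (s : forall y, vfibre A y) c a (y : M) : R :=
  coord (vframe c.2 y) a (s y).
Definition sec_family (s : forall y, vfibre A y) : bigfam A :=
  fun c => momfree (sec_part (fun a (v : rV) => sec_coord s c a (mparam c.1 v))).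

Lemma leval_momfree (u : {set 'I_(d + d)} -> rV -> R) v :
  leval v (momfree u : locfun R n d) = momfree (fun S => u S v).
Proof.
apply/ffunP => S; rewrite !ffunE; apply/mpolyP => m.
by rewrite mcoeff_map_mpoly0 // !mcoeffC; case: eqP => _; rewrite ?mulr1 ?mulr0.
Qed.

Lemma leval_fun u c v : leval v (fun_family u c) = momfree (fun_part (u (mparam c.1 v))).
Proof. by rewrite leval_momfree; congr momfree; apply/funext => S; rewrite /fun_part; case: ifP. Qed.

Lemma leval_sec s c v :
  leval v (sec_family s c) = momfree (sec_part (fun a => sec_coord s c a (mparam c.1 v))).
Proof.
rewrite leval_momfree; congr momfree; apply/funext => S; rewrite /sec_part fct_sumE.
by apply: eq_bigr => a _; case: ifP.
Qed.

Lemma smooth_zero (V : set rV) : smooth_on V (0 : rV -> R).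
Proof. exact: smooth_cst. Qed.

Lemma bigF_fun u : (forall c, smooth_on (lcod c) (u \o mparam c.1)) ->
  bigF 0 0 (fun_family u).
Proof.
move=> su; split=> [c S m|c v _|c c' x [dx _] [dx' _]].
- rewrite mcoeff_momfree; case: ifP => _; last exact: smooth_zero.
  by rewrite /fun_part; case: ifP => _; [exact: (su c) | exact: smooth_zero].
- by rewrite leval_fun; exact: shomog_fun.
- by rewrite !leval_fun ssubst_fun !mcoordK // momfree_fun.
Qed.

(** This is how the components of a section change with the frame, and it is also
    the transformation law of the theta^a; so [sec_family] is compatible. *)
Lemma sec_change s c c' x b : ldom c' x ->
  sec_coord s c b x = \sum_a sec_coord s c' a x * frame_change c c' x a b.
Proof.
move=> [_ vx']; rewrite /sec_coord.
rewrite {1}(coord_basis (v_basis vx') (memvf (s x))) linear_sum.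
by apply: eq_bigr => a _; rewrite linearZ mxE (tnth_nth 0).
Qed.

Lemma bigF_sec s : (forall c a, smooth_on (lcod c) (sec_coord s c a \o mparam c.1)) ->
  bigF 1 0 (sec_family s).
Proof.
move=> ss; split=> [c S m|c v _|c c' x lx lx'].
- rewrite mcoeff_momfree; case: ifP => _; last exact: smooth_zero.
  rewrite /sec_part fct_sumE; apply: smooth_sum; first exact: open_lcod.
  by move=> a; case: ifP => _; [exact: ss | exact: smooth_zero].
- by rewrite leval_sec; exact: shomog_sec.
- have [dx _] := lx; have [dx' _] := lx'.
  rewrite !leval_sec ssubst_sec !mcoordK // momfree_sec.
  under [RHS]eq_bigr => a _ do rewrite /odd_change /theta_idx
    -/(unsplit (inl a)) unsplitK scaler_sumr.
  rewrite exchange_big; apply: eq_bigr => b _ /=.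
  rewrite (sec_change s c b lx') scaler_suml.
  by apply: eq_bigr => a _; rewrite scalerA.
Qed.

Lemma bigF_zero k : bigF k 0 (0 : bigfam A).
Proof.
have z c : (0 : bigfam A) c = 0 by [].
have lz v : leval v (0 : locfun R n d) = 0 by rewrite levalE smap0.
split=> [c S m|c v _ S m|c c' x _ _].
- by rewrite z ffunE mcoeff0; exact: smooth_zero.
- by rewrite z lz ffunE mcoeff0 eqxx.
- rewrite !z !lz /ssubst big1 // => S _; by rewrite ffunE msupp0 big_nil.
Qed.

Lemma multisection_bigF k (F : bigfam A) : bigF k 0 F -> multisection F.
Proof.
move=> hF; exists k.+1, (fun i => if i == k then F else 0); split.
  by move=> i; case: eqP => [->|_]; [exact: hF | exact: bigF_zero].
rewrite (bigD1 ord_max) //= eqxx big1 ?addr0 // => i ni.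
by rewrite ifF //; apply: contraNF ni => /eqP e; apply/eqP/val_inj.
Qed.

Lemma bigF_one : bigF 0 0 (fun_family (fun=> 1)).
Proof. by apply: bigF_fun => c; exact: smooth_cst. Qed.

End TestFamilies.
Arguments fun_family {R n d M} A u c.
Arguments sec_family {R n d M} A s c.

Section TestReps.
Variables (R : realType) (n d : nat) (M : manifold R n) (A : vbundle M d).
Variables (c : lcoord A) (a : 'rV[R]_n) (r : R).
Hypotheses (r0 : 0 < r) (box_cod : box a (r *+ 2) `<=` lcod c).

(** The coordinates x_i and the frame of c, cut off outside a neighbourhood of a:
    the global counterparts of [test]. *)
Definition test_family (u : 'I_n + 'I_d) : bigfam A :=
  match u with
  | inl i => fun_family A (coord_fun c a r i)
  | inr j => sec_family A (frame_section c a r j)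
  end.

Lemma bigF_test u : bigF (test_deg u) 0 (test_family u).
Proof.
case: u => j; first by apply: bigF_fun => c'; exact: smooth_coord_fun.
by apply: bigF_sec => c' b; exact: smooth_frame_section.
Qed.

Variable P : pointed_open R n.
Hypothesis PV : popen P `<=` box a r.

Lemma rep_one : rep (fun_family A (fun=> 1) c) (1 : sring (smoothfun P) n d).
Proof.
move=> w Vw; rewrite leval_fun; apply/ffunP => S; rewrite !ffunE /fun_part.
by case: ifP => _; rewrite ?rmorph1 ?raddf0.
Qed.

Lemma rep_test u : rep (test_family u c) (test (@sf_coord _ _ P) u).
Proof.
move=> w Vw; have bw := PV Vw; have r1 := rho_eq1 r0 box_cod bw.
have [x [dx vx] xw] : lcod c w.
  by apply: box_cod => i; apply: le_trans (bw i) _; rewrite mulr2n lerDl ltW.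
have Kw : mcoord c.1 (mparam c.1 w) = w by rewrite -xw mcoordK.
case: u => j /=.
  rewrite leval_fun /coord_fun r1 mul1r Kw; apply/ffunP => S; rewrite [RHS]ffunE scstE.
  rewrite ffunE /fun_part; case: ifP => _; last by rewrite !raddf0.
  by rewrite map_mpolyC; congr mpolyC; exact/esym/restrE.
rewrite leval_sec; apply/ffunP => S; rewrite [RHS]ffunE !ffunE /sec_part.
have E b : sec_coord (frame_section c a r j) c b (mparam c.1 w) = (j == b)%:R.
  rewrite /sec_coord frame_section_coord r1 mul1r -xw mcoordK //.
  have := coord_free j b (basis_free (v_basis vx)).
  by rewrite (tnth_nth 0).
rewrite (bigD1 j) //= big1 => [|b nb]; last first.
  by rewrite E [j == b]eq_sym (negbTE nb) if_same.
by rewrite addr0 E eqxx; case: ifP => _; rewrite ?rmorph1 ?raddf0.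
Qed.

End TestReps.

(** * The correspondence *)
Section DefectAdditive.
Variables (K : comNzRingType) (n d : nat) (Dx : 'I_n -> {additive K -> K}).
Variables (phi nu X M : sring K n d).
Implicit Types (F G H : sring K n d).

Lemma sgD (V : zmodType) e (x y : V) : sg e (x + y) = sg e x + sg e y.
Proof. by case: e; rewrite /sg // opprD. Qed.

Lemma sjdiffD F G : sjdiff Dx nu X (F + G) = sjdiff Dx nu X F + sjdiff Dx nu X G.
Proof. by rewrite /sjdiff sbrDr mulrDr; sring_linear. Qed.

Lemma sjbrDr F G H :
  sjbr Dx phi M F (G + H) = sjbr Dx phi M F G + sjbr Dx phi M F H.
Proof. by rewrite /sjbr !sbrDr !mulrDr; sring_linear. Qed.

Lemma sdefectDr e F G H : sdefect Dx phi nu X M e F (G + H) =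
  sdefect Dx phi nu X M e F G + sdefect Dx phi nu X M e F H.
Proof.
by rewrite /sdefect sjdiffD !sjbrDr sjdiffD sgD; sring_linear.
Qed.

Lemma sdefect0r e F : sdefect Dx phi nu X M e F 0 = 0.
Proof.
have := sdefectDr e F 0 0; rewrite addr0 => /(congr1 (fun G => G - sdefect Dx phi nu X M e F 0)).
by rewrite addrK subrr.
Qed.

End DefectAdditive.

Section LocalForms.
Variables (R : realType) (n d : nat) (M : manifold R n) (A : vbundle M d).
Variables (c : lcoord A) (P : pointed_open R n).
Hypothesis PV : popen P `<=` lcod c.
Notation K := (smoothfun P).
Notation der := (@sf_der _ _ P).
Notation sring := (sring K n d).
Implicit Types (F G : bigfam A) (Ft Gt : sring).

Lemma rep_mul (F G : locfun R n d) (Ft Gt : sring) : rep F Ft -> rep G Gt ->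
  rep (lmul F G) (Ft * Gt).
Proof. by move=> rF rG; rewrite sringM; exact: repM. Qed.

Lemma rep_idA : rep (idA A c) (sidA K n d).
Proof. by apply: rep_sum => j; apply: rep_mul; exact: rep_ogen. Qed.

Lemma rep_bigF k l F : bigF k l F -> exists2 Ft : sring, rep (F c) Ft & shomog k l Ft.
Proof.
case=> sF hF _; have [|Ft rF] := @rep_exists _ _ _ P (F c).
  by move=> S m; exact: smooth_sub PV (sF c S m).
by exists Ft => //; apply: (rep_shomog rF) => w /PV; exact: hF.
Qed.

Lemma rep_sum_nat N (G : nat -> bigfam A) (Gt : nat -> sring) :
  (forall i, rep (G i c) (Gt i)) ->
  rep ((\sum_(i < N) G i) c) (\sum_(i < N) Gt i).
Proof. by move=> rG; rewrite fct_sumE; apply: rep_sum => i; exact: rG. Qed.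

Lemma rep_multisection F : multisection F ->
  exists (N : nat) (Gt : nat -> sring), (forall i, shomog i 0 (Gt i)) /\
    rep (F c) (\sum_(i < N) Gt i).
Proof.
move=> [N [G [hG FG]]].
have /choice[Gt HGt] : forall i, exists Gt : sring, rep (G i c) Gt /\ shomog i 0 Gt.
  by move=> i; have [Gt rG sG] := rep_bigF (hG i); exists Gt.
exists N, Gt; split; first by move=> i; case: (HGt i).
apply: (@rep_leval _ _ _ _ ((\sum_(i < N) G i) c)).
  by move=> w /PV Vw; rewrite -FG.
by apply: rep_sum_nat => i; case: (HGt i).
Qed.

Lemma feq_rep F G Ft Gt : rep (F c) Ft -> rep (G c) Gt -> F ≡ G -> Ft = Gt.
Proof.
move=> rF rG FG; apply: rep_uniq rF (rep_leval _ rG) => w Vw.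
by rewrite FG //; exact: PV.
Qed.

Lemma rep_feq F G Ft w : rep (F c) Ft -> rep (G c) Ft -> popen P w ->
  leval w (F c) = leval w (G c).
Proof. by move=> rF rG Vw; rewrite (rF w Vw) (rG w Vw). Qed.

Lemma gconst_sign k (F : sring) :
  gconst n d (sf_cst P ((-1) ^+ k.+1)) * F = sg (~~ odd k) F.
Proof.
rewrite -signr_odd /=; case: (odd k) => /=.
  have -> : sf_cst P (1 : R) = 1 by [].
  by rewrite gconst1 mul1r.
have -> : sf_cst P (-1 : R) = -1.
  apply: smoothfunP => w Vw; transitivity (-1 : R); first exact: restrE.
  by rewrite (rmorphN (sf_eval Vw)) (rmorph1 (sf_eval Vw)).
by rewrite /gconst !raddfN /= -/(gconst n d 1) gconst1 mulN1r.
Qed.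

Variables (mu phi nu X : bigfam A) (mut phit nut Xt : sring).
Hypotheses (rmu : rep (mu c) mut) (rphi : rep (phi c) phit)
           (rnu : rep (nu c) nut) (rX : rep (X c) Xt).

Lemma rep_jdiff F Ft : rep (F c) Ft -> rep (jdiff nu X F c) (sjdiff der nut Xt Ft).
Proof. by move=> rF; apply: repD; [exact: rep_bracket | exact: rep_mul]. Qed.

Lemma rep_jbracket F G Ft Gt : rep (F c) Ft -> rep (G c) Gt ->
  rep (jbracket mu phi F G c) (sjbracket der mut phit Ft Gt).
Proof.
move=> rF rG; have rM : rep ((mu + idA A ⋆ phi) c) (mut + sidA K n d * phit).
  by apply: repD => //; apply: rep_mul => //; exact: rep_idA.
apply: repD; last by apply: rep_mul => //; exact: rep_bracket.
apply: repB; first by apply: rep_bracket => //; exact: rep_bracket.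
by apply: rep_mul => //; exact: rep_bracket.
Qed.

Lemma rep_diamond : rep (diamond phi X c) (sdiamond der phit Xt).
Proof. exact: rep_bracket. Qed.

Lemma rep_club : rep (club mu phi nu X c) (sclub der mut phit nut Xt).
Proof. by apply: repD; exact: rep_bracket. Qed.

Lemma rep_spade :
  rep (spade mu phi nu X c) (sspade der mut phit nut Xt (sf_cst P 2^-1)).
Proof.
apply: repB; first by do ?apply: repD; [exact: rep_bracket | exact: rep_mul..].
apply: rep_mul; first exact: rep_idA.
apply: repD; first by apply: repN; exact: rep_mul.
by apply: rep_scale; apply: repB; exact: rep_bracket.
Qed.

Lemma rep_rhs k a b at_ bt : rep (a c) at_ -> rep (b c) bt ->
  rep ((jbracket mu phi (jdiff nu X a) b +
        fscale ((-1) ^+ k.+1) (jbracket mu phi a (jdiff nu X b))) c)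
    (sjbracket der mut phit (sjdiff der nut Xt at_) bt +
      sg (~~ odd k) (sjbracket der mut phit at_ (sjdiff der nut Xt bt))).
Proof.
move=> ra rb; apply: repD; first by apply: rep_jbracket => //; exact: rep_jdiff.
rewrite -gconst_sign; apply: rep_scale.
by apply: rep_jbracket => //; exact: rep_jdiff.
Qed.

End LocalForms.

Section Correspondence.
Variables (R : realType) (n d : nat) (M : manifold R n) (A : vbundle M d).
Variables (mu phi nu X : bigfam A).
Hypotheses (hmu : bigF 1 2 mu) (hphi : bigF 0 1 phi)
           (hnu : bigF 2 1 nu) (hX : bigF 1 0 X).

(** The derivation rule in the definition of a pre-Jacobi bialgebroid. *)
Definition compatible_brackets : Prop :=
  forall k (a b : bigfam A), bigF k 0 a -> multisection b ->
    jdiff nu X (jbracket mu phi a b) ≡ jbracket mu phi (jdiff nu X a) b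
      + fscale ((-1) ^+ k.+1) (jbracket mu phi a (jdiff nu X b)).

Lemma zero_feq (F : bigfam A) : (forall c v, lcod c v ->
   exists P : pointed_open R n, [/\ popen P `<=` lcod c, popen P v & rep (F c) (0 : sring (smoothfun P) n d)])
   -> F ≡ (0 : bigfam A).
Proof.
move=> H c v Vv; have [P [_ Pv r0]] := H c v Vv.
by rewrite (rep0_leval r0 Pv) levalE smap0.
Qed.

(** Near any point all data have expressions over one ring of functions, where
    [defect_eq0] applies to the homogeneous components of b. *)
Lemma obstructions_compatible : diamond phi X ≡ 0 -> club mu phi nu X ≡ 0 ->
  spade mu phi nu X ≡ 0 -> compatible_brackets.
Proof.
move=> d0 c0 s0 k a b ha hb c v Vv.
pose P := PointedOpen (@open_lcod _ _ _ _ A c) Vv.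
have PV : popen P `<=` lcod c by [].
have [mut rmu smu] := rep_bigF PV hmu; have [phit rphi sphi] := rep_bigF PV hphi.
have [nut rnu snu] := rep_bigF PV hnu; have [Xt rX sX] := rep_bigF PV hX.
have [at_ ra sa] := rep_bigF PV ha.
have [N [bt [sb rb]]] := rep_multisection PV hb.
have rz : rep ((0 : bigfam A) c) (0 : sring (smoothfun P) n d) by exact: rep0.
have d0t := feq_rep PV (rep_diamond rphi rX) rz d0.
have c0t := feq_rep PV (rep_club rmu rphi rnu rX) rz c0.
have s0t := feq_rep PV (rep_spade rmu rphi rnu rX) rz s0.
have D0 : sdefect (@sf_der _ _ P) phit nut Xt (mut + sidA _ n d * phit) (odd k) at_
    (\sum_(i < N) bt i) = 0.
  elim/big_rec: _ => [|i F _ DF]; first exact: sdefect0r.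
  rewrite sdefectDr DF addr0.
  exact: (defect_eq0 (@sf_derM _ _ P) (@sf_derC _ _ P) smu sphi snu sX (sf_half P) sa
    (sb i) d0t c0t s0t).
move: D0 => /eqP; rewrite subr_eq0 => /eqP E.
apply: (rep_feq (P := P) (Ft := sjdiff (@sf_der _ _ P) nut Xt
  (sjbracket (@sf_der _ _ P) mut phit at_ (\sum_(i < N) bt i))) _ _ Vv).
  by apply: rep_jdiff => //; exact: rep_jbracket.
by rewrite [X in rep _ X]E; exact: rep_rhs.
Qed.

Lemma nbhs_box (v : 'rV[R]_n) (W : set 'rV[R]_n) : open W -> W v ->
  exists r, [/\ 0 < r, box v (r *+ 2) `<=` W & interior (box v r) v].
Proof.
move=> oW Wv; have [e e0 He] := box_nbhs (near_open oW Wv).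
exists (e / 3); split; first by rewrite divr_gt0.
  by move=> w bw; apply: He => i; apply: le_lt_trans (bw i) _; lra.
apply/nbhs_ballP; exists (e / 3); first by rewrite /= divr_gt0.
move=> w [_ Hw] i; have := Hw 0 i; rewrite /ball /= distrC; exact: ltW.
Qed.

(** The neighbourhood P of v is where the cut-off functions are 1; the larger cube
    contains their supports. *)
Lemma local_test_ring (c : lcoord A) v : lcod c v -> exists (P : pointed_open R n) (r : R),
  [/\ 0 < r, box v (r *+ 2) `<=` lcod c, popen P `<=` box v r, popen P `<=` lcod c
    & popen P v].
Proof.
move=> Vv; have [r [r0 bW iv]] := nbhs_box (@open_lcod _ _ _ _ A c) Vv.
exists (PointedOpen (@open_interior _ (box v r)) iv), r; split=> //=.
  exact: interior_subset.
apply: subset_trans (@interior_subset _ _) _ => w bw; apply: bW => i.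
by apply: le_trans (bw i) _; rewrite mulr2n lerDl ltW.
Qed.

(** Near a given point the derivation rule for 1 and the global [test_family] is
    the vanishing of the defect on 1 and [test]. *)
Lemma compatible_obstructions : compatible_brackets ->
  [/\ diamond phi X ≡ 0, club mu phi nu X ≡ 0 & spade mu phi nu X ≡ 0].
Proof.
move=> comp.
suff H c v : lcod c v -> exists P : pointed_open R n,
    [/\ popen P `<=` lcod c, popen P v, rep (diamond phi X c) (0 : sring (smoothfun P) n d),
     rep (club mu phi nu X c) (0 : sring (smoothfun P) n d) &
     rep (spade mu phi nu X c) (0 : sring (smoothfun P) n d)].
  by split; apply: zero_feq => c v /H[P [PV Pv ? ? ?]]; exists P; split.
move=> Vv; have [P [r [r0 bW Pb PV Pv]]] := local_test_ring Vv; exists P.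
have [mut rmu smu] := rep_bigF PV hmu; have [phit rphi sphi] := rep_bigF PV hphi.
have [nut rnu snu] := rep_bigF PV hnu; have [Xt rX sX] := rep_bigF PV hX.
have D k l a b at_ bt : bigF k 0 a -> bigF l 0 b -> rep (a c) at_ -> rep (b c) bt ->
    sdefect (@sf_der _ _ P) phit nut Xt (mut + sidA _ n d * phit) (odd k) at_ bt = 0.
  move=> ha hb ra rb; apply/eqP; rewrite subr_eq0; apply/eqP.
  apply: (feq_rep PV _ _ (comp k a b ha (multisection_bigF hb))).
    by apply: rep_jdiff => //; exact: rep_jbracket.
  exact: rep_rhs.
have rt u := @rep_test _ _ _ _ _ c v r r0 bW P Pb u.
have r1 := @rep_one _ _ _ _ A c P.
have ht u := @bigF_test _ _ _ _ _ c v r r0 bW u.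
have [d0 c0 s0] := tested_defect_eq0 (@sf_derM _ _ P) (@sf_derC _ _ P) smu sphi snu sX
  (sf_half P) (@sf_torsion_free _ _ P) (@sf_der_coord _ _ P)
  (D _ _ _ _ _ _ (bigF_one A) (bigF_one A) r1 r1)
  (fun u => D _ _ _ _ _ _ (bigF_one A) (ht u) r1 (rt u))
  (fun u v => D _ _ _ _ _ _ (ht u) (ht v) (rt u) (rt v)).
split=> //; first by rewrite -d0; exact: rep_diamond.
  by rewrite -c0; exact: rep_club.
by rewrite -s0; exact: rep_spade.
Qed.

Lemma rep_nuX c P (nut Xt : sring (smoothfun P) n d) : rep (nu c) nut -> rep (X c) Xt ->
  rep (⦃nu + X, nu + X⦄ c) (sbr (@sf_der _ _ P) (nut + Xt) (nut + Xt)).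
Proof. by move=> rnu rX; apply: rep_bracket; exact: repD. Qed.

Lemma square_zero_diff : ⦃nu + X, nu + X⦄ ≡ 0 ->
  forall Q, multisection Q -> jdiff nu X (jdiff nu X Q) ≡ 0.
Proof.
move=> s0 Q hQ; apply: zero_feq => c v Vv.
pose P := PointedOpen (@open_lcod _ _ _ _ A c) Vv; exists P.
have PV : popen P `<=` lcod c by [].
split=> //.
have [nut rnu snu] := rep_bigF PV hnu; have [Xt rX sX] := rep_bigF PV hX.
have [N [Qt [_ rQ]]] := rep_multisection PV hQ.
have rz : rep ((0 : bigfam A) c) (0 : sring (smoothfun P) n d) by exact: rep0.
have E := feq_rep PV (rep_nuX rnu rX) rz s0.
rewrite -(jdiff2_eq0 (@sf_derM _ _ P) (@sf_derC _ _ P) snu sX (@sf_torsion_free _ _ P)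
  (\sum_(i < N) Qt i) E).
by apply: rep_jdiff => //; exact: rep_jdiff.
Qed.

Lemma diff_square_zero :
  (forall Q, multisection Q -> jdiff nu X (jdiff nu X Q) ≡ 0) ->
  ⦃nu + X, nu + X⦄ ≡ 0.
Proof.
move=> dd; apply: zero_feq => c v Vv.
have [P [r [r0 bW Pb PV Pv]]] := local_test_ring Vv; exists P; split=> //.
have [nut rnu snu] := rep_bigF PV hnu; have [Xt rX sX] := rep_bigF PV hX.
have rz : rep ((0 : bigfam A) c) (0 : sring (smoothfun P) n d) by exact: rep0.
have D k Q Qt : bigF k 0 Q -> rep (Q c) Qt ->
    sjdiff (@sf_der _ _ P) nut Xt (sjdiff (@sf_der _ _ P) nut Xt Qt) = 0.
  move=> hQ rQ; apply: (feq_rep PV _ rz (dd Q (multisection_bigF hQ))).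
  by apply: rep_jdiff => //; exact: rep_jdiff.
have rt u := @rep_test _ _ _ _ _ c v r r0 bW P Pb u.
have r1 := @rep_one _ _ _ _ A c P.
have ht u := @bigF_test _ _ _ _ _ c v r r0 bW u.
rewrite -(tested_jdiff2_eq0 (@sf_derM _ _ P) (@sf_derC _ _ P) snu sX
  (@sf_torsion_free _ _ P) (@sf_der_coord _ _ P) (D _ _ _ (bigF_one A) r1)
  (fun u => D _ _ _ (ht u) (rt u))).
exact: rep_nuX.
Qed.

End Correspondence.

Local Close Scope classical_set_scope.

Theorem theorem3p9 (R : realType) (n d : nat) (M : manifold R n)
    (A : vbundle M d) (mu phi nu X : bigfam A)
    (hmuphi : pre_jacobi_algebroid mu phi)
    (hnuX : pre_jacobi_algebroid_dual nu X) :
  (pre_jacobi_bialgebroid mu phi nu X <->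
     [/\ diamond phi X ≡ 0, club mu phi nu X ≡ 0 & spade mu phi nu X ≡ 0]) /\
  (jacobi_bialgebroid mu phi nu X <->
     [/\ diamond phi X ≡ 0, club mu phi nu X ≡ 0, spade mu phi nu X ≡ 0,
         ⦃mu + phi, mu + phi⦄ ≡ 0 & ⦃nu + X, nu + X⦄ ≡ 0]).
Proof.
have [[hmu hphi] [hnu hX]] := (hmuphi, hnuX).
have part1 : pre_jacobi_bialgebroid mu phi nu X <->
    [/\ diamond phi X ≡ 0, club mu phi nu X ≡ 0 & spade mu phi nu X ≡ 0].
  split=> [[_ _]|[d0 c0 s0]]; first exact: compatible_obstructions.
  exact: And3 hmuphi hnuX (obstructions_compatible hmu hphi hnu hX d0 c0 s0).
split; first exact: part1.
split=> [[/part1[d0 c0 s0] [_ mm] dd]|[d0 c0 s0 mm nn]].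
  exact: And5 d0 c0 s0 mm (diff_square_zero hnu hX dd).
have pre : pre_jacobi_bialgebroid mu phi nu X by apply/part1; exact: And3 d0 c0 s0.
exact: And3 pre (conj hmuphi mm) (square_zero_diff hnu hX nn).
Qed.
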